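(* Let $0<\delta\le1$, let $b\in L^\infty(\mathbb R^n)$ be a para-accretive function, and let $\{\theta_k\}_{k\in\mathbb Z}$ be a collection of Littlewood-Paley square function kernels such that $\Theta_kb=\Theta_k^*b=0$ for all $k\in\mathbb Z$. Assume also that $$\sum_{k\in\mathbb Z}M_b\Theta_kM_bf=bf$$ for every $f\in C_0^\delta$ such that $bf$ has mean zero, where the convergence holds in $L^p$ for some $1<p<\infty$. If $\phi\in C_0^\delta$ is such that $b\phi$ has mean zero, then $b\phi\in H^1$ and $$\sum_{k\in\mathbb Z}M_b\Theta_kM_b\phi=b\phi,$$ where the convergence holds in $H^1$.
   Context: All functions are complex-valued on $\mathbb R^n$. $M_bf=bf$. $C_0^\delta$ is the space of compactly supported $\delta$-H\''older continuous functions $\mathbb R^n\to\mathbb C$. $b\in L^\infty$ is para-accretive if $b^{-1}\in L^\infty$ and there is $c_0>0$ such that every cube $Q$ contains a sub-cube $R\subset Q$ with $\frac1{|Q|}\left|\int_Rb(x)\,dx\right|\ge c_0$. For $N>0$, $k\in\mathbb Z$: $\Phi_k^N(x)=\dfrac{2^{kn}}{(1+2^k|x|)^N}$. A collection of Littlewood-Paley square function kernels is a family of functions $\theta_k:\mathbb R^{2n}\to\mathbb C$, $k\in\mathbb Z$, for which there exist $A>0$, $N>n$, $0<\gamma\le1$ such that for all $x,y,y'\in\mathbb R^n$ and $k\in\mathbb Z$: $|\theta_k(x,y)|\le A\Phi_k^{N+\gamma}(x-y)$ and $|\theta_k(x,y)-\theta_k(x,y')|\le A(2^k|y-y'|)^\gamma\left(\Phi_k^{N+\gamma}(x-y)+\Phi_k^{N+\gamma}(x-y')\right)$.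 The operators are $\Theta_kf(x)=\int_{\mathbb R^n}\theta_k(x,y)f(y)\,dy$ for $f\in L^1+L^\infty$, and $\Theta_k^*f(x)=\int_{\mathbb R^n}\theta_k(y,x)f(y)\,dy$. $H^1$ is the Hardy space with norm $\|f\|_{H^1}=\|f\|_{L^1}+\sum_{\ell=1}^n\|R_\ell f\|_{L^1}$, where $R_\ell$ is the $\ell$-th Riesz transform, $R_\ell f=c_n\,\mathrm{p.v.}\frac{y_\ell}{|y|^{n+1}}*f$. *)

(* Defs.v *)
From HB Require Import structures.
From mathcomp Require Import all_boot all_order all_algebra.
From mathcomp Require Import all_classical all_reals all_analysis.
From mathcomp Require Import complex.

Set Implicit Arguments.
Unset Strict Implicit.
Unset Printing Implicit Defensive.

Import Order.TTheory GRing.Theory Num.Theory.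
Import numFieldTopology.Exports numFieldNormedType.Exports.

Local Open Scope classical_set_scope.
Local Open Scope ring_scope.

(* R^n is 'rV[R]_n with the product sigma-algebra, i.e. the sigma-algebra
   generated by the coordinates (equivalently, the Borel sets). *)
Section measurable_rV.
Context {R : realType} (n : nat).

Definition rV_coord (i : 'I_n) (x : 'rV[R]_n) : measurableTypeR R := x ord0 i.

Let rV_set0 : g_sigma_preimage rV_coord set0.
Proof. exact: sigma_algebra0. Qed.

Let rV_setC A : g_sigma_preimage rV_coord A -> g_sigma_preimage rV_coord (~` A).
Proof. exact: sigma_algebraC. Qed.

Let rV_bigcup (F : _^nat) : (forall i, g_sigma_preimage rV_coord (F i)) ->
  g_sigma_preimage rV_coord (\bigcup_i (F i)).
Proof. exact: sigma_algebra_bigcup. Qed.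

HB.instance Definition _ := @isMeasurable.Build default_measure_display
  'rV[R]_n (g_sigma_preimage rV_coord) rV_set0 rV_setC rV_bigcup.

Lemma measurable_rV_coord (i : 'I_n) : measurable_fun [set: 'rV[R]_n] (rV_coord i).
Proof.
move=> _ Y mY; rewrite setTI; apply: sub_sigma_algebra => /=.
rewrite -bigcup_seq/=; exists i => /=; first by rewrite mem_index_enum.
by exists Y => //; rewrite setTI.
Qed.

Lemma measurable_fun_rVP d (T : measurableType d) (f : T -> 'rV[R]_n) :
  measurable_fun [set: T] f <->
  forall i, measurable_fun [set: T] (rV_coord i \o f).
Proof.
split=> [mf i|mf]; first exact: measurableT_comp (measurable_rV_coord i) mf.
have sub : g_sigma_preimage (fun i => rV_coord i \o f) `<=` measurable.
  apply: smallest_sub; first exact: sigma_algebra_measurable.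
  move=> A; rewrite -bigcup_seq => -[i _ [B mB <-]].
  exact: mf.
move=> _ A mA; apply: sub.
by rewrite (@g_sigma_preimage_comp _ _ n 'rV[R]_n rV_coord); exists A.
Qed.

End measurable_rV.

Section lebesgue_rV.
Context {R : realType}.

Definition rV_cons n (p : 'rV[R]_n * measurableTypeR R) : 'rV[R]_n.+1 :=
  row_mx (p.2%:M : 'rV[R]_1) p.1.

Definition rV_uncons n (x : 'rV[R]_n.+1) : 'rV[R]_n * measurableTypeR R :=
  (@rsubmx R 1 1 n x, x ord0 ord0).

Lemma rV_consK n : cancel (@rV_cons n) (@rV_uncons n).
Proof.
case=> v x; rewrite /rV_cons /rV_uncons row_mxKr/=; congr pair.
rewrite (_ : ord0 = @lshift 1 n ord0); last exact: ord_inj.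
by rewrite (@row_mxEl R 1 1 n) mxE eqxx mulr1n.
Qed.

Lemma rV_unconsK n : cancel (@rV_uncons n) (@rV_cons n).
Proof.
move=> x; rewrite /rV_cons /rV_uncons/= -[RHS](@hsubmxK R 1 1 n x).
suff -> : (x ord0 ord0)%:M = @lsubmx R 1 1 n x by [].
apply/rowP => i; rewrite (ord1 i) !mxE eqxx/= mulr1n.
by congr (x _ _); exact: ord_inj.
Qed.

Lemma rV_coord_cons0 n (p : 'rV[R]_n * measurableTypeR R) :
  rV_coord ord0 (rV_cons p) = p.2.
Proof.
rewrite /rV_coord /rV_cons (_ : ord0 = @lshift 1 n ord0).
  by rewrite (@row_mxEl R 1 1 n) mxE eqxx mulr1n.
exact: ord_inj.
Qed.

Lemma rV_coord_consS n (p : 'rV[R]_n * measurableTypeR R) (i : 'I_n) :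
  rV_coord (lift ord0 i) (rV_cons p) = rV_coord i p.1.
Proof.
rewrite /rV_coord /rV_cons (_ : lift ord0 i = @rshift 1 n i).
  by rewrite (@row_mxEr R 1 1 n).
exact: ord_inj.
Qed.

Lemma measurable_rV_cons n : measurable_fun [set: _] (@rV_cons n).
Proof.
apply/measurable_fun_rVP => i; case: (unliftP ord0 i) => [j|] ->.
- rewrite (_ : _ \o _ = @rV_coord R n j \o fst); last first.
    by apply/funext => p /=; rewrite rV_coord_consS.
  by apply: measurableT_comp => //; exact: measurable_rV_coord.
- rewrite (_ : _ \o _ = snd)//.
  by apply/funext => p /=; rewrite rV_coord_cons0.
Qed.

Lemma measurable_rV_uncons n : measurable_fun [set: _] (@rV_uncons n).
Proof.
apply: measurable_fun_pair; last exact: (measurable_rV_coord ord0).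
apply/measurable_fun_rVP => i.
rewrite (_ : _ \o _ = @rV_coord R n.+1 (lift ord0 i)).
  exact: measurable_rV_coord.
apply/funext => x /=; rewrite /rV_coord mxE; congr (x _ _).
exact: ord_inj.
Qed.

Fixpoint lebesgue_rV_rec n : {measure set 'rV[R]_n -> \bar R} :=
  match n with
  | 0 => \d_ (0 : 'rV[R]_0)
  | n'.+1 => measure_function_pushforward__canonical__measure_function_Measure
      (lebesgue_rV_rec n' \x @lebesgue_measure R)%E (@measurable_rV_cons n')
  end.

(* Lebesgue measure on R^n (on Borel sets), see lebesgue_rV_box. *)
Definition lebesgue_rV n : set 'rV[R]_n -> \bar R := lebesgue_rV_rec n.

HB.instance Definition _ n := Measure.on (@lebesgue_rV n).

Let lebesgue_rV_sigma_finite n : sigma_finite setT (@lebesgue_rV n).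
Proof.
elim: n => [|n IH].
  exists (fun=> setT); first by rewrite bigcup_const.
  by move=> _; split => //; rewrite /lebesgue_rV/= diracT ltry.
have [F FT Ffin] : sigma_finite setT (@lebesgue_rV n \x @lebesgue_measure R)%E.
  have /sigma_finiteP[F [TF ndF Foo]] := IH.
  have /sigma_finiteP[G [TG ndG Goo]] := sigma_finiteT (@lebesgue_measure R).
  exists (fun k => F k `*` G k).
    rewrite -setXTT TF TG predeqE => -[x y]; split.
      move=> [/= [i _ Fix] [j _ Gjy]]; exists (maxn i j) => //; split.
      - by move: x Fix; exact/subsetPset/ndF/leq_maxl.
      - by move: y Gjy; exact/subsetPset/ndG/leq_maxr.
    by move=> [i _ []/= ? ?]; split; exists i.
  move=> k; have [? ?] := Foo k; have [? ?] := Goo k.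
  split; first exact: measurableX.
  by rewrite product_measure1E// lte_mul_pinfty// ge0_fin_numE.
exists (fun k => @rV_uncons n @^-1` F k).
  by rewrite -preimage_bigcup -FT preimage_setT.
move=> k; have [mF Foo] := Ffin k; split.
  by rewrite -[X in measurable X]setTI; exact: measurable_rV_uncons.
rewrite /lebesgue_rV/= /pushforward -comp_preimage.
by rewrite (_ : _ \o _ = id)//; apply/funext => p /=; rewrite rV_consK.
Qed.

HB.instance Definition _ n := Measure_isSigmaFinite.Build _ _ _
  (@lebesgue_rV n) (@lebesgue_rV_sigma_finite n).

Lemma lebesgue_rV_box n (A : 'I_n -> set (measurableTypeR R)) :
  (forall i, measurable (A i)) ->
  lebesgue_rV [set x : 'rV[R]_n | forall i, A i (x ord0 i)] =
  (\prod_(i < n) lebesgue_measure (A i))%E.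
Proof.
elim: n A => [|n IH] A mA.
  rewrite big_ord0 /lebesgue_rV/= (_ : [set x | _] = setT) ?diracT//.
  by apply/seteqP; split => // x _ [].
rewrite big_ord_recl /lebesgue_rV/= /pushforward.
have mB : measurable [set x : 'rV[R]_n | forall i, A (lift ord0 i) (x ord0 i)].
  rewrite (_ : [set x | _] = \big[setI/setT]_(i < n)
      (@rV_coord R n i @^-1` A (lift ord0 i))).
    apply: bigsetI_measurable => i _.
    by rewrite -[X in measurable X]setTI; exact: measurable_rV_coord.
  apply/seteqP; split => x /=.
    by move=> Ax; rewrite -bigcap_seq => i _; exact: Ax.
  by rewrite -bigcap_seq => Ax i; apply: Ax => /=; rewrite mem_index_enum.
rewrite (_ : _ @^-1` _ = [set x : 'rV[R]_n | forall i,
    A (lift ord0 i) (x ord0 i)] `*` A ord0).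
  by rewrite product_measure1E// muleC -IH.
apply/seteqP; split => p /=.
  move=> Ap; split => [i|]; last by rewrite -(rV_coord_cons0 p); exact: Ap.
  by rewrite -[X in A _ X](rV_coord_consS p i); exact: Ap.
move=> [Bp Ap] i; rewrite -/(rV_coord i (rV_cons p)).
by case: (unliftP ord0 i) => [j|] ->; rewrite ?rV_coord_consS ?rV_coord_cons0//; exact: Bp.
Qed.

End lebesgue_rV.

Section complex_integral.
Context {R : realType} d {T : measurableType d}.
Variable mu : {measure set T -> \bar R}.
Local Notation C := R[i].

(* Measurability with respect to the completion of mu: equality mu-a.e. with a
   function that is measurable (on the Borel sets when mu is lebesgue_rV). *)
Definition ae_measurable (f : T -> C) := exists g : T -> C,
  [/\ measurable_fun setT (fun x => complex.Re (g x)),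
      measurable_fun setT (fun x => complex.Im (g x)) &
      {ae mu, forall x, f x = g x}].

Definition cintegral (D : set T) (f : T -> C) : C :=
  Complex (\int[mu]_(x in D) complex.Re (f x))
          (\int[mu]_(x in D) complex.Im (f x)).

Definition cLnorm (p : \bar R) (f : T -> C) : \bar R :=
  Lnorm mu p (fun x => (Normc.normc (f x))%:E).

Definition in_Lp (p : \bar R) (f : T -> C) :=
  ae_measurable f /\ (cLnorm p f < +oo)%E.

End complex_integral.

Section euclidean.
Context {R : realType} {n : nat}.
Local Notation V := 'rV[R]_n.
Local Notation C := R[i].
Local Notation mu := (@lebesgue_rV R n).

(* The norm that the library puts on 'rV[R]_n is the sup norm. *)
Definition enorm (x : V) : R := Num.sqrt (\sum_(i < n) x ord0 i ^+ 2).

Definition mulop (b f : V -> C) : V -> C := fun x => b x * f x.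

Definition holder_c0 (delta : R) (f : V -> C) :=
  compact (closure [set x | f x != 0]) /\
  exists K : R, forall x y,
    Normc.normc (f x - f y) <= K * enorm (x - y) `^ delta.

Definition mean_zero (f : V -> C) := cintegral mu setT f = 0.

Definition cube (a : V) (l : R) : set V :=
  [set x | forall i, a ord0 i <= x ord0 i <= a ord0 i + l].

(* As 0^-1 = 0 in the library, b != 0 a.e. has to be required explicitly. *)
Definition para_accretive (b : V -> C) :=
  [/\ in_Lp mu +oo%E b,
      {ae mu, forall x, b x != 0} /\ in_Lp mu +oo%E (fun x => (b x)^-1) &
      exists2 c0 : R, 0 < c0 & forall a l, 0 < l -> exists a' l',
        [/\ 0 < l', cube a' l' `<=` cube a l &
            c0 <= Normc.normc (cintegral mu (cube a' l') b) /
                  fine (mu (cube a l))]].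

Definition Phi (N : R) (k : int) (x : V) : R :=
  2 ^ (k * n%:Z) / (1 + 2 ^ k * enorm x) `^ N.

(* Measurability on R^2n is left implicit in the usual definition. *)
Definition square_function_kernels (theta : int -> V -> V -> C) :=
  (forall k, ae_measurable (mu \x mu)%E (fun z : V * V => theta k z.1 z.2)) /\
  exists A N gamma : R,
    [/\ 0 < A, n%:R < N, 0 < gamma <= 1,
        forall k x y,
          Normc.normc (theta k x y) <= A * Phi (N + gamma) k (x - y) &
        forall k x y y',
          Normc.normc (theta k x y - theta k x y') <=
          A * (2 ^ k * enorm (y - y')) `^ gamma *
          (Phi (N + gamma) k (x - y) + Phi (N + gamma) k (x - y'))].

Definition Theta (theta : int -> V -> V -> C) (k : int) (f : V -> C) : V -> C :=
  fun x => cintegral mu setT (fun y => theta k x y * f y).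

Definition Theta_adj (theta : int -> V -> V -> C) (k : int) (f : V -> C) :
    V -> C :=
  fun x => cintegral mu setT (fun y => theta k y x * f y).

Definition Gamma_fun (s : R) : R :=
  \int[lebesgue_measure]_(t in `]0, +oo[%classic) (t `^ (s - 1) * expR (- t)).

Definition riesz_cst : R :=
  Gamma_fun ((n%:R + 1) / 2) / pi `^ ((n%:R + 1) / 2).

Definition riesz_trunc (l : 'I_n) (f : V -> C) (e : R) (x : V) : C :=
  riesz_cst%:C%C *
  cintegral mu [set y | e < enorm y]
    (fun y => (y ord0 l / enorm y ^+ n.+1)%:C%C * f (x - y)).

(* The principal value. For f in L^1 the limits exist for a.e. x; [lim] is 0
   at the other points. *)
Definition riesz (l : 'I_n) (f : V -> C) (x : V) : C :=
  Complex (lim (complex.Re (riesz_trunc l f e x) @[e --> 0^'+]))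
          (lim (complex.Im (riesz_trunc l f e x) @[e --> 0^'+])).

Definition in_H1 (f : V -> C) :=
  in_Lp mu 1%:E f /\ forall l, in_Lp mu 1%:E (riesz l f).

Definition H1norm (f : V -> C) : \bar R :=
  (cLnorm mu 1%:E f + \sum_(l < n) cLnorm mu 1%:E (riesz l f))%E.

(* \sum_(k : int) u k = f, with terms in X and convergence in the norm nrm: the
   partial sums over -M <= k <= N converge as M and N tend independently to
   infinity. *)
Definition series_cvg (X : set (V -> C)) (nrm : (V -> C) -> \bar R)
    (u : int -> V -> C) (f : V -> C) :=
  (forall k, X (u k)) /\
  nrm (fun x => \sum_(i < (MN.1 + MN.2).+1) u (i%:Z - MN.1%:Z) x - f x)
    @[MN --> (\oo, \oo)] --> 0%E.

End euclidean.

Arguments riesz_cst : clear implicits.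

(* Main.v *)
Require Import Defs.
From mathcomp Require Import all_boot all_order all_algebra.
From mathcomp Require Import all_classical all_reals all_analysis.
From mathcomp Require Import complex measurable_realfun.
From mathcomp Require Import ring lra zify.

(** Convergence in H^1 of the reproducing formula for a para-accretive function.

    The terms g_k = b Theta_k (b phi) are, up to a factor q ^ |k| with q < 1,
    molecules: functions of mean zero bounded by r ^ (- n) (1 + |x| / r) ^ (- s)
    with s > n, at the scale r = 1 for k >= 0 and r = 2 ^ (- k) for k < 0
    ([theta_molecules]). For k >= 0 the cancellation Theta_k b = 0 is tested
    against the smoothness of phi ([high_frequency_bound]); for k < 0 the mean
    zero of b phi is tested against the smoothness of the kernel
    ([low_frequency_bound]); the mean of g_k is zero because Theta_k^* b = 0
    ([adjoint_mean0]). As the H^1 norms of molecules are uniformly bounded, the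
    series converges absolutely in H^1. Its sum is b phi, because the symmetric
    partial sums converge pointwise and their limit has to agree with the limit in
    L^p ([cvg_Lp_ae_eq]).

    Molecules in H^1. The Riesz kernel truncated to |y| > e is the sum of its
    restrictions to the dyadic annuli 2 ^ j e < |y| <= 2 ^ (j + 1) e. These pieces
    are odd and have an L^1 modulus of continuity adapted to their scale
    ([ann_modulus]), so that they are almost orthogonal, and the Cotlar-Stein lemma
    bounds their sums on L^2 uniformly in e ([rsum_L2]). On a molecule of unit scale
    the pieces of larger scales gain a geometric factor from the mean zero
    ([rsum_nonlocal]); the pieces of smaller scales are local, and Cauchy-Schwarz on
    dyadic shells reduces them to the L^2 bound ([rsum_local]). Dilating gives an
    L^1 bound for the truncated Riesz transforms of all molecules, uniform in e
    ([rtr_molecule]).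

    Principal values. The transform [riesz] is 0 where its defining limit does not
    exist. Hence its L^1 norm is controlled by the truncations through Fatou's lemma
    ([rlim_L1]), and no existence theorem for principal values enters. The same
    device handles the error of the partial sums: truncated transforms are linear and
    continuous on L^1, so those of the error are limits of those of finite sums of
    the g_k, whose L^1 norms are geometrically small ([rtr_psum_L1_error]). As the
    kernels are real, all this is done for real functions and applied to real and
    imaginary parts.

    Measurability. The functions at hand are only almost everywhere equal to Borel
    functions. Integrals of arbitrary functions depend on null sets in the expected
    way ([ge0_ae_le_integral]), so Borel representatives may be substituted
    throughout, for theta_k by Tonelli's theorem on almost every section
    ([ae_xsection], [ae_ysection]). *)

Set Implicit Arguments.
Unset Strict Implicit.
Unset Printing Implicit Defensive.

Import Order.TTheory GRing.Theory Num.Theory.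
Import numFieldTopology.Exports numFieldNormedType.Exports.

Local Open Scope classical_set_scope.
Local Open Scope ring_scope.

(** * Affine changes of variables *)

Section affine_invariance.
Context {R : realType}.

Lemma lebesgue_measure_affine (c t : R) (A : set (measurableTypeR R)) :
  c != 0 -> measurable A ->
  lebesgue_measure ((fun x : measurableTypeR R => c * x + t) @^-1` A) =
  (`|c|^-1%:E * lebesgue_measure A)%E.
Proof.
move=> c0 mA.
pose f : measurableTypeR R -> measurableTypeR R := fun x => c * x + t.
have mf : measurable_fun setT f.
  by apply: measurable_funD => //; apply: measurable_funM.
have nc : 0 < `|c| by rewrite normr_gt0.
pose p : {measure set (measurableTypeR R) -> \bar R} :=
  measure_function_pushforward__canonical__measure_function_Measure
      (@lebesgue_measure R) mf.
pose m' : {measure set (measurableTypeR R) -> \bar R} :=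
  mscale (NngNum (ltW nc)) p.
suff -> : lebesgue_measure A = m' A.
  by rewrite /m'/= /mscale/= muleA -EFinM mulVf ?gt_eqF// mul1e.
apply: lebesgue_measure_unique => // _ [[a b]] _ <-.
rewrite /m'/= /mscale/= /pushforward lebesgue_measure_itv/= lte_fin.
case: (ltgtP c 0) c0 => // hc _.
- rewrite (_ : _ @^-1` _ = `[(b - t) / c, (a - t) / c[%classic); last first.
    apply/seteqP; split => x /=; rewrite !in_itv/=;
      rewrite ler_ndivrMr// ltr_ndivlMr// lerBrDr ltrBlDr (mulrC x) => /andP[-> ->]//.
  rewrite lebesgue_measure_itv/= lte_fin ltr_nM2r ?invr_lt0// ltrD2r.
  case: ifP => _; last by rewrite mule0.
  by rewrite -?EFinB -?EFinM ltr0_norm// -?EFinB; congr EFin; field; rewrite lt_eqF.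
- rewrite (_ : _ @^-1` _ = `](a - t) / c, (b - t) / c]%classic); last first.
    apply/seteqP; split => x /=; rewrite !in_itv/=;
      rewrite ltr_pdivrMr// ler_pdivlMr// lerBrDr ltrBlDr (mulrC x) => /andP[-> ->]//.
  rewrite lebesgue_measure_itv/= lte_fin ltr_pM2r ?invr_gt0// ltrD2r.
  case: ifP => _; last by rewrite mule0.
  by rewrite -?EFinB -?EFinM gtr0_norm// -?EFinB; congr EFin; field; rewrite gt_eqF.
Qed.

Variable n : nat.
Local Notation V := 'rV[R]_n.
Local Notation mu := (@lebesgue_rV R n).

Definition box (A : 'I_n -> set (measurableTypeR R)) : set V :=
  [set x | forall i, A i (x ord0 i)].

Lemma measurable_box A : (forall i, measurable (A i)) -> measurable (box A).
Proof.
move=> mA; rewrite (_ : box A = \big[setI/setT]_(i < n)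
    (@rV_coord R n i @^-1` A i)).
  apply: bigsetI_measurable => i _.
  by rewrite -[X in measurable X]setTI; exact: measurable_rV_coord.
apply/seteqP; split => x /=.
  by move=> Ax; rewrite -bigcap_seq => i _; exact: Ax.
by rewrite -bigcap_seq => Ax i; apply: Ax => /=; rewrite mem_index_enum.
Qed.

Lemma lebesgue_rV_boxE A : (forall i, measurable (A i)) ->
  mu (box A) = (\prod_(i < n) lebesgue_measure (A i))%E.
Proof. exact: lebesgue_rV_box. Qed.

Definition boxes : set (set V) :=
  [set B | exists2 A, (forall i, measurable (A i)) & B = box A].

Lemma measurable_rV_boxes :
  @measurable _ V = <<s boxes >>.
Proof.
apply/seteqP; split; last first.
  apply: smallest_sub; first exact: sigma_algebra_measurable.
  by move=> _ [A mA ->]; exact: measurable_box.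
apply: smallest_sub; first exact: smallest_sigma_algebra.
move=> A; rewrite -bigcup_seq => -[i _ [B mB <-]].
apply: sub_sigma_algebra; exists (fun j => if j == i then B else setT).
  by move=> j; case: ifP.
apply/seteqP; split => x /=.
  by case=> _ Bx j; case: eqP => [->|].
by move=> /(_ i); rewrite eqxx.
Qed.

Lemma setI_closed_boxes : setI_closed boxes.
Proof.
move=> _ _ [A mA ->] [B mB ->]; exists (fun i => A i `&` B i).
  by move=> i; exact: measurableI.
apply/seteqP; split => x /=; first by move=> [? ?] i; split.
by move=> AB; split => i; have [] := AB i.
Qed.

Lemma measurable_affine (c : R) (t : V) :
  measurable_fun setT (fun x : V => c *: x + t).
Proof.
apply/measurable_fun_rVP => i.
rewrite (_ : _ \o _ = fun x : V => c * rV_coord i x + t ord0 i); last first.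
  by apply/funext => x /=; rewrite /rV_coord !mxE.
apply: measurable_funD => //; apply: measurable_funM => //.
exact: measurable_rV_coord.
Qed.

(** Both sides, multiplied by |c| ^ n, are measures in A. They agree on boxes by
    the one-dimensional statement, and boxes form an intersection-stable generating
    family in which countably many of finite measure cover the space. *)
Lemma lebesgue_rV_affine (c : R) (t : V) (A : set V) : c != 0 -> measurable A ->
  mu ((fun x => c *: x + t) @^-1` A) = ((`|c| ^- n)%:E * mu A)%E.
Proof.
move=> c0 mA.
have nc : 0 < `|c| ^+ n by rewrite exprn_gt0// normr_gt0.
pose p : {measure set V -> \bar R} :=
  measure_function_pushforward__canonical__measure_function_Measure
    mu (measurable_affine c t).
pose m' : {measure set V -> \bar R} := mscale (NngNum (ltW nc)) p.
suff -> : mu A = m' A.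
  by rewrite /m'/= /mscale/= muleA -EFinM mulVf ?gt_eqF// mul1e.
pose I (k : nat) : 'I_n -> set (measurableTypeR R) :=
   fun=> `[- k%:R, k%:R]%classic.
apply: (measure_unique boxes (fun k => box (I k))) => //.
- exact: measurable_rV_boxes.
- exact: setI_closed_boxes.
- move=> k; exists (I k) => // i; exact: measurable_itv.
- apply/seteqP; split => // x _.
  pose N := (\max_(i < n) (Num.truncn `|x ord0 i|).+1)%N.
  exists N => // i; rewrite /I/= in_itv/= -ler_norml.
  apply: (@le_trans _ _ (Num.truncn `|x ord0 i|).+1%:R).
    by rewrite ltW// truncnS_gt.
  by rewrite ler_nat /N (leq_bigmax i).
- move=> _ [B mB ->].
  rewrite [RHS]/= /mscale [RHS]/= /pushforward.
  rewrite (_ : _ @^-1` _ = box (fun i =>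
     (fun x : measurableTypeR R => c * x + t ord0 i) @^-1` B i)); last first.
    by apply/seteqP; split => x /= + i => /(_ i); rewrite !mxE.
  have mB' i : measurable
      ((fun x : measurableTypeR R => c * x + t ord0 i) @^-1` B i).
    rewrite -[X in measurable X]setTI.
    apply: (_ : measurable_fun setT _) => //; last exact: mB.
    by apply: measurable_funD => //; apply: measurable_funM.
  rewrite -[LHS]/(mu _) (lebesgue_rV_boxE mB) (lebesgue_rV_boxE mB').
  transitivity ((`|c| ^+ n)%:E *
      \prod_(i < n) (`|c|^-1%:E * lebesgue_measure (B i)))%E; last first.
    congr (_ * _)%E; apply: eq_bigr => i _.
    exact/esym/lebesgue_measure_affine.
  rewrite big_split/= big_const card_ord iter_mule EFin_expe mule1 muleA.
  by rewrite -!EFin_expe -EFinM -exprMn mulfV ?gt_eqF ?normr_gt0// expr1n mul1e.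
- move=> k; suff : mu (box (I k)) \is a fin_num.
    by rewrite fin_numElt => /andP[].
  rewrite lebesgue_rV_boxE; last by move=> i; exact: measurable_itv.
  apply: prode_fin_num => i _.
  by rewrite lebesgue_measure_itv/=; case: ifP.
Qed.

End affine_invariance.

(** * Integrals of arbitrary functions and of parametrised ones *)

Section integral_without_measurability.
Context d (T : measurableType d) (R : realType).
Variable mu : {measure set T -> \bar R}.
Local Open Scope ereal_scope.
Import HBNNSimple.

(** The integral of a nonnegative function, measurable or not, is a supremum over
    the simple functions below it; cutting such a simple function off on a null set
    does not change its integral. *)
Lemma ge0_ae_le_integral (f g : T -> \bar R) :
  (forall x, 0 <= f x) -> (forall x, 0 <= g x) ->
  {ae mu, forall x, f x <= g x} ->
  \int[mu]_x f x <= \int[mu]_x g x.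
Proof.
move=> f0 g0 [N [mN muN fgN]].
rewrite !ge0_integralTE//; apply: ge_ereal_sup => _ [h /= hf <-].
have mNC : measurable (~` N) by exact: measurableC.
pose h' := mul_nnsfun h (indic_nnsfun R mNC).
rewrite -integralT_nnsfun.
have -> : \int[mu]_x (h x)%:E = \int[mu]_x (h' x)%:E.
  apply: ge0_ae_eq_integral => //.
  - exact/measurable_EFinP.
  - exact/measurable_EFinP.
  - by move=> x _; rewrite lee_fin.
  - by move=> x _; rewrite lee_fin.
  exists N; split => // x /=; apply: contra_notP => Nx _.
  by rewrite /= mindicE mem_set// mulr1.
rewrite integralT_nnsfun; apply: ereal_sup_ubound; exists h' => //= x.
rewrite /h' /= mindicE.
have [Nx|Nx] := pselect (N x).
  by rewrite memNset ?mulr0//; apply.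
rewrite mem_set// mulr1 (le_trans (hf x))//.
by apply: contrapT => fgx; apply: Nx; exact: fgN.
Qed.

Lemma ge0_le_integralT (f g : T -> \bar R) :
  (forall x, 0 <= f x) -> (forall x, f x <= g x) ->
  \int[mu]_x f x <= \int[mu]_x g x.
Proof.
move=> f0 fg; apply: ge0_ae_le_integral => //; last exact: aeW.
by move=> x; exact: le_trans (fg x).
Qed.

Lemma ae_eq_integralT (f g : T -> \bar R) :
  {ae mu, forall x, f x = g x} -> \int[mu]_x f x = \int[mu]_x g x.
Proof.
move=> fg; rewrite integralE [RHS]integralE; congr (_ - _);
  apply/eqP; rewrite eq_le; apply/andP; split; apply: ge0_ae_le_integral => //;
  by apply: filterS fg => x; rewrite ?funeposE ?funenegE => ->.
Qed.

End integral_without_measurability.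

Section Rintegral_general.
Context d (T : measurableType d) (R : realType).
Variable mu : {measure set T -> \bar R}.

Lemma ae_eq_RintegralT (f g : T -> R) :
  {ae mu, forall x, f x = g x} -> \int[mu]_x f x = \int[mu]_x g x.
Proof.
move=> fg; congr fine; apply: ae_eq_integralT.
by apply: filterS fg => x ->.
Qed.

(** A real-valued integral that does not converge is 0 by convention, so the bound
    holds for every f. *)
Lemma normr_Rintegral_le (f : T -> R) :
  (`|\int[mu]_x f x|%:E <= \int[mu]_x `|f x|%:E)%E.
Proof.
have H : (`|\int[mu]_x (f x)%:E| <= \int[mu]_x `|f x|%:E)%E.
  rewrite integralE.
  have a0 : (0 <= \int[mu]_x ((fun x => (f x)%:E)^\+ x))%E by exact: integral_ge0.
  have b0 : (0 <= \int[mu]_x ((fun x => (f x)%:E)^\- x))%E by exact: integral_ge0.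
  have aN : (\int[mu]_x ((fun x => (f x)%:E)^\+ x) <= \int[mu]_x `|f x|%:E)%E.
    apply: ge0_le_integralT => // x.
    by rewrite funeposE -EFin_max lee_fin ge_max ler_norm normr_ge0.
  have bN : (\int[mu]_x ((fun x => (f x)%:E)^\- x) <= \int[mu]_x `|f x|%:E)%E.
    apply: ge0_le_integralT => // x.
    by rewrite funenegE -EFinN -EFin_max lee_fin ge_max -normrN ler_norm normr_ge0.
  move: a0 b0 aN bN; set a := integral _ _ _; set b := integral _ _ _.
  set N := integral _ _ _; clearbody a b N.
  case: N => [N| |]; last 2 first.
  - by move=> *; rewrite leey.
  - by move=> a0 _ /(le_trans a0).
  case: a => [a| |]//; case: b => [b| |]//; rewrite ?leNye// !lee_fin => *.
  rewrite ler_norml; lra.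
apply: le_trans H; rewrite /Rintegral.
by case: integral => [r| |]//=; rewrite ?normr0 ?leey.
Qed.

Lemma normr_Rintegral_le_fin (f : T -> R) (M : R) :
  (\int[mu]_x `|f x|%:E <= M%:E)%E -> `|\int[mu]_x f x| <= M.
Proof. by move=> fM; rewrite -lee_fin (le_trans (normr_Rintegral_le f)). Qed.

Lemma integrable_le (f : T -> R) (M : R) : measurable_fun setT f ->
  (\int[mu]_x `|f x|%:E <= M%:E)%E -> mu.-integrable setT (EFin \o f).
Proof.
move=> mf fM; apply/integrableP; split; first exact/measurable_EFinP.
exact: le_lt_trans fM (ltry _).
Qed.

Lemma integrable_normE (f : T -> R) : mu.-integrable setT (EFin \o f) ->
  (\int[mu]_x `|f x|%:E = (\int[mu]_x `|f x|)%:E)%E.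
Proof.
move=> /integrableP[mf foo]; rewrite fineK// ge0_fin_numE//.
by apply: integral_ge0 => x _; rewrite lee_fin.
Qed.

Lemma Rintegral_EFin (f : T -> R) : mu.-integrable setT (EFin \o f) ->
  (\int[mu]_x (f x)%:E = (\int[mu]_x f x)%:E)%E.
Proof. by move=> fi; rewrite fineK//; exact: integrable_fin_num. Qed.

Lemma ge0_intZ (r : R) (f : T -> R) : 0 <= r -> measurable_fun setT f ->
  (forall x, 0 <= f x) ->
  (\int[mu]_x (r * f x)%:E = r%:E * \int[mu]_x (f x)%:E)%E.
Proof.
move=> r0 mf f0; under eq_integral do rewrite EFinM.
by apply: ge0_integralZl_EFin => //; [move=> x _; rewrite lee_fin|exact/measurable_EFinP].
Qed.

Lemma ge0_intD (f g : T -> R) : measurable_fun setT f -> measurable_fun setT g ->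
  (forall x, 0 <= f x) -> (forall x, 0 <= g x) ->
  (\int[mu]_x (f x + g x)%:E = \int[mu]_x (f x)%:E + \int[mu]_x (g x)%:E)%E.
Proof.
move=> mf mg f0 g0; under eq_integral do rewrite EFinD.
by apply: ge0_integralD => //; try (by move=> x _; rewrite lee_fin);
  exact/measurable_EFinP.
Qed.

Lemma eq_integrableR (f g : T -> R) : f =1 g ->
  mu.-integrable setT (EFin \o f) -> mu.-integrable setT (EFin \o g).
Proof. by move=> /funext ->. Qed.

Lemma integrableZR c (f : T -> R) : mu.-integrable setT (EFin \o f) ->
  mu.-integrable setT (EFin \o (fun x => c * f x)).
Proof.
by move=> /(integrableZl measurableT c); apply: eq_integrable.
Qed.

Lemma integrableDR (f g : T -> R) : mu.-integrable setT (EFin \o f) ->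
  mu.-integrable setT (EFin \o g) ->
  mu.-integrable setT (EFin \o (fun x => f x + g x)).
Proof.
by move=> fi gi; have := integrableD measurableT fi gi; apply: eq_integrable.
Qed.

Lemma integrableBR (f g : T -> R) : mu.-integrable setT (EFin \o f) ->
  mu.-integrable setT (EFin \o g) ->
  mu.-integrable setT (EFin \o (fun x => f x - g x)).
Proof.
by move=> fi gi; have := integrableB measurableT fi gi; apply: eq_integrable.
Qed.

Lemma integrable_measurable (f : T -> R) : mu.-integrable setT (EFin \o f) ->
  measurable_fun setT f.
Proof. by move=> /measurable_int /measurable_EFinP. Qed.

Lemma integrable_normR (f : T -> R) : mu.-integrable setT (EFin \o f) ->
  mu.-integrable setT (EFin \o (fun x => `|f x|)).
Proof. exact: integrable_norm. Qed.

(** Integrate 2 t |k u| <= |k| u ^ 2 + t ^ 2 |k| with t = p / a, where p is the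
    left-hand side. *)
Lemma Cauchy_Schwarz_weight (k u : T -> R) (a q : R) : 0 < a ->
  measurable_fun setT k -> measurable_fun setT u ->
  (\int[mu]_x `|k x|%:E <= a%:E)%E ->
  (\int[mu]_x (`|k x| * u x ^+ 2)%:E <= q%:E)%E ->
  (\int[mu]_x `|k x * u x|%:E <= (Num.sqrt (a * q))%:E)%E.
Proof.
move=> a0 mk mu' ka kq.
have q0 : 0 <= q.
  rewrite -lee_fin; apply: le_trans kq; apply: integral_ge0 => x _.
  by rewrite lee_fin mulr_ge0// sqr_ge0.
have mk1 : measurable_fun setT (fun x => `|k x|) by exact: measurableT_comp.
have mk2 : measurable_fun setT (fun x => `|k x| * u x ^+ 2).
  by apply: measurable_funM => //; exact: measurable_funX.
have mk3 : measurable_fun setT (fun x => `|k x * u x|).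
  by apply: measurableT_comp => //; exact: measurable_funM.
have H s : 0 < s -> ((2 * s)%:E * \int[mu]_x `|k x * u x|%:E
    <= q%:E + (s ^+ 2 * a)%:E)%E.
  move=> s0.
  rewrite -ge0_intZ ?mulr_ge0 ?(ltW s0)//.
  apply: (@le_trans _ _ (\int[mu]_x (`|k x| * u x ^+ 2 + s ^+ 2 * `|k x|)%:E)%E).
    apply: ge0_le_integralT => x; first by rewrite lee_fin !mulr_ge0// ltW.
    rewrite lee_fin normrM -[u x ^+ 2]real_normK ?num_real//.
    have := normr_ge0 (k x); have := sqr_ge0 (`|u x| - s).
    move: (`|k x|) (`|u x|) => K U ? ?.
    rewrite -subr_ge0.
    rewrite (_ : _ - _ = K * (U - s) ^+ 2); last by ring.
    exact: mulr_ge0.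
  rewrite ge0_intD//; last 3 first.
  - exact: measurable_funM.
  - by move=> x; rewrite mulr_ge0// sqr_ge0.
  - by move=> x; rewrite mulr_ge0// sqr_ge0.
  rewrite leeD// ge0_intZ ?sqr_ge0//.
  rewrite [leRHS]EFinM; apply: lee_pmul => //; first by rewrite lee_fin sqr_ge0.
  exact: integral_ge0.
have N0 : (0 <= \int[mu]_x `|k x * u x|%:E)%E.
  by apply: integral_ge0 => x _; rewrite lee_fin.
move: N0 H; case: integral => [p| |]//.
  rewrite lee_fin => p0 H.
  have [->|pn0] := eqVneq p 0; first by rewrite lee_fin sqrtr_ge0.
  have {}p0 : 0 < p by rewrite lt_neqAle eq_sym pn0.
  have := H (p / a) (divr_gt0 p0 a0).
  rewrite -EFinM -EFinD !lee_fin => {}H.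
  rewrite -[p]ger0_norm ?(ltW p0)// -sqrtr_sqr ler_sqrt; last by rewrite mulr_ge0// ltW.
  rewrite -(@ler_pM2l _ a^-1) ?invr_gt0//.
  have -> : a^-1 * (a * q) = q by field; exact: lt0r_neq0.
  have E1 : 2 * (p / a) * p = 2 * (a^-1 * p ^+ 2) by ring.
  have E2 : (p / a) ^+ 2 * a = a^-1 * p ^+ 2 by field; exact: lt0r_neq0.
  by move: H; rewrite E1 E2; lra.
move=> _ /(_ 1 ltr01); rewrite mulr1 gt0_muley ?lte_fin//.
Qed.

End Rintegral_general.

Section parametric_integrals.
Context d1 d2 (T1 : measurableType d1) (T2 : measurableType d2) (R : realType).
Variable m1 : {sigma_finite_measure set T1 -> \bar R}.
Variable m2 : {sigma_finite_measure set T2 -> \bar R}.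

Lemma measurable_Rintegral (F : T1 * T2 -> R) : measurable_fun setT F ->
  measurable_fun setT (fun x => \int[m2]_y F (x, y)).
Proof.
move=> mF; apply: measurableT_comp; first exact: fine_measurable.
rewrite (_ : (fun x => _) = (fun x => (\int[m2]_y (EFin \o F)^\+ (x, y))%E -
   (\int[m2]_y (EFin \o F)^\- (x, y))%E)%E).
  apply: emeasurable_funB.
    apply: (measurable_fun_fubini_tonelli_F (m2 := m2) (EFin \o F)^\+%E) => //.
    by apply: measurable_funepos; exact/measurable_EFinP.
  apply: (measurable_fun_fubini_tonelli_F (m2 := m2) (EFin \o F)^\-%E) => //.
  by apply: measurable_funeneg; exact/measurable_EFinP.
apply/funext => x; rewrite integralE.
by congr (_ - _)%E; apply: eq_integral => y _; rewrite ?funeposE ?funenegE.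
Qed.

(** Cauchy-Schwarz with the weight |k| in y, then Tonelli; the bound on the slices is
    uniform in y, so the remaining integral of |k| gives the second factor a. *)
Lemma Minkowski_L2 (k : T2 -> R) (F : T1 * T2 -> R) (a c : R) : 0 < a -> 0 <= c ->
  measurable_fun setT k -> measurable_fun setT F ->
  (\int[m2]_y `|k y|%:E <= a%:E)%E ->
  (forall y, (\int[m1]_x (F (x, y) ^+ 2)%:E <= c%:E)%E) ->
  (\int[m1]_x ((\int[m2]_y (k y * F (x, y))) ^+ 2)%:E <= (a ^+ 2 * c)%:E)%E.
Proof.
move=> a0 c0 mk mF ka Fc.
have mk' : measurable_fun setT (fun z : T1 * T2 => `|k z.2|).
  do 2 (apply: measurableT_comp => //).
have mkF : measurable_fun setT (fun z : T1 * T2 => `|k z.2| * F z ^+ 2).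
  by apply: measurable_funM => //; exact: measurable_funX.
apply: (@le_trans _ _ (\int[m1]_x (a%:E * \int[m2]_y (`|k y| * F (x, y) ^+ 2)%:E))%E).
  apply: ge0_le_integralT => x; first by rewrite lee_fin sqr_ge0.
  have := @integral_ge0 _ _ _ m2 setT (fun y => (`|k y| * F (x, y) ^+ 2)%:E)
     (fun y _ => mulr_ge0 (normr_ge0 (k y)) (sqr_ge0 (F (x, y)))).
  case E : integral => [q| |]//; last first.
    by move=> _; rewrite gt0_muley ?lte_fin// leey.
  rewrite lee_fin => q0.
  have := @Cauchy_Schwarz_weight _ _ _ m2 k (fun y => F (x, y)) a q a0 mk
     (measurable_fun_pair2 x mF) ka.
  rewrite E lexx => /(_ isT) /normr_Rintegral_le_fin H.
  rewrite -EFinM lee_fin -real_normK ?num_real//.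
  rewrite -[leRHS]sqr_sqrtr ?mulr_ge0 ?(ltW a0)//.
  by rewrite ler_sqr ?nnegrE ?sqrtr_ge0.
rewrite ge0_integralZl_EFin ?(ltW a0)//; last 2 first.
- by move=> x _; apply: integral_ge0 => y _; rewrite lee_fin mulr_ge0// sqr_ge0.
- apply: (measurable_fun_fubini_tonelli_F (m2 := m2)
     (fun z => (`|k z.2| * F z ^+ 2)%:E)) => //.
    exact/measurable_EFinP.
  by move=> z; rewrite lee_fin mulr_ge0// sqr_ge0.
have -> : (\int[m1]_x \int[m2]_y (`|k y| * F (x, y) ^+ 2)%:E =
  \int[m2]_y \int[m1]_x (`|k y| * F (x, y) ^+ 2)%:E)%E.
  apply: (fubini_tonelli (fun z => (`|k z.2| * F z ^+ 2)%:E)) => //.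
    exact/measurable_EFinP.
  by move=> z; rewrite lee_fin mulr_ge0// sqr_ge0.
rewrite expr2 -mulrA EFinM lee_pmul2l ?lte_fin//.
apply: (@le_trans _ _ (\int[m2]_y (c%:E * `|k y|%:E))%E).
  apply: ge0_le_integralT => y.
    by apply: integral_ge0 => x _; rewrite lee_fin mulr_ge0// sqr_ge0.
  rewrite ge0_intZ//; last 2 first.
  - by apply: measurable_funX; exact: measurable_fun_pair1.
  - by move=> x; rewrite sqr_ge0.
  by rewrite muleC lee_pmul// integral_ge0// => x _; rewrite lee_fin sqr_ge0.
rewrite ge0_integralZl_EFin//.
  by rewrite mulrC EFinM lee_pmul// ?lee_fin// integral_ge0.
by apply/measurable_EFinP; exact: measurableT_comp.
Qed.

Lemma Rintegral_Fubini (G : T1 * T2 -> R) : measurable_fun setT G ->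
  (\int[m2]_y \int[m1]_x `|G (x, y)|%:E < +oo)%E ->
  (forall x, m2.-integrable setT (EFin \o (fun y => G (x, y)))) ->
  (forall y, m1.-integrable setT (EFin \o (fun x => G (x, y)))) ->
  \int[m1]_x (\int[m2]_y G (x, y)) = \int[m2]_y (\int[m1]_x G (x, y)).
Proof.
move=> mG Goo Gx Gy.
have Gi : (m1 \x m2)%E.-integrable setT (EFin \o G).
  by apply/integrable21ltyP; first exact/measurable_EFinP.
transitivity (fine (\int[m1]_x \int[m2]_y (G (x, y))%:E)).
  by congr fine; apply: eq_integral => x _; rewrite -Rintegral_EFin.
rewrite (Fubini Gi); congr fine; apply: eq_integral => y _.
by rewrite -Rintegral_EFin.
Qed.

End parametric_integrals.

(** * The Euclidean norm, its balls and polynomial weights *)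

Section sums.
Context {R : realType}.

Lemma geom_sum_le (z : R) k : 0 <= z < 1 -> \sum_(m < k) z ^+ m <= (1 - z)^-1.
Proof.
move=> /andP[z0 z1]; rewrite -[leRHS]mul1r ler_pdivlMr ?subr_gt0//.
elim: k => [|k IH]; first by rewrite big_ord0 mul0r.
rewrite -(big_mkord xpredT (fun m => z ^+ m)) big_nat_recl//= big_mkord expr0.
have -> : \sum_(i < k) z ^+ i.+1 = z * \sum_(i < k) z ^+ i.
  by rewrite mulr_sumr; apply: eq_bigr => i _; rewrite exprS.
have := ler_wpM2l z0 IH; lra.
Qed.

Lemma nneseries_le (u : nat -> R) (M : R) : (forall k, 0 <= u k) ->
  (forall k, \sum_(m < k) u m <= M) -> (\sum_(m <oo) (u m)%:E <= M%:E)%E.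
Proof.
move=> u0 uM; apply: lime_le; first by apply: is_cvg_nneseries => m _ _; rewrite lee_fin.
by apply: nearW => k; rewrite sumEFin lee_fin big_mkord.
Qed.

Lemma ler_term_nneseries (u : nat -> R) (m : nat) : (forall k, 0 <= u k) ->
  ((u m)%:E <= \sum_(m <oo) (u m)%:E)%E.
Proof.
move=> u0; apply: le_trans (nneseries_lim_ge m.+1 _); last by move=> *; rewrite lee_fin.
rewrite big_nat_recr//= leeDr// big_seq sume_ge0// => *; by rewrite lee_fin.
Qed.

End sums.

Lemma measurable_bigcup_count d (T : sigmaRingType d) (I : countType)
    (A : I -> set T) :
  (forall i, measurable (A i)) -> measurable (\bigcup_i A i).
Proof.
move=> mA.
rewrite (_ : \bigcup_i _ = \bigcup_(k : nat) (if unpickle k is Some i then A i else set0)).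
  by apply: bigcup_measurable => k _; case: unpickle.
apply/seteqP; split => x [i _ Ai].
  by exists (pickle i) => //; rewrite pickleK.
by move: Ai; case: unpickle => // j Aj; exists j.
Qed.

Section euclidean_norm.
Context {R : realType} {n : nat}.
Local Notation V := 'rV[R]_n.
Local Notation mu := (@lebesgue_rV R n).
Implicit Types x y : V.

Lemma enorm_ge0 x : 0 <= enorm x.
Proof. exact: sqrtr_ge0. Qed.

Lemma sumsq_ge0 x : 0 <= \sum_(i < n) x ord0 i ^+ 2.
Proof. by apply: sumr_ge0 => i _; exact: sqr_ge0. Qed.

Lemma enorm_sqr x : enorm x ^+ 2 = \sum_(i < n) x ord0 i ^+ 2.
Proof. by rewrite sqr_sqrtr// sumsq_ge0. Qed.

Lemma enormZ c x : enorm (c *: x) = `|c| * enorm x.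
Proof.
rewrite /enorm -sqrtr_sqr -sqrtrM ?sqr_ge0//; congr Num.sqrt.
by rewrite mulr_sumr; apply: eq_bigr => i _; rewrite mxE exprMn.
Qed.

Lemma enormN x : enorm (- x) = enorm x.
Proof. by rewrite -scaleN1r enormZ normrN1 mul1r. Qed.

Lemma enormBC x y : enorm (x - y) = enorm (y - x).
Proof. by rewrite -opprB enormN. Qed.

Lemma enorm_coord x i : `|x ord0 i| <= enorm x.
Proof.
rewrite -sqrtr_sqr ler_sqrt ?sumsq_ge0// (bigD1 i)//= lerDl.
by apply: sumr_ge0 => j _; exact: sqr_ge0.
Qed.

Lemma enorm_eq0 x : enorm x = 0 -> x = 0.
Proof.
move=> x0; apply/rowP => i; rewrite !mxE; apply/eqP; rewrite -normr_le0 -x0.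
exact: enorm_coord.
Qed.

Lemma enorm_CS x y : \sum_(i < n) x ord0 i * y ord0 i <= enorm x * enorm y.
Proof.
have [x0|xn0] := eqVneq (enorm x) 0.
  by rewrite x0 mul0r (enorm_eq0 x0) big1// => i _; rewrite !mxE mul0r.
have [y0|yn0] := eqVneq (enorm y) 0.
  by rewrite y0 mulr0 (enorm_eq0 y0) big1// => i _; rewrite !mxE mulr0.
have xp : 0 < enorm x by rewrite lt_neqAle eq_sym xn0 enorm_ge0.
have yp : 0 < enorm y by rewrite lt_neqAle eq_sym yn0 enorm_ge0.
have : 0 <= \sum_(i < n) (enorm y * x ord0 i - enorm x * y ord0 i) ^+ 2.
  by apply: sumr_ge0 => i _; exact: sqr_ge0.
rewrite (eq_bigr (fun i => enorm y ^+ 2 * x ord0 i ^+ 2 -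
  (2 * enorm x * enorm y) * (x ord0 i * y ord0 i) +
  enorm x ^+ 2 * y ord0 i ^+ 2)); last by move=> i _; ring.
rewrite big_split/= sumrB -!mulr_sumr -!enorm_sqr => H.
rewrite -(ler_pM2l (mulr_gt0 xp yp)); move: H.
move: (enorm x) (enorm y) (\sum_(_ < n) _) => X Y S.
by move=> H; rewrite -subr_ge0 -(pmulr_rge0 _ (ltr0Sn _ 1)) (le_trans H)//; lra.
Qed.

Lemma enormD x y : enorm (x + y) <= enorm x + enorm y.
Proof.
rewrite -(@ler_pXn2r _ 2)// ?nnegrE ?addr_ge0 ?enorm_ge0//.
rewrite sqrrD !enorm_sqr -[leLHS]/(\sum_(i < n) _).
under eq_bigr do rewrite mxE sqrrD.
rewrite big_split/= big_split/= sumrMnl.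
have := enorm_CS x y; lra.
Qed.

Lemma enorm_triB x y : enorm x <= enorm y + enorm (x - y).
Proof. by rewrite -[X in enorm X <= _](subrKC y) enormD. Qed.

Lemma enorm_triD x y : enorm x <= enorm (x - y) + enorm y.
Proof. by rewrite -[X in enorm X <= _](subrK y) enormD. Qed.

Lemma sumsq_le_sqsum (I : Type) (s : seq I) (f : I -> R) :
  \sum_(i <- s) f i ^+ 2 <= (\sum_(i <- s) `|f i|) ^+ 2.
Proof.
elim: s => [|i s IH]; first by rewrite !big_nil expr0n.
rewrite !big_cons sqrrD real_normK ?num_real//.
have : 0 <= `|f i| * \sum_(j <- s) `|f j| by rewrite mulr_ge0// sumr_ge0.
lra.
Qed.

Lemma enorm_le_sum x : enorm x <= \sum_(i < n) `|x ord0 i|.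
Proof.
rewrite -(@ler_pXn2r _ 2)// ?nnegrE ?enorm_ge0 ?sumr_ge0//.
by rewrite enorm_sqr; exact: sumsq_le_sqsum.
Qed.

Lemma measurable_coord i : measurable_fun setT (fun x : V => x ord0 i).
Proof. exact: measurable_rV_coord. Qed.

Lemma measurable_enorm : measurable_fun setT (@enorm R n).
Proof.
rewrite /enorm (_ : (fun x => _) = (fun r => r `^ (2^-1)) \o
  (fun x : V => \sum_(i < n) x ord0 i ^+ 2)); last first.
  by apply/funext => x /=; rewrite powR12_sqrt// sumsq_ge0.
apply: measurableT_comp; first exact: measurable_powR.
apply: measurable_sum => i; apply: measurable_funX; exact: measurable_coord.
Qed.

Lemma measurable_fun_row d (T : measurableType d) (f : T -> V) :
  (forall i, measurable_fun setT (fun t => f t ord0 i)) -> measurable_fun setT f.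
Proof. by move=> mf; apply/measurable_fun_rVP => i; exact: mf. Qed.

Lemma measurable_row_comp d (T : measurableType d) (f : T -> V) i :
  measurable_fun setT f -> measurable_fun setT (fun t => f t ord0 i).
Proof. by move=> /measurable_fun_rVP /(_ i). Qed.

Lemma measurable_rowB d (T : measurableType d) (f g : T -> V) :
  measurable_fun setT f -> measurable_fun setT g ->
  measurable_fun setT (fun t => f t - g t).
Proof.
move=> mf mg; apply: measurable_fun_row => i.
under eq_fun do rewrite !mxE.
by apply: measurable_funB; exact: measurable_row_comp.
Qed.

Lemma measurable_scale (c : R) (f : V -> R) : measurable_fun setT f ->
  measurable_fun setT (fun x : V => f (c *: x)).
Proof.
move=> mf; rewrite (_ : (fun x => _) = f \o (fun x : V => c *: x + 0)).
  exact: (measurableT_comp mf (measurable_affine c 0)).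
by apply/funext => x /=; rewrite addr0.
Qed.

Lemma measurable_sub_row : measurable_fun setT (fun z : V * V => z.1 - z.2).
Proof. by apply: measurable_rowB; [exact: measurable_fst|exact: measurable_snd]. Qed.

Lemma ge0_integral_affine (c : R) (t : V) (f : V -> R) : c != 0 ->
  measurable_fun setT f -> (forall x, 0 <= f x) ->
  (\int[mu]_x (f (c *: x + t)%R)%:E = (`|c| ^- n)%:E * \int[mu]_x (f x)%:E)%E.
Proof.
move=> c0 mf f0.
have c1 : 0 <= `|c| ^- n by rewrite invr_ge0 exprn_ge0.
rewrite -(@ge0_integral_mscale _ _ _ mu setT measurableT (NngNum c1)
   (fun x => (f x)%:E))//; last 2 first.
- exact/measurable_EFinP.
- by move=> x _; rewrite lee_fin.
have mf' : measurable_fun setT (fun x => (f x)%:E) by exact/measurable_EFinP.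
have f0' : {in [set: V], forall y, (0 <= (f y)%:E)%E}.
  by move=> x _; rewrite lee_fin.
have := ge0_integral_pushforward (measurable_affine c t) mu measurableT mf' f0'.
rewrite preimage_setT => <-.
apply: eq_measure_integral; first exact: measurable_affine.
by move=> mT A mA _; exact: lebesgue_rV_affine.
Qed.

Lemma Rintegral_affine (c : R) (t : V) (f : V -> R) : c != 0 ->
  measurable_fun setT f ->
  \int[mu]_x (f (c *: x + t)) = `|c| ^- n * \int[mu]_x f x.
Proof.
move=> c0 mf; rewrite /Rintegral.
have c1 : 0 < `|c| ^- n by rewrite invr_gt0 exprn_gt0// normr_gt0.
rewrite integralE [X in _ = _ * fine X]integralE.
have part (g : R -> R) : measurable_fun setT g -> (forall r, 0 <= g r) ->
    (\int[mu]_x (g (f (c *: x + t)%R))%:E =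
     (`|c| ^- n)%:E * \int[mu]_x (g (f x))%:E)%E.
  move=> mg g0; apply: (ge0_integral_affine t c0 (measurableT_comp mg mf)) => x.
  exact: g0.
have posE (h : V -> R) : (fun x => (h x)%:E)^\+%E = (fun x => (Num.max (h x) 0)%:E).
  by apply/funext => x; rewrite funeposE -EFin_max.
have negE (h : V -> R) : (fun x => (h x)%:E)^\-%E = (fun x => (Num.max (- h x) 0)%:E).
  by apply/funext => x; rewrite funenegE -EFin_max.
rewrite !posE !negE (part (fun r => Num.max r 0)); last 2 first.
- exact: measurable_maxr.
- by move=> r; rewrite le_max lexx orbT.
rewrite (part (fun r => Num.max (- r) 0)); last 2 first.
- by apply: measurable_maxr => //; exact: measurable_funN.
- by move=> r; rewrite le_max lexx orbT.
have a0 : (0 <= \int[mu]_x (Num.max (f x) 0)%:E)%E.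
  by apply: integral_ge0 => x _; rewrite lee_fin le_max lexx orbT.
have b0 : (0 <= \int[mu]_x (Num.max (- f x) 0)%:E)%E.
  by apply: integral_ge0 => x _; rewrite lee_fin le_max lexx orbT.
move: a0 b0; set a := integral _ _ _; set b := integral _ _ _; clearbody a b.
have cy : ((`|c| ^- n)%:E * +oo = +oo)%E by rewrite gt0_muley ?lte_fin.
case: a => [a| |]//; case: b => [b| |]// _ _; rewrite ?cy /= ?mulr0//.
by rewrite mulrBr.
Qed.

Lemma Rintegral_reflect (x : V) (f : V -> R) : measurable_fun setT f ->
  \int[mu]_y (f (x - y)) = \int[mu]_y f y.
Proof.
move=> mf; transitivity (\int[mu]_y (f ((-1) *: y + x))).
  by apply: eq_Rintegral => y _; rewrite scaleN1r addrC.
by rewrite Rintegral_affine ?oppr_eq0 ?oner_eq0// normrN1 expr1n invr1 mul1r.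
Qed.

Lemma ge0_integral_reflect (x : V) (f : V -> R) : measurable_fun setT f ->
  (forall x, 0 <= f x) ->
  (\int[mu]_y (f (x - y)%R)%:E = \int[mu]_y (f y)%:E)%E.
Proof.
move=> mf f0; transitivity (\int[mu]_y (f ((-1) *: y + x)%R)%:E)%E.
  by apply: eq_integral => y _; rewrite scaleN1r addrC.
by rewrite ge0_integral_affine ?oppr_eq0 ?oner_eq0// normrN1 expr1n invr1 mul1e.
Qed.

Lemma ge0_integral_shift (x : V) (f : V -> R) : measurable_fun setT f ->
  (forall x, 0 <= f x) ->
  (\int[mu]_y (f (y - x)%R)%:E = \int[mu]_y (f y)%:E)%E.
Proof.
move=> mf f0; transitivity (\int[mu]_y (f (1 *: y + (- x))%R)%:E)%E.
  by apply: eq_integral => y _; rewrite scale1r.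
by rewrite ge0_integral_affine ?oner_eq0// normr1 expr1n invr1 mul1e.
Qed.

Lemma ge0_integral_scale (c : R) (f : V -> R) : 0 < c -> measurable_fun setT f ->
  (forall x, 0 <= f x) ->
  (\int[mu]_y (f (c *: y)%R)%:E = (c ^- n)%:E * \int[mu]_y (f y)%:E)%E.
Proof.
move=> c0 mf f0; transitivity (\int[mu]_y (f (c *: y + 0)%R)%:E)%E.
  by apply: eq_integral => y _; rewrite addr0.
by rewrite ge0_integral_affine ?gt_eqF// gtr0_norm.
Qed.

(** Balls of [enorm]; the library's [ball] is the one of the sup norm. *)
Definition eball (r : R) : set V := [set x | enorm x <= r].

Lemma measurable_enorm_le r : measurable (eball r).
Proof.
have := measurable_enorm; rewrite -[X in measurable X]setTI => me.
rewrite (_ : eball r = (@enorm R n) @^-1` `]-oo, r]%classic); last first.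
  by apply/seteqP; split => x /=; rewrite in_itv.
exact: me.
Qed.

Definition vball : R := fine (mu (eball 1)).

Lemma mu_eball1 : (mu (eball 1) < +oo)%E.
Proof.
pose I : 'I_n -> set (measurableTypeR R) := fun=> `[-1, 1]%classic.
apply: (@le_lt_trans _ _ (mu (box I))).
  apply: le_measure; rewrite ?inE.
  - exact: measurable_enorm_le.
  - by apply: measurable_box => i; exact: measurable_itv.
  - move=> x /= x1 i; rewrite /I/= in_itv/= -ler_norml.
    exact: le_trans (enorm_coord _ _) x1.
suff : mu (box I) \is a fin_num by rewrite fin_numElt => /andP[].
rewrite lebesgue_rV_boxE; last by move=> i; exact: measurable_itv.
by apply: prode_fin_num => i _; rewrite lebesgue_measure_itv/=; case: ifP.
Qed.

Lemma vball_ge0 : 0 <= vball.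
Proof. by rewrite fine_ge0// measure_ge0. Qed.

Lemma mu_eball r : 0 < r -> mu (eball r) = (r ^+ n * vball)%:E.
Proof.
move=> r0.
have -> : eball r = (fun x => r^-1 *: x + 0) @^-1` eball 1.
  apply/seteqP; split => x /=; rewrite /eball/= addr0 enormZ gtr0_norm ?invr_gt0//;
    by rewrite ler_pdivrMl// mulr1.
rewrite lebesgue_rV_affine ?invr_eq0 ?gt_eqF//; last exact: measurable_enorm_le.
rewrite EFinM /vball fineK ?ge0_fin_numE ?mu_eball1 ?measure_ge0//.
by rewrite gtr0_norm ?invr_gt0// exprVn invrK.
Qed.

Lemma mu_shell a b : 0 < a -> a <= b ->
  mu [set x | a < enorm x <= b] = ((b ^+ n - a ^+ n) * vball)%:E.
Proof.
move=> a0 ab.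
have -> : [set x : V | a < enorm x <= b] = eball b `\` eball a.
  apply/seteqP; split => x /=; rewrite /eball/=.
    by move=> /andP[ax xb]; split => //; apply/negP; rewrite -ltNge.
  by move=> [-> /negP]; rewrite -ltNge => ->.
rewrite measureD; last 3 first.
- exact: measurable_enorm_le.
- exact: measurable_enorm_le.
- by rewrite -[X in (X < _)%E]/(mu _) mu_eball ?(lt_le_trans a0)// ltry.
have -> : eball b `&` eball a = eball a.
  by apply/seteqP; split => [x []//|x xa]; split => //; exact: le_trans ab.
rewrite mulrBl EFinB; congr (_ - _)%E; exact: mu_eball (lt_le_trans a0 _).
Qed.

Lemma integral_indic_eball (c r : R) : 0 <= c -> 0 < r ->
  (\int[mu]_x (c * \1_(eball r) x)%:E = (c * (r ^+ n * vball))%:E)%E.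
Proof.
move=> c0 r0; rewrite ge0_intZ//; last by apply: measurable_indic; exact: measurable_enorm_le.
rewrite integral_indic ?setIT//; last exact: measurable_enorm_le.
by rewrite -[X in (_ * X)%E]/(mu _) mu_eball.
Qed.

(** The decay profile of the molecules below; integrable for s > n. *)
Definition wgt (s : R) (x : V) : R := ((1 + enorm x) `^ s)^-1.

Lemma wgt_gt0 s x : 0 < wgt s x.
Proof. by rewrite invr_gt0 powR_gt0// ltr_pwDl// enorm_ge0. Qed.

Lemma measurable_wgt s : measurable_fun setT (wgt s).
Proof.
rewrite (_ : wgt s = (fun r => r `^ (- s)) \o (fun x => 1 + enorm x)); last first.
  by apply/funext => x /=; rewrite powRN.
apply: measurableT_comp; first exact: measurable_powR.
by apply: measurable_funD => //; exact: measurable_enorm.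
Qed.

Lemma wgt_le1 s x : 0 <= s -> wgt s x <= 1.
Proof.
move=> s0; rewrite invf_le1 ?powR_gt0 ?ltr_pwDl ?enorm_ge0//.
rewrite -[leLHS](powRr0 (1 + enorm x)); apply: ler_powR => //.
by rewrite lerDl enorm_ge0.
Qed.

(** The weight is dominated by the series of 2 ^ (- s m) times the indicator of the
    ball of radius 2 ^ (m + 1), whose integral is geometric with ratio 2 ^ (n - s). *)
Lemma wgt_integrable s : n%:R < s ->
  exists2 I : R, 0 < I & (\int[mu]_x (wgt s x)%:E <= I%:E)%E.
Proof.
move=> ns; have s0 : 0 <= s by apply: le_trans (ltW ns).
pose q : R := 2 `^ (- s); have q0 : 0 < q by rewrite powR_gt0.
pose z := q * 2 ^+ n; have z0 : 0 < z by rewrite mulr_gt0// exprn_gt0.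
have z1 : z < 1.
  rewrite /z -powR_mulrn// -powRD; last by rewrite pnatr_eq0 implybT.
  by rewrite /powR pnatr_eq0/= expR_lt1 pmulr_llt0 ?ln_gt0 ?ltr1n//; lra.
pose u m x : R := q ^+ m * \1_(eball (2 ^+ m.+1)) x.
have u0 m x : 0 <= u m x by rewrite mulr_ge0 ?exprn_ge0 ?(ltW q0)//.
exists (2 ^+ n * vball * (1 - z)^-1 + 1).
  by rewrite ltr_wpDl// !mulr_ge0 ?exprn_ge0 ?vball_ge0// invr_ge0 subr_ge0 ltW.
apply: (@le_trans _ _ (\int[mu]_x (\sum_(m <oo) (u m x)%:E))%E).
  apply: ge0_le_integralT => x; first by rewrite lee_fin ltW ?wgt_gt0.
  have ex : exists m, enorm x <= 2 ^+ m.+1.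
    exists (Num.truncn (enorm x)); apply: le_trans (ltW (truncnS_gt _)) _.
    by rewrite -natrX ler_nat ltnW// ltn_expl.
  case: (ex_minnP ex) => m xm mmin.
  apply: le_trans (ler_term_nneseries (u := fun m => u m x) m _) => //.
  rewrite lee_fin /u indicE mem_set// mulr1.
  case: m xm mmin => [|m] xm mmin; first by rewrite expr0 wgt_le1.
  have {}mmin : 2 ^+ m.+1 < enorm x.
    by rewrite ltNge; apply/negP => /mmin; rewrite ltnn.
  rewrite /wgt /q -powRN -powR_mulrn ?powR_ge0// -powRrM mulrC powRrM.
  rewrite powR_mulrn// !powRN lef_pV2 ?posrE ?powR_gt0 ?exprn_gt0 ?ltr_pwDl ?enorm_ge0//.
  apply: ge0_ler_powR => //; rewrite ?nnegrE ?exprn_ge0 ?addr_ge0 ?enorm_ge0//.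
  by rewrite (le_trans (ltW mmin))// lerDr.
rewrite integral_nneseries//; last 2 first.
- move=> m; apply/measurable_EFinP; apply: measurable_funM => //.
  by apply: measurable_indic; exact: measurable_enorm_le.
- by move=> m x _; rewrite lee_fin.
under eq_eseriesr => m _ do
  rewrite integral_indic_eball ?exprn_gt0// ?exprn_ge0 ?(ltW q0)//.
apply: nneseries_le => [m|k].
  by rewrite !mulr_ge0 ?exprn_ge0 ?vball_ge0// ltW.
rewrite ler_wpDr//.
rewrite (eq_bigr (fun m : 'I_k => 2 ^+ n * vball * z ^+ m)); last first.
  move=> m _; rewrite /z exprMn.
  have -> : (2 : R) ^+ m.+1 ^+ n = 2 ^+ n * (2 ^+ n) ^+ m.
    by rewrite -!exprM mulSn exprD (mulnC m).
  ring.
rewrite -mulr_sumr ler_wpM2l ?mulr_ge0 ?exprn_ge0 ?vball_ge0//.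
by apply: geom_sum_le; rewrite (ltW z0).
Qed.

(** The sigma-algebra is generated by the coordinates, so continuity does not give
    measurability at once. The set where f < c is the union, over the points q with
    rational coordinates, of the sets where f q + K |x - q| ^ delta < c. *)
Lemma holder_measurable (f : V -> R) (K delta : R) : 0 < delta ->
  (forall x y, `|f x - f y| <= K * enorm (x - y) `^ delta) ->
  measurable_fun setT f.
Proof.
move=> d0 fK.
wlog K0 : K fK / 0 < K.
  move=> /(_ (`|K| + 1)); apply; last by rewrite ltr_wpDl.
  move=> x y; apply: le_trans (fK x y) _; rewrite ler_wpM2r ?powR_ge0//.
  by rewrite (le_trans (ler_norm _))// lerDl.
have mD y : measurable_fun setT (fun x : V => f y + K * enorm (x - y) `^ delta).
  apply: measurable_funD => //; apply: measurable_funM => //.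
  apply: (measurableT_comp (f := fun r => r `^ delta)).
    exact: measurable_powR.
  apply: (measurableT_comp (f := @enorm R n)); first exact: measurable_enorm.
  by apply: measurable_rowB => //.
apply: (measurability _ (RGenInftyO.measurableE R)) => //.
move=> _ [_ [c ->] <-]; rewrite setTI (_ : _ @^-1` _ = \bigcup_(q : 'rV[rat]_n)
   ((fun x : V => f (map_mx ratr q) + K * enorm (x - map_mx ratr q) `^ delta)
     @^-1` `]-oo, c[%classic)).
  apply: measurable_bigcup_count => q.
  by rewrite -[X in measurable X]setTI; apply: mD => //; exact: measurable_itv.
apply/seteqP; split => x /=; rewrite ?in_itv/=; last first.
  move=> [q _ /=]; rewrite in_itv/=; apply: le_lt_trans.
  rewrite -lerBlDl; exact: le_trans (ler_norm _) (fK _ _).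
move=> fc.
(* A point within e of x in each coordinate is within n e of x, and n e is at most
   ((c - f x) / (2 K + 1)) ^ (1 / delta). *)
pose e := ((c - f x) / (2 * K + 1)) `^ (delta^-1) / n.+1%:R.
have r0 : 0 < (c - f x) / (2 * K + 1).
  by rewrite divr_gt0 ?subr_gt0//; lra.
have e0 : 0 < e by rewrite divr_gt0// powR_gt0.
have qx (i : 'I_n) : exists q : rat, x ord0 i < ratr q < x ord0 i + e.
  have : x ord0 i < x ord0 i + e by rewrite ltrDl.
  by move=> /rat_in_itvoo[q]; rewrite in_itv/=; exists q.
have [q hq] := choice qx.
exists (\row_i q i) => //=; rewrite in_itv/=.
set y := map_mx _ _.
have xy : enorm (x - y) <= ((c - f x) / (2 * K + 1)) `^ (delta^-1).
  apply: le_trans (enorm_le_sum _) _.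
  apply: (@le_trans _ _ (\sum_(i < n) e)).
    apply: ler_sum => i _; rewrite !mxE; have /andP[h1 h2] := hq i.
    rewrite ler_norml; lra.
  rewrite sumr_const card_ord /e -[leLHS]mulr_natr -mulrA.
  apply: ler_piMr; first exact: powR_ge0.
  by rewrite mulrC ler_pdivrMr// mul1r ler_nat.
have {}xy : enorm (x - y) `^ delta <= (c - f x) / (2 * K + 1).
  have -> : (c - f x) / (2 * K + 1) =
      (((c - f x) / (2 * K + 1)) `^ (delta^-1)) `^ delta.
    by rewrite -powRrM mulVf ?gt_eqF// powRr1 ?(ltW r0).
  by apply: ge0_ler_powR; rewrite ?nnegrE ?powR_ge0 ?enorm_ge0// ltW.
have := fK x y; rewrite distrC => /(le_trans (ler_norm _)) fxy.
have {}xy : (2 * K + 1) * enorm (x - y) `^ delta <= c - f x.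
  have K1 : 0 < 2 * K + 1 by rewrite addr_gt0// mulr_gt0.
  by rewrite ler_pdivlMr// in xy; rewrite mulrC.
have := powR_ge0 (enorm (x - y)) delta.
rewrite mulrDl mul1r -mulrA in xy.
move: xy fxy fc; set D := enorm _ `^ _ => xy fxy fc.
rewrite le_eqVlt => /orP[/eqP D0|D0]; last by lra.
by move: xy fxy; rewrite -D0 mulr0; lra.
Qed.

End euclidean_norm.

(** * The Cotlar-Stein lemma for antisymmetric operators *)

Lemma bernoulli_le (R : realType) (h : R) m : 0 <= h -> 1 + h *+ m <= (1 + h) ^+ m.
Proof.
move=> h0; elim: m => [|m IH]; first by rewrite mulr0n addr0 expr0.
rewrite exprS mulrS.
have : (1 + h) * (1 + h *+ m) <= (1 + h) * (1 + h) ^+ m by rewrite ler_wpM2l ?addr_ge0.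
apply: le_trans; rewrite mulrDl mul1r mulrDr mulr1.
have : 0 <= h * (h *+ m) by rewrite mulr_ge0 ?mulrn_wge0.
lra.
Qed.

(** Take 2 ^ r-th roots: the constant M disappears as r grows. *)
Lemma le_of_powers (R : realType) (x y M : R) : 0 <= x -> 0 <= y ->
  (forall r, x ^+ (2 ^ r) <= M * y ^+ (2 ^ r)) -> x <= y.
Proof.
move=> x0 y0 H; rewrite leNgt; apply/negP => yx.
have xp : 0 < x by exact: le_lt_trans yx.
have yp : 0 < y.
  rewrite lt_neqAle y0 andbT eq_sym; apply/eqP => y_eq0.
  have := H 0; rewrite expn0 !expr1 y_eq0 mulr0 => /(lt_le_trans xp).
  by rewrite ltxx.
pose h := x / y - 1.
have h0 : 0 < h by rewrite subr_gt0 ltr_pdivlMr// mul1r.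
have M0 : 0 <= M.
  have := H 0; rewrite expn0 !expr1 => /(le_trans x0).
  by rewrite pmulr_lge0.
have := H (Num.truncn (M / h)).+1; set m := (2 ^ _)%N => Hm.
have mM : M < h *+ m.
  rewrite -mulr_natl -ltr_pdivrMr//.
  apply: lt_le_trans (truncnS_gt _) _.
  by rewrite ler_nat /m ltnW// ltn_expl.
have : (x / y) ^+ m <= M.
  by rewrite expr_div_n ler_pdivrMr// exprn_gt0.
have -> : x / y = 1 + h by rewrite /h addrC subrK.
move=> /(le_trans (bernoulli_le m (ltW h0))).
lra.
Qed.

Section Cotlar_Stein.
Context {R : realType} {W : lmodType R}.
(* D stands for a space of test functions, on which the form is defined. *)
Variables (D : set W) (ip : W -> W -> R).
Hypothesis D0 : D 0.
Hypothesis DD : forall f g, D f -> D g -> D (f + g).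
Hypothesis DZ : forall c f, D f -> D (c *: f).
Hypothesis ipC : forall f g, D f -> D g -> ip f g = ip g f.
Hypothesis ipDl : forall f g h, D f -> D g -> D h -> ip (f + g) h = ip f h + ip g h.
Hypothesis ipZl : forall c f h, D f -> D h -> ip (c *: f) h = c * ip f h.
Hypothesis ip_ge0 : forall f, D f -> 0 <= ip f f.

Definition ipnorm f := Num.sqrt (ip f f).
Local Notation nm := ipnorm.

Lemma ipnorm_ge0 f : 0 <= nm f. Proof. exact: sqrtr_ge0. Qed.

Lemma ipnorm_sqr f : D f -> nm f ^+ 2 = ip f f.
Proof. by move=> Df; rewrite sqr_sqrtr// ip_ge0. Qed.

Lemma ipDr f g h : D f -> D g -> D h -> ip f (g + h) = ip f g + ip f h.
Proof. move=> Df Dg Dh; rewrite (ipC Df (DD Dg Dh)) ipDl// (ipC Dg Df).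
by rewrite (ipC Dh Df). Qed.

Lemma ipZr c f h : D f -> D h -> ip f (c *: h) = c * ip f h.
Proof. by move=> Df Dh; rewrite (ipC Df (DZ c Dh)) ipZl// (ipC Dh Df). Qed.

Lemma ip_CS f g : D f -> D g -> `|ip f g| <= nm f * nm g.
Proof.
move=> Df Dg.
have H s t : 0 <= s ^+ 2 * ip f f + 2 * s * t * ip f g + t ^+ 2 * ip g g.
  have Dsf := DZ s Df; have Dtg := DZ t Dg.
  have := ip_ge0 (DD Dsf Dtg).
  rewrite ipDl ?ipDr ?ipZl ?ipZr ?(ipC Dg Df)//; last exact: DD.
  by congr (0 <= _); ring.
rewrite /nm -sqrtrM ?ip_ge0// -sqrtr_sqr ler_wsqrtr//.
have := ip_ge0 Dg; have := ip_ge0 Df.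
move: (ip f f) (ip g g) (ip f g) H => a b x H a0 b0.
have [bz|bn] := eqVneq b 0.
  have := H (- x) (a + 1); rewrite bz mulr0 mulr0 addr0.
  rewrite (_ : _ + _ = - (x ^+ 2 * (a + 2))); last by ring.
  by rewrite oppr_ge0 pmulr_lle0// ltr_wpDl.
have := H b (- x); rewrite (_ : _ + _ = b * (a * b - x ^+ 2)); last by ring.
by rewrite pmulr_rge0 ?subr_ge0// lt_neqAle eq_sym bn.
Qed.

Lemma ipnormD f g : D f -> D g -> nm (f + g) <= nm f + nm g.
Proof.
move=> Df Dg; have Dfg := DD Df Dg.
rewrite -(@ler_pXn2r _ 2)// ?nnegrE ?addr_ge0 ?ipnorm_ge0//.
rewrite sqrrD !ipnorm_sqr// ipDl// !ipDr// (ipC Dg Df).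
have := le_trans (ler_norm _) (ip_CS Df Dg); lra.
Qed.

Lemma D_sum (I : Type) (s : seq I) (F : I -> W) :
  (forall i, D (F i)) -> D (\sum_(i <- s) F i).
Proof.
by move=> DF; elim: s => [|i s IH]; rewrite ?big_nil ?big_cons//; exact: DD.
Qed.

Lemma ipnorm0 : nm 0 = 0.
Proof.
have := ipZl 0 D0 D0; rewrite scale0r mul0r => E.
by rewrite /nm /ipnorm E sqrtr0.
Qed.

Lemma ipnorm_sum (I : Type) (s : seq I) (F : I -> W) :
  (forall i, D (F i)) -> nm (\sum_(i <- s) F i) <= \sum_(i <- s) nm (F i).
Proof.
move=> DF; elim: s => [|i s IH]; first by rewrite !big_nil ipnorm0.
rewrite !big_cons (le_trans (ipnormD _ _))//; last by rewrite lerD2l.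
exact: D_sum.
Qed.

Variables (J : nat) (T : 'I_J -> W -> W).
Hypothesis DT : forall i f, D f -> D (T i f).
Hypothesis TD : forall i f g, D f -> D g -> T i (f + g) = T i f + T i g.
Hypothesis T0 : forall i, T i 0 = 0.
Hypothesis T_anti : forall i f g, D f -> D g -> ip (T i f) g = - ip f (T i g).
Variables (a C : R) (d : 'I_J -> 'I_J -> R).
Hypothesis a0 : 0 <= a.
Hypothesis C0 : 0 < C.
Hypothesis d0 : forall i j, 0 <= d i j.
Hypothesis Ta : forall i f, D f -> nm (T i f) <= a * nm f.
Hypothesis Td : forall i j f, D f -> nm (T i (T j f)) <= d i j * nm f.
Hypothesis dC : forall j, \sum_(i < J) Num.sqrt (d i j) <= C.

Let S f := \sum_(i < J) T i f.

Let DS f : D f -> D (S f).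
Proof. by move=> Df; apply: D_sum => i; exact: DT. Qed.

Let T_sum i (I : Type) (s : seq I) (F : I -> W) :
  (forall i, D (F i)) -> T i (\sum_(j <- s) F j) = \sum_(j <- s) T i (F j).
Proof.
move=> DF; elim: s => [|j s IH]; rewrite ?big_nil ?big_cons// TD ?IH//.
exact: D_sum.
Qed.

Fixpoint words m : seq (seq 'I_J) :=
  if m is m'.+1 then [seq i :: s | i <- index_enum 'I_J, s <- words m'] else [:: [::]].

Let wordsS m :
  words m.+1 = [seq i :: s | i <- index_enum 'I_J, s <- words m].
Proof. by []. Qed.

Let Tw (s : seq 'I_J) f := foldr T f s.

Let DTw s f : D f -> D (Tw s f).
Proof. by move=> Df; elim: s => //= i s IH; exact: DT. Qed.

Let iterSE m f : D f -> iter m S f = \sum_(s <- words m) Tw s f.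
Proof.
move=> Df; elim: m => [|m IH]; first by rewrite big_seq1.
rewrite iterS IH /S wordsS big_allpairs_dep.
by apply: eq_bigr => i _; rewrite T_sum// => s; exact: DTw.
Qed.

(** Two bounds for a word of operators, which pair its letters as (T T) (T T) ... and
    as T (T T) (T T) ...; in their geometric mean q each pair of consecutive letters
    i, j contributes exactly sqrt (d i j). *)
Let b1 : seq 'I_J -> R := fix b1 s :=
  match s with [::] => 1 | [:: i] => a | i :: (j :: s') => d i j * b1 s' end.
Let b2 (s : seq 'I_J) : R := match s with [::] => 1 | i :: s' => a * b1 s' end.

Let b1_ge0 s : 0 <= b1 s.
Proof.
have [k] := ubnP (size s); elim: k s => // k IH [|i [|j s]]//= sk.
by apply: mulr_ge0 => //; apply: IH; rewrite -ltnS ltnW.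
Qed.

Let b2_ge0 s : 0 <= b2 s.
Proof. by case: s => //= i s; rewrite mulr_ge0. Qed.

Let Tw_b1 s f : D f -> nm (Tw s f) <= b1 s * nm f.
Proof.
move=> Df; have [k] := ubnP (size s); elim: k s => // k IH [|i [|j s]]//= sk.
- by rewrite mul1r.
- exact: Ta.
- apply: le_trans (Td _ _ (DTw s Df)) _; rewrite -mulrA ler_wpM2l//.
  by apply: IH; rewrite -ltnS ltnW.
Qed.

Let Tw_b2 s f : D f -> nm (Tw s f) <= b2 s * nm f.
Proof.
case: s => [|i s] Df /=; first by rewrite mul1r.
apply: le_trans (Ta _ (DTw s Df)) _; rewrite -mulrA ler_wpM2l//.
exact: Tw_b1.
Qed.

Let q s := Num.sqrt (b1 s * b2 s).

Let Tw_q s f : D f -> nm (Tw s f) <= q s * nm f.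
Proof.
move=> Df; rewrite -(@ler_pXn2r _ 2)// ?nnegrE ?mulr_ge0 ?sqrtr_ge0//.
rewrite exprMn [q s ^+ 2]sqr_sqrtr ?mulr_ge0 ?b1_ge0 ?b2_ge0//.
have -> : b1 s * b2 s * nm f ^+ 2 = (b1 s * nm f) * (b2 s * nm f) by ring.
by rewrite expr2 ler_pM ?ipnorm_ge0 ?Tw_b1 ?Tw_b2.
Qed.

Let q_cons i j s : q (i :: j :: s) = Num.sqrt (d i j) * q (j :: s).
Proof.
rewrite /q -sqrtrM ?d0//; congr Num.sqrt; rewrite /b2 -/b2.
have -> : b1 [:: i, j & s] = d i j * b1 s by [].
ring.
Qed.

Let sum_q m : \sum_(s <- words m.+1) q s <= J%:R * a * C ^+ m.
Proof.
elim: m => [|m IH].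
  rewrite wordsS big_allpairs_dep expr0 mulr1.
  under eq_bigr do rewrite big_seq1 /q/= mulr1 -expr2 sqrtr_sqr ger0_norm//.
  by rewrite big_const card_ord iter_addr_0 mulr_natl.
rewrite wordsS big_allpairs_dep.
rewrite exprS mulrCA; apply: le_trans (_ : C * \sum_(s <- words m.+1) q s <= _); last first.
  by rewrite ler_wpM2l// ltW.
rewrite exchange_big mulr_sumr wordsS !big_allpairs_dep.
apply: ler_sum => j _; apply: ler_sum => s _.
under eq_bigr do rewrite q_cons.
by rewrite -mulr_suml ler_wpM2r ?sqrtr_ge0.
Qed.

Let S_anti f g : D f -> D g -> ip (S f) g = - ip f (S g).
Proof.
move=> Df Dg; rewrite /S.
elim: (index_enum _) => [|i s IH].
  by rewrite !big_nil -(scale0r 0) ipZl// ipZr// !mul0r oppr0.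
rewrite !big_cons ipDl//; last 2 first.
- exact: DT.
- by apply: D_sum => j; exact: DT.
rewrite ipDr//; last 2 first.
- exact: DT.
- by apply: D_sum => j; exact: DT.
by rewrite IH T_anti// opprD.
Qed.

Let Diter m f : D f -> D (iter m S f).
Proof. by move=> Df; elim: m => //= m IH; exact: DS. Qed.

Let iter_anti m f g : D f -> D g ->
  ip (iter m S f) g = (-1) ^+ m * ip f (iter m S g).
Proof.
elim: m f g => [|m IH] f g Df Dg; first by rewrite expr0 mul1r.
rewrite iterS S_anti//; last exact: Diter.
by rewrite IH//; [rewrite -iterSr exprS mulN1r mulNr|exact: DS].
Qed.

(** The power S ^ m is symmetric or antisymmetric. *)
Let iter_sqr m f : D f -> nm (iter m S f) ^+ 2 <= nm f * nm (iter (m + m) S f).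
Proof.
move=> Df; rewrite ipnorm_sqr; last exact: Diter.
rewrite iter_anti//; last exact: Diter.
rewrite -iterD; apply: le_trans (ler_norm _) _.
rewrite normrM normrX normrN1 expr1n mul1r; apply: ip_CS => //; exact: Diter.
Qed.

Let power_le r f : D f ->
  nm (S f) ^+ (2 ^ r) <= nm (iter (2 ^ r) S f) * nm f ^+ (2 ^ r).-1.
Proof.
move=> Df; elim: r => [|r IH]; first by rewrite expn0 expr1 expr0 mulr1.
rewrite expnS mulnC exprM; set m := (2 ^ r)%N in IH *.
have m0 : (0 < m)%N by rewrite expn_gt0.
apply: (@le_trans _ _ ((nm (iter m S f) * nm f ^+ m.-1) ^+ 2)).
  by rewrite ler_sqr ?nnegrE ?mulr_ge0 ?exprn_ge0 ?ipnorm_ge0.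
rewrite exprMn.
apply: le_trans (ler_wpM2r _ (iter_sqr m Df)) _; first exact: sqr_ge0.
have -> : (m * 2 = m + m)%N by lia.
have -> : ((m + m).-1 = (m.-1 * 2).+1)%N by lia.
by rewrite [X in _ <= _ * X]exprS exprM (mulrC (nm f)) -mulrA.
Qed.

(** As S = \sum_i T i is antisymmetric, |S f| ^ (2 ^ r) is at most
    |S ^ (2 ^ r) f| |f| ^ (2 ^ r - 1). The power expands into words bounded by q, and
    summing them letter by letter costs a factor C per letter; the remaining factor
    J a disappears by [le_of_powers]. *)
Lemma Cotlar_Stein f : D f -> nm (\sum_(i < J) T i f) <= C * nm f.
Proof.
move=> Df; apply: (@le_of_powers _ _ _ (J%:R * a / C)).
- exact: ipnorm_ge0.
- by rewrite mulr_ge0 ?ipnorm_ge0// ltW.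
move=> r; apply: le_trans (power_le r Df) _.
set m := (2 ^ r)%N; have m0 : (0 < m)%N by rewrite expn_gt0.
rewrite iterSE//; case: m m0 => // m _; rewrite [m.+1.-1]/=.
apply: (@le_trans _ _ ((\sum_(s <- words m.+1) q s * nm f) * nm f ^+ m)).
  rewrite ler_wpM2r ?exprn_ge0 ?ipnorm_ge0//.
  apply: le_trans (ipnorm_sum _ _) _; first by move=> s; exact: DTw.
  by apply: ler_sum => s _; exact: Tw_q.
rewrite -mulr_suml -mulrA -exprS exprMn mulrA ler_wpM2r ?exprn_ge0 ?ipnorm_ge0//.
apply: le_trans (sum_q m) _.
by rewrite exprS mulrA divfK ?gt_eqF.
Qed.

End Cotlar_Stein.

(** * Convolutions *)

Section power_bounds.
Context {R : realType}.

Lemma exprB_le (B a b : R) m : 1 <= B -> 0 <= a <= B -> 0 <= b <= B ->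
  `|b ^+ m - a ^+ m| <= m%:R * B ^+ m * `|b - a|.
Proof.
move=> B1 /andP[a0 aB] /andP[b0 bB]; have B0 : 0 <= B by apply: le_trans B1.
elim: m => [|m IH]; first by rewrite !expr0 subrr normr0 !mul0r.
have -> : b ^+ m.+1 - a ^+ m.+1 = b * (b ^+ m - a ^+ m) + (b - a) * a ^+ m.
  by rewrite !exprS; ring.
apply: le_trans (ler_normD _ _) _; rewrite !normrM (ger0_norm b0).
have h1 : b * `|b ^+ m - a ^+ m| <= B * (m%:R * B ^+ m * `|b - a|).
  by apply: ler_pM.
have h2 : `|b - a| * `|a ^+ m| <= `|b - a| * B ^+ m.+1.
  rewrite ler_wpM2l// ger0_norm ?exprn_ge0//.
  apply: (@le_trans _ _ (B ^+ m)); first by rewrite lerXn2r ?nnegrE.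
  by rewrite exprS ler_peMl ?exprn_ge0.
apply: le_trans (lerD h1 h2) _.
by rewrite -natr1 exprS; apply/eqP/eqP => //; rewrite le_eqVlt; apply/orP; left;
  apply/eqP; ring.
Qed.

Lemma exprVB_le (B a b : R) m : 1 <= a <= B -> 1 <= b <= B ->
  `|b ^- m - a ^- m| <= m%:R * B ^+ m * `|b - a|.
Proof.
move=> /andP[a1 aB] /andP[b1 bB].
have am : 1 <= a ^+ m by rewrite exprn_ege1.
have bm : 1 <= b ^+ m by rewrite exprn_ege1.
have am0 : 0 < a ^+ m by apply: lt_le_trans am.
have bm0 : 0 < b ^+ m by apply: lt_le_trans bm.
have -> : b ^- m - a ^- m = (a ^+ m - b ^+ m) / (a ^+ m * b ^+ m).
  by field; rewrite !gt_eqF.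
rewrite normrM; apply: (@le_trans _ _ (`|a ^+ m - b ^+ m| * 1)).
  rewrite ler_wpM2l// normfV invf_le1 ?normr_gt0 ?mulf_neq0 ?gt_eqF//.
  by rewrite ger0_norm ?mulr_ge0 ?(ltW am0) ?(ltW bm0)// mulr_ege1.
rewrite mulr1 distrC; apply: exprB_le; first exact: le_trans aB.
  by rewrite aB (le_trans _ a1).
by rewrite bB (le_trans _ b1).
Qed.

Lemma sum_geom_dist (s : R) (J : nat) (j : 'I_J) : 0 <= s < 1 ->
  \sum_(i < J) s ^+ ((i - j) + (j - i))%N <= 2 * (1 - s)^-1.
Proof.
move=> /[dup] s01 /andP[s0 s1].
have H1 m : \sum_(i < m.+1) s ^+ (m - i)%N <= (1 - s)^-1.
  rewrite (reindex_inj rev_ord_inj)/=.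
  rewrite (eq_bigr (fun i : 'I_m.+1 => s ^+ i)); first exact: geom_sum_le.
  by move=> i _; congr (_ ^+ _); have := ltn_ord i; lia.
have H2 p m : \sum_(i < p + m) (if (p <= i)%N then s ^+ (i - p)%N else 0) <= (1 - s)^-1.
  rewrite big_split_ord/= big1 ?add0r; last first.
    by move=> i _; rewrite leqNgt ltn_ord.
  rewrite (eq_bigr (fun i : 'I_m => s ^+ i)); first exact: geom_sum_le.
  by move=> i _; rewrite leq_addr addKn.
have H3 p m : \sum_(i < p.+1 + m) (if (i <= p)%N then s ^+ (p - i)%N else 0) <= (1 - s)^-1.
  rewrite big_split_ord/= [X in _ + X]big1 ?addr0; last first.
    by move=> i _; rewrite leqNgt ltnS leq_addr.
  apply: le_trans (H1 p); apply: ler_sum => i _.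
  by rewrite -ltnS ltn_ord.
have jJ := ltn_ord j.
apply: (@le_trans _ _ (\sum_(i < J) ((if (j <= i)%N then s ^+ (i - j)%N else 0) +
   (if (i <= j)%N then s ^+ (j - i)%N else 0)))).
  apply: ler_sum => i _; case: leqP => ij; case: leqP => ji.
  - by rewrite (_ : (j - i = 0)%N) ?addn0 ?lerDl ?exprn_ge0//; lia.
  - by rewrite (_ : (j - i = 0)%N) ?addn0 ?addr0//; lia.
  - by rewrite (_ : (i - j = 0)%N) ?add0n ?add0r//; lia.
  - lia.
rewrite big_split/= mulrDl mul1r lerD//.
  have := H2 j (J - j)%N; rewrite (_ : (j + (J - j) = J)%N); last by lia.
  by [].
have := H3 j (J - j.+1)%N; rewrite (_ : (j.+1 + (J - j.+1) = J)%N); last by lia.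
by [].
Qed.

End power_bounds.

Section convolution.
Context {R : realType} {n : nat}.
Local Notation V := 'rV[R]_n.
Local Notation mu := (@lebesgue_rV R n).
Implicit Types f g k : V -> R.

Definition convol k f x : R := \int[mu]_y (k y * f (x - y)).

(** A space of test functions, stable under convolution, for which all the integrals
    of the L^2 theory converge absolutely. *)
Definition bddL1 f := [/\ measurable_fun setT f, (exists M : R, forall x, `|f x| <= M) &
  mu.-integrable setT (EFin \o f)].

Lemma measurable_sub_comp f : measurable_fun setT f ->
  measurable_fun setT (fun z : V * V => f (z.1 - z.2)).
Proof. by move=> mf; apply: measurableT_comp => //; exact: measurable_sub_row. Qed.

Lemma measurable_comp_snd f : measurable_fun setT f ->
  measurable_fun setT (fun z : V * V => f z.2).
Proof. by move=> mf; exact: (measurableT_comp mf measurable_snd). Qed.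

Lemma measurable_comp_fst f : measurable_fun setT f ->
  measurable_fun setT (fun z : V * V => f z.1).
Proof. by move=> mf; exact: (measurableT_comp mf measurable_fst). Qed.

Lemma measurable_reflect f (x : V) : measurable_fun setT f ->
  measurable_fun setT (fun y : V => f (x - y)).
Proof.
by move=> mf; apply: measurableT_comp => //; apply: measurable_rowB => //.
Qed.

Lemma measurable_shift f (x : V) : measurable_fun setT f ->
  measurable_fun setT (fun y : V => f (y - x)).
Proof.
by move=> mf; apply: measurableT_comp => //; apply: measurable_rowB => //.
Qed.

Lemma measurable_convol k f : measurable_fun setT k -> measurable_fun setT f ->
  measurable_fun setT (convol k f).
Proof.
move=> mk mf; apply: (@measurable_Rintegral _ _ _ _ _ mu (fun z : V * V => k z.2 * f (z.1 - z.2))).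
apply: measurable_funM; last exact: measurable_sub_comp.
by apply: measurableT_comp => //; exact: measurable_snd.
Qed.

Lemma integrable_bdd_mul (k f : V -> R) (M : R) : measurable_fun setT f ->
  (forall x, `|f x| <= M) -> mu.-integrable setT (EFin \o k) ->
  mu.-integrable setT (EFin \o (fun x => k x * f x)).
Proof.
move=> mf fM ki.
have mk : measurable_fun setT k.
  by have /measurable_int := ki; move/measurable_EFinP.
apply: (@le_integrable _ _ _ mu setT measurableT _ (EFin \o (fun x => M * k x))).
- by apply/measurable_EFinP; exact: measurable_funM.
- move=> x _ /=; rewrite lee_fin !normrM mulrC ler_wpM2r//.
  by rewrite (le_trans (fM x))// ler_norm.
- exact: integrableZR.
Qed.

Lemma integrable_convol k f x : bddL1 f -> mu.-integrable setT (EFin \o k) ->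
  mu.-integrable setT (EFin \o (fun y => k y * f (x - y))).
Proof.
move=> [mf [M fM] _] ki; apply: (integrable_bdd_mul (M := M)) => //.
exact: measurable_reflect.
Qed.

Lemma conv_L1 k f : measurable_fun setT k -> measurable_fun setT f ->
  (\int[mu]_x `|convol k f x|%:E <=
   (\int[mu]_y `|k y|%:E) * (\int[mu]_x `|f x|%:E))%E.
Proof.
move=> mk mf.
have mk' : measurable_fun setT (fun y => `|k y|) by exact: measurableT_comp.
have mf' : measurable_fun setT (fun y => `|f y|) by exact: measurableT_comp.
apply: (@le_trans _ _ (\int[mu]_x \int[mu]_y (`|k y| * `|f (x - y)%R|)%:E)%E).
  apply: ge0_le_integralT => x; first by rewrite lee_fin.
  by apply: le_trans (normr_Rintegral_le _ _) _; under eq_integral do rewrite normrM.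
rewrite (fubini_tonelli (fun z : V * V => (`|k z.2| * `|f (z.1 - z.2)%R|)%:E)) /=.
- under eq_integral => y _.
    rewrite ge0_intZ//; last exact: measurable_shift mf'.
    rewrite (ge0_integral_shift y mf')//.
    over.
  by rewrite /= ge0_integralZr//; [exact/measurable_EFinP|exact: integral_ge0].
- apply/measurable_EFinP; apply: measurable_funM; last exact: measurable_sub_comp mf'.
  exact: measurable_comp_snd mk'.
- by move=> z; rewrite lee_fin mulr_ge0.
Qed.

Lemma bddL1_convol k f : bddL1 k -> bddL1 f -> bddL1 (convol k f).
Proof.
move=> [mk _ ki] [mf [M fM] fi]; have mc := measurable_convol mk mf.
have M0 : 0 <= M by apply: le_trans (fM 0).
split=> //.
  exists (\int[mu]_y `|k y| * M) => x.
  apply: normr_Rintegral_le_fin.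
  apply: (@le_trans _ _ (\int[mu]_y (M * `|k y|)%:E)%E).
    by apply: ge0_le_integralT => y; rewrite lee_fin// normrM mulrC ler_wpM2r.
  rewrite ge0_intZ//; last exact: measurableT_comp.
  by rewrite integrable_normE// -EFinM mulrC.
apply: (integrable_le (M := \int[mu]_y `|k y| * \int[mu]_x `|f x|)) => //.
by apply: le_trans (conv_L1 mk mf) _; rewrite !integrable_normE.
Qed.

Lemma bddL1_0 : bddL1 (fun=> 0).
Proof.
split=> //; first by exists 0 => x; rewrite normr0.
exact: integrable0.
Qed.

Lemma bddL1D f g : bddL1 f -> bddL1 g -> bddL1 (fun x => f x + g x).
Proof.
move=> [mf [M fM] fi] [mg [N gN] gi]; split.
- exact: measurable_funD.
- by exists (M + N) => x; rewrite (le_trans (ler_normD _ _))// lerD.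
- exact: integrableDR.
Qed.

Lemma bddL1Z c f : bddL1 f -> bddL1 (fun x => c * f x).
Proof.
move=> [mf [M fM] fi]; split.
- exact: measurable_funM.
- by exists (`|c| * M) => x; rewrite normrM ler_wpM2l.
- exact: integrableZR.
Qed.

Lemma bddL1M f g : bddL1 f -> bddL1 g -> mu.-integrable setT (EFin \o (fun x => f x * g x)).
Proof. by move=> [mf _ fi] [mg [M gM] gi]; exact: integrable_bdd_mul gM fi. Qed.

Lemma conv_addr k f g x : bddL1 k -> bddL1 f -> bddL1 g ->
  convol k (fun x => f x + g x) x = convol k f x + convol k g x.
Proof.
move=> [_ _ ki] Df Dg; rewrite /convol -RintegralD//; try exact: integrable_convol.
by apply: eq_Rintegral => y _; rewrite mulrDr.
Qed.

Lemma conv_L2 k f a q : 0 < a -> 0 <= q ->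
  measurable_fun setT k -> measurable_fun setT f ->
  (\int[mu]_y `|k y|%:E <= a%:E)%E -> (\int[mu]_x (f x ^+ 2)%:E <= q%:E)%E ->
  (\int[mu]_x (convol k f x ^+ 2)%:E <= (a ^+ 2 * q)%:E)%E.
Proof.
move=> a0 q0 mk mf ka fq.
apply: (Minkowski_L2 (F := fun z : V * V => f (z.1 - z.2))) => //.
  exact: measurable_sub_comp.
move=> y; rewrite /= (ge0_integral_shift y (f := fun x => f x ^+ 2))//.
  exact: measurable_funX.
by move=> x; exact: sqr_ge0.
Qed.

Definition ip f g : R := \int[mu]_x (f x * g x).

Lemma convolE k f x : measurable_fun setT k -> measurable_fun setT f ->
  convol k f x = \int[mu]_y (k (x - y) * f y).
Proof.
move=> mk mf; rewrite /convol -(Rintegral_reflect x (f := fun y => k y * f (x - y))).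
  by apply: eq_Rintegral => y _; rewrite subKr.
by apply: measurable_funM => //; exact: measurable_reflect.
Qed.

(** Exchange the two integrals: k (x - y) changes sign when x and y are exchanged. *)
Lemma conv_anti k f g : bddL1 k -> bddL1 f -> bddL1 g -> (forall x, k (- x) = - k x) ->
  ip (convol k f) g = - ip f (convol k g).
Proof.
move=> Dk Df Dg kN; have [mk [Mk kM] ki] := Dk.
have [mf [Mf fM] fi] := Df; have [mg [Mg gM] gi] := Dg.
pose H := fun z : V * V => f z.2 * (g z.1 * k (z.1 - z.2)).
have mH : measurable_fun setT H.
  apply: measurable_funM; first exact: measurable_comp_snd.
  by apply: measurable_funM; [exact: measurable_comp_fst|exact: measurable_sub_comp].
have mk' : measurable_fun setT (fun y => `|k y|) by exact: measurableT_comp.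
have fk x : mu.-integrable setT (EFin \o (fun y : V => f y * k (x - y))).
  by apply: (integrable_bdd_mul (M := Mk)) => //; exact: measurable_reflect.
have gk y : mu.-integrable setT (EFin \o (fun x : V => g x * k (x - y))).
  by apply: (integrable_bdd_mul (M := Mk)) => //; exact: measurable_shift.
have Mg0 : 0 <= Mg by apply: le_trans (gM 0).
have Hi : (\int[mu]_y \int[mu]_x `|H (x, y)|%:E < +oo)%E.
  apply: (@le_lt_trans _ _ (\int[mu]_y ((Mg * \int[mu]_x `|k x|) * `|f y|)%:E)%E).
    apply: ge0_le_integralT => y.
      by apply: integral_ge0 => x _; rewrite lee_fin.
    apply: (@le_trans _ _ (\int[mu]_x ((Mg * `|f y|) * `|k (x - y)|)%:E)%E).
      apply: ge0_le_integralT => x; rewrite ?lee_fin//.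
      by rewrite /H /= !normrM mulrA ler_wpM2r// mulrC ler_wpM2r.
    rewrite ge0_intZ ?mulr_ge0//; last exact: measurable_shift mk'.
    by rewrite (ge0_integral_shift y mk')// integrable_normE// -EFinM lee_fin mulrAC.
  rewrite ge0_intZ ?mulr_ge0 ?Rintegral_ge0//; last exact: measurableT_comp.
  by rewrite integrable_normE// -EFinM ltry.
transitivity (\int[mu]_x (\int[mu]_y H (x, y))).
  apply: eq_Rintegral => x _; rewrite convolE// mulrC -RintegralZl//; last first.
    by apply: eq_integrableR (fk x) => y; rewrite mulrC.
  by apply: eq_Rintegral => y _; rewrite /H/=; ring.
rewrite (Rintegral_Fubini (G := H))//; last 2 first.
- move=> x; apply: eq_integrableR (integrableZR (g x) (fk x)) => y.
  by rewrite /H/=; ring.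
- by move=> y; exact: (integrableZR (f y) (gk y)).
rewrite -mulN1r -RintegralZl//; last by apply: bddL1M => //; exact: bddL1_convol.
apply: eq_Rintegral => y _; rewrite mulN1r -mulrN.
transitivity (f y * \int[mu]_x (g x * k (x - y))); first by rewrite -RintegralZl.
congr (_ * _).
rewrite convolE// -mulN1r -RintegralZl//; last first.
  apply: (eq_integrableR (f := (fun x : V => -1 * (g x * k (x - y))))); last exact: integrableZR.
  by move=> x; rewrite -(opprB x y) kN; ring.
by apply: eq_Rintegral => x _; rewrite -(opprB x y) kN; ring.
Qed.

Lemma conv_shiftB k f x y : bddL1 k -> bddL1 f ->
  convol k f (x - y) - convol k f x = convol (fun z => k (z - y) - k z) f x.
Proof.
move=> Dk Df; have [mk [M kM] ki] := Dk; have [mf [Mf fM] fi] := Df.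
have E : convol k f (x - y) = \int[mu]_z (k (z - y) * f (x - z)).
  have mF : measurable_fun setT (fun z : V => k (z - y) * f (x - z)).
    by apply: measurable_funM; [exact: measurable_shift|exact: measurable_reflect].
  have := Rintegral_affine y (oner_neq0 R) mF.
  rewrite normr1 expr1n invr1 mul1r => <-.
  by apply: eq_Rintegral => z _ /=; rewrite scale1r addrK opprD addrA addrAC.
rewrite E /convol -RintegralB//; last 2 first.
- apply: (eq_integrableR (f := (fun z : V => f (x - z) * k (z - y)))) => //.
    by move=> z /=; rewrite mulrC.
  apply: (integrable_bdd_mul (M := M)) => //; first exact: measurable_shift.
  apply: (integrable_le (M := \int[mu]_z `|f z|)); first exact: measurable_reflect.
  rewrite (ge0_integral_reflect x (f := fun z => `|f z|))//; last exact: measurableT_comp.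
  by rewrite integrable_normE.
- exact: integrable_convol.
by apply: eq_Rintegral => z _; rewrite mulrBl.
Qed.

(** Almost orthogonality. As k1 has mean zero, k1 * (k2 * f) (x) integrates k1 y
    against (k2 * f) (x - y) - (k2 * f) (x), which is a convolution of f with the
    increment of k2 by y, of L^1 norm at most w on the support of k1. Conclude by
    Minkowski's inequality. *)
Lemma conv_conv_L2 (k1 k2 f : V -> R) (a q w r : R) : 0 < a -> 0 <= q -> 0 < w ->
  bddL1 k1 -> bddL1 k2 -> bddL1 f ->
  \int[mu]_x k1 x = 0 -> (forall x, r < enorm x -> k1 x = 0) ->
  (\int[mu]_y `|k1 y|%:E <= a%:E)%E ->
  (forall y, enorm y <= r -> (\int[mu]_z `|k2 (z - y)%R - k2 z|%:E <= w%:E)%E) ->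
  (\int[mu]_x (f x ^+ 2)%:E <= q%:E)%E ->
  (\int[mu]_x (convol k1 (convol k2 f) x ^+ 2)%:E <= ((a * w) ^+ 2 * q)%:E)%E.
Proof.
move=> a0 q0 w0 Dk1 Dk2 Df k10 k1r k1a k2w fq.
have [mk1 _ k1i] := Dk1; have [mk2 _ k2i] := Dk2; have [mf _ fi] := Df.
have Dg := bddL1_convol Dk2 Df; have [mg _ gi] := Dg.
pose F := fun z : V * V => (convol k2 f (z.1 - z.2) - convol k2 f z.1) * \1_(eball r) z.2.
have E x : convol k1 (convol k2 f) x = \int[mu]_y (k1 y * F (x, y)).
  rewrite -[LHS]subr0 -[X in _ - X](mul0r (convol k2 f x)) -k10.
  rewrite -RintegralZr// -RintegralB//; last 2 first.
  - exact: integrable_convol Dg k1i.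
  - by apply: (eq_integrableR (f := (fun y : V => convol k2 f x * k1 y))) => [y|];
      [rewrite mulrC|exact: integrableZR].
  apply: eq_Rintegral => y _; rewrite /F/= indicE.
  have [yr|yr] := lerP (enorm y) r; first by rewrite mem_set// mulr1 mulrBr.
  by rewrite (k1r _ yr) !mul0r subr0.
under eq_integral do rewrite E.
rewrite exprMn -mulrA; apply: (Minkowski_L2 (F := F)) => //.
- by rewrite mulr_ge0// sqr_ge0.
- apply: measurable_funM; last first.
    apply: (measurable_comp_snd (f := \1_(eball r))).
    by apply: measurable_indic; exact: measurable_enorm_le.
  apply: measurable_funB; first exact: measurable_sub_comp.
  by apply: measurableT_comp => //; exact: measurable_fst.
- move=> y; rewrite /F/= indicE.
  have [yr|yr] := boolP (y \in eball r); last first.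
    under eq_integral do rewrite mulr0 expr0n/=.
    by rewrite integral0 lee_fin mulr_ge0// sqr_ge0.
  under eq_integral do rewrite mulr1 conv_shiftB//.
  apply: conv_L2 => //; last by apply: k2w; rewrite inE in yr.
  by apply: measurable_funB => //; exact: measurable_shift.
Qed.

End convolution.

(** * Dyadic pieces of the Riesz kernels *)

Section riesz_pieces.
Context {R : realType} {n : nat}.
Local Notation V := 'rV[R]_n.
Local Notation mu := (@lebesgue_rV R n).
Variable l : 'I_n.
Implicit Types (x y h z : V) (r t : R).

(** The Riesz kernel without its constant [riesz_cst]. *)
Definition rker x : R := x ord0 l / enorm x ^+ n.+1.

Definition ann r x : R := if r < enorm x <= 2 * r then rker x else 0.

Lemma rkerN x : rker (- x) = - rker x.
Proof. by rewrite /rker enormN mxE mulNr. Qed.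

Lemma annN r x : ann r (- x) = - ann r x.
Proof. by rewrite /ann enormN rkerN; case: ifP => // _; rewrite oppr0. Qed.

Lemma rker_le x : 0 < enorm x -> `|rker x| <= enorm x ^- n.
Proof.
move=> x0; rewrite /rker normrM normfV [`|enorm x ^+ _|]ger0_norm ?exprn_ge0 ?(ltW x0)//.
rewrite ler_pdivrMr ?exprn_gt0// exprS mulrCA mulVf ?expf_neq0 ?gt_eqF// mulr1.
exact: enorm_coord.
Qed.

Lemma rkerZ c x : 0 < c -> rker (c *: x) = c ^- n * rker x.
Proof.
move=> c0; rewrite /rker enormZ mxE gtr0_norm// exprMn exprS invfM invfM.
rewrite [LHS](_ : _ = (c * c^-1) * (c ^- n * (x ord0 l / enorm x ^+ n.+1))).
  by rewrite mulfV ?gt_eqF// mul1r.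
ring.
Qed.

Lemma ann_scale r x : 0 < r -> ann r x = r ^- n * ann 1 (r^-1 *: x).
Proof.
move=> r0; rewrite /ann enormZ gtr0_norm ?invr_gt0//.
have -> : (1 < r^-1 * enorm x) = (r < enorm x) by rewrite ltr_pdivlMl// mulr1.
have -> : (r^-1 * enorm x <= 2 * 1) = (enorm x <= 2 * r).
  by rewrite ler_pdivrMl// mulr1 mulrC.
case: ifP => _; last by rewrite mulr0.
by rewrite rkerZ ?invr_gt0// exprVn invrK mulrA mulVf ?mul1r// expf_neq0 ?gt_eqF.
Qed.

Lemma measurable_rker : measurable_fun setT rker.
Proof.
rewrite /rker (_ : (fun x => _) =
    fun x => x ord0 l * ((enorm x ^+ n.+1) `^ (-1))); last first.
  by apply/funext => x; rewrite powR_inv1// exprn_ge0// enorm_ge0.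
apply: measurable_funM; first exact: measurable_coord.
apply: (measurableT_comp (f := fun r : R => r `^ (-1))).
  exact: measurable_powR.
by apply: measurable_funX; exact: measurable_enorm.
Qed.

Lemma measurable_ann r : measurable_fun setT (ann r).
Proof.
apply: measurable_fun_ifT => //; last exact: measurable_rker.
apply: measurable_and.
  by apply: measurable_fun_ltr => //; exact: measurable_enorm.
by apply: measurable_fun_ler => //; exact: measurable_enorm.
Qed.

Lemma ann_le r x : 0 < r -> `|ann r x| <= r ^- n * \1_(eball (2 * r)) x.
Proof.
move=> r0; rewrite /ann indicE; case: ifP => [/andP[rx xr]|_]; last first.
  by rewrite normr0 mulr_ge0// invr_ge0 exprn_ge0// ltW.
have x0 : 0 < enorm x := lt_trans r0 rx.
rewrite mem_set// mulr1 (le_trans (rker_le x0))//.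
rewrite lef_pV2 ?posrE ?exprn_gt0//.
by rewrite lerXn2r ?nnegrE ?enorm_ge0 ?ltW.
Qed.

Lemma ann_L1 r : 0 < r ->
  (\int[mu]_x `|ann r x|%:E <= (2 ^+ n * @vball R n + 1)%:E)%E.
Proof.
move=> r0; apply: (@le_trans _ _ (\int[mu]_x (r ^- n * \1_(eball (2 * r)) x)%:E)%E).
  by apply: ge0_le_integralT => x; rewrite lee_fin// ann_le.
rewrite integral_indic_eball ?mulr_gt0 ?invr_ge0 ?exprn_ge0 ?(ltW r0)//.
rewrite lee_fin exprMn.
rewrite (_ : r ^- n * _ = 2 ^+ n * @vball R n) ?lerDl//.
by field; rewrite expf_neq0// gt_eqF.
Qed.

Lemma annC_gt0 : 0 < 2 ^+ n * @vball R n + 1.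
Proof. by rewrite ltr_wpDl// mulr_ge0 ?exprn_ge0 ?vball_ge0. Qed.

Lemma bddL1_ann r : 0 < r -> bddL1 (ann r).
Proof.
move=> r0; split.
- exact: measurable_ann.
- exists (r ^- n) => x; apply: le_trans (ann_le x r0) _.
  by rewrite ler_piMr ?invr_ge0 ?exprn_ge0 ?(ltW r0)// indicE; case: (_ \in _).
- by apply: integrable_le (ann_L1 r0); exact: measurable_ann.
Qed.

Lemma ann_mean0 r : \int[mu]_x ann r x = 0.
Proof.
have := Rintegral_reflect 0 (measurable_ann r).
under eq_Rintegral do rewrite sub0r annN.
have [r0|r0] := ltP 0 r; last first.
  have E x : ann r x = 0.
    rewrite /ann; case: ifP => // /andP[h1 h2].
    by have := lt_le_trans h1 h2; lra.
  move=> _; rewrite /Rintegral (_ : (fun x => (ann r x)%:E) = cst 0%E) ?integral0//.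
  by apply/funext => x; rewrite E.
under eq_Rintegral do rewrite -mulN1r.
rewrite RintegralZl//; last by have [] := bddL1_ann r0.
lra.
Qed.

Lemma rker_lip x y : 1 <= enorm x <= 2 -> 1 <= enorm y <= 2 ->
  `|rker x - rker y| <= (1 + 2 * (n.+1%:R * 2 ^+ n.+1)) * enorm (x - y).
Proof.
move=> /[dup] x12 /andP[x1 x2] /[dup] y12 /andP[y1 y2].
have -> : rker x - rker y = (x ord0 l - y ord0 l) * enorm x ^- n.+1 +
   y ord0 l * (enorm x ^- n.+1 - enorm y ^- n.+1) by rewrite /rker; ring.
apply: le_trans (ler_normD _ _) _; rewrite [leRHS]mulrDl mul1r !normrM lerD//.
  rewrite -[leRHS]mulr1 ler_pM//.
    by have := enorm_coord (x - y) l; rewrite !mxE.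
  rewrite normfV invf_le1 ?normr_gt0 ?expf_neq0 ?gt_eqF ?(lt_le_trans ltr01)//.
  by rewrite ger0_norm ?exprn_ge0 ?enorm_ge0// exprn_ege1.
rewrite -mulrA ler_pM//; first exact: le_trans (enorm_coord _ _) y2.
apply: le_trans (exprVB_le n.+1 y12 x12) _.
rewrite ler_wpM2l ?mulr_ge0 ?exprn_ge0//.
rewrite ler_norml lerBrDr lerBlDr.
have := enorm_triD x y; have := enorm_triD y x; rewrite (enormBC y x); lra.
Qed.

(** On the intersection of the annulus with its translate the kernel is Lipschitz; the
    rest lies in two thin shells, around the spheres of radius 1 and 2, where the
    kernel is bounded by 1. *)
Lemma ann1_diff z h : enorm h <= 2^-1 ->
  `|ann 1 (z - h) - ann 1 z| <=
    (1 + 2 * (n.+1%:R * 2 ^+ n.+1)) * enorm h * \1_(eball 3) z +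
    \1_[set z | 1 - enorm h < enorm z <= 1 + enorm h] z +
    \1_[set z | 2 - enorm h < enorm z <= 2 + enorm h] z.
Proof.
move=> h2; set L := 1 + _.
have L0 : 0 <= L by rewrite /L addr_ge0// !mulr_ge0.
have h0 := enorm_ge0 h.
have t1 : enorm z <= enorm (z - h) + enorm h := enorm_triD z h.
have t2 : enorm (z - h) <= enorm z + enorm h.
  by have := enormD z (- h); rewrite enormN.
have i3 : 0 <= L * enorm h * \1_(eball 3) z by rewrite !mulr_ge0.
have i1 (A : set V) : 0 <= \1_A z :> R by [].
have Hle A w : 1 < enorm w -> A z -> `|rker w| <= \1_A z.
  move=> w1 Az; rewrite indicE mem_set//.
  rewrite (le_trans (rker_le _)) ?(lt_trans ltr01)//.
  by rewrite invf_le1 ?exprn_gt0 ?(lt_trans ltr01)// exprn_ege1// ltW.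
have Hle1 w B : 1 < enorm w -> 1 - enorm h < enorm z <= 1 + enorm h -> 0 <= B ->
    `|rker w| <= L * enorm h * \1_(eball 3) z +
      \1_[set z | 1 - enorm h < enorm z <= 1 + enorm h] z + B.
  move=> w1 Az B0; have := Hle [set z | 1 - enorm h < enorm z <= 1 + enorm h] w w1 Az.
  move=> Hw; apply: le_trans Hw _; rewrite -addrA ler_wpDl// lerDl//.
have Hle2 w B : 1 < enorm w -> 2 - enorm h < enorm z <= 2 + enorm h -> 0 <= B ->
    `|rker w| <= L * enorm h * \1_(eball 3) z + B +
      \1_[set z | 2 - enorm h < enorm z <= 2 + enorm h] z.
  move=> w1 Az B0; have := Hle [set z | 2 - enorm h < enorm z <= 2 + enorm h] w w1 Az.
  by move=> Hw; apply: le_trans Hw _; rewrite lerDr addr_ge0.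
have [hz|hn] := eqVneq h 0.
  by rewrite hz subr0 subrr normr0 !addr_ge0//; rewrite -hz.
have hp : 0 < enorm h.
  rewrite lt_neqAle enorm_ge0 andbT eq_sym; apply/eqP => /enorm_eq0.
  exact/eqP.
rewrite /ann mulr1.
case: ifP => [/andP[a1 a2]|aN]; case: ifP => [/andP[b1 b2]|bN].
- apply: (@le_trans _ _ (L * enorm h * \1_(eball 3) z)); last first.
    by rewrite -addrA lerDl addr_ge0.
  rewrite indicE mem_set ?mulr1; last by rewrite /eball/=; lra.
  have := @rker_lip (z - h) z; rewrite (_ : z - h - z = - h) ?enormN.
    by apply; rewrite ?(ltW a1) ?(ltW b1).
  by rewrite addrAC subrr sub0r.
- rewrite subr0; move/negbT: bN; rewrite negb_and -leNgt -ltNge => /orP[zc|zc].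
    by apply: Hle1 => //; apply/andP; split; lra.
  by apply: Hle2 => //; apply/andP; split; lra.
- rewrite sub0r normrN; move/negbT: aN; rewrite negb_and -leNgt -ltNge => /orP[zc|zc].
    by apply: Hle1 => //; apply/andP; split; lra.
  by apply: Hle2 => //; apply/andP; split; lra.
- by rewrite subrr normr0 !addr_ge0.
Qed.

Lemma measurable_shell (a b : R) : measurable [set z : V | a < enorm z <= b].
Proof.
have me := @measurable_enorm R n.
rewrite (_ : [set z | _] = (@enorm R n) @^-1` `]a, b]%classic).
  rewrite -[X in measurable X]setTI.
  exact: (me measurableT _ (measurable_itv _)).
by apply/seteqP; split => x /=; rewrite in_itv.
Qed.

Lemma shell_small (s t : R) : 1 <= s <= 2 -> 0 <= t <= 2^-1 ->
  (\int[mu]_z (\1_[set z : V | (s - t < enorm z <= s + t)%R] z)%:E <=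
   (n%:R * 3 ^+ n * 2 * t * @vball R n)%:E)%E.
Proof.
move=> /andP[s1 s2] /andP[t0 t1].
rewrite integral_indic ?setIT//; last exact: measurable_shell.
rewrite -[X in (X <= _)%E]/(mu _) mu_shell; [|lra|lra].
rewrite lee_fin ler_wpM2r ?vball_ge0//.
apply: le_trans (ler_norm _) _.
apply: (le_trans (@exprB_le _ 3 _ _ n _ _ _)); rewrite ?ler1n//; try (apply/andP; split; lra).
by rewrite -!mulrA !ler_wpM2l ?exprn_ge0// ger0_norm; lra.
Qed.

(** By homogeneity it is enough to treat r = 1. Integrate [ann1_diff] when
    |h| <= 1/2; otherwise the L^1 norm of the piece suffices. *)
Lemma ann_modulus : exists2 C : R, 0 < C & forall r h, 0 < r ->
  (\int[mu]_z `|ann r (z - h)%R - ann r z|%:E <= (C * Num.min 1 (enorm h / r))%:E)%E.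
Proof.
pose L : R := 1 + 2 * (n.+1%:R * 2 ^+ n.+1).
pose v := @vball R n; have v0 : 0 <= v := vball_ge0.
pose C1 := L * 3 ^+ n * v + 2 * (n%:R * 3 ^+ n * 2 * v).
have C10 : 0 <= C1.
  by rewrite /C1 /L !(addr_ge0, mulr_ge0, exprn_ge0).
pose C2 := 4 * (2 ^+ n * v + 1).
have C20 : 0 < C2 by rewrite mulr_gt0// annC_gt0.
have mabs r h : measurable_fun setT (fun z => `|ann r (z - h) - ann r z|).
  apply: measurableT_comp => //; apply: measurable_funB.
    exact: measurable_shift (measurable_ann r).
  exact: measurable_ann.
have M2 h : (\int[mu]_z `|ann 1 (z - h)%R - ann 1 z|%:E <= (2 * (2 ^+ n * v + 1))%:E)%E.
  have ma := measurableT_comp (@normr_measurable R setT) (measurable_ann 1).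
  apply: (@le_trans _ _ (\int[mu]_z (`|ann 1 (z - h)| + `|ann 1 z|)%:E)%E).
    by apply: ge0_le_integralT => z; rewrite lee_fin// ler_normB.
  rewrite ge0_intD//; last exact: measurable_shift ma.
  rewrite (ge0_integral_shift h (f := fun z => `|ann 1 z|))//.
  by rewrite mulrDl mul1r EFinD leeD//; exact: ann_L1.
have H1 h : (\int[mu]_z `|ann 1 (z - h)%R - ann 1 z|%:E <=
    ((C1 + C2) * Num.min 1 (enorm h))%:E)%E.
  have [h12|h12] := lerP (enorm h) 2^-1; last first.
    apply: le_trans (M2 h) _; rewrite lee_fin.
    have m12 : 2^-1 <= Num.min 1 (enorm h) by rewrite le_min (ltW h12) andbT; lra.
    apply: (@le_trans _ _ (C2 * 2^-1)); first by rewrite /C2; lra.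
    apply: (@le_trans _ _ (C2 * Num.min 1 (enorm h))).
      by rewrite ler_wpM2l// ltW.
    rewrite ler_wpM2r ?lerDr// (le_trans _ m12)//; lra.
  have -> : Num.min 1 (enorm h) = enorm h by apply/min_idPr; lra.
  apply: (@le_trans _ _ (C1 * enorm h)%:E); last first.
    by rewrite lee_fin ler_wpM2r ?enorm_ge0// lerDl ltW.
  have h0 := enorm_ge0 h.
  have L0 : 0 <= L by rewrite /L addr_ge0// !mulr_ge0.
  have m1 (A : set V) : measurable A -> measurable_fun setT (\1_A : V -> R).
    exact: measurable_indic.
  have mA := m1 _ (measurable_shell (1 - enorm h) (1 + enorm h)).
  have mB := m1 _ (measurable_shell (2 - enorm h) (2 + enorm h)).
  have m3 : measurable_fun setT (fun z => L * enorm h * \1_(eball 3) z).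
    by apply: measurable_funM => //; apply: m1; exact: measurable_enorm_le.
  have p3 z : 0 <= L * enorm h * \1_(eball 3) z by rewrite !mulr_ge0.
  apply: (@le_trans _ _ (\int[mu]_z (L * enorm h * \1_(eball 3) z +
    \1_[set z | (1 - enorm h < enorm z <= 1 + enorm h)%R] z +
    \1_[set z | (2 - enorm h < enorm z <= 2 + enorm h)%R] z)%:E)%E).
    by apply: ge0_le_integralT => z; rewrite lee_fin// ann1_diff.
  rewrite ge0_intD//; last 2 first.
  - exact: measurable_funD.
  - by move=> z; rewrite addr_ge0.
  rewrite ge0_intD// integral_indic_eball ?mulr_ge0//.
  rewrite (_ : C1 * enorm h = L * enorm h * (3 ^+ n * v) +
     n%:R * 3 ^+ n * 2 * enorm h * v + n%:R * 3 ^+ n * 2 * enorm h * v); last first.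
    by rewrite /C1; ring.
  rewrite !EFinD; apply: leeD; first apply: leeD => //.
  + by apply: shell_small; [lra|rewrite h0].
  + by apply: shell_small; [lra|rewrite h0].
exists (C1 + C2) => [|r h r0]; first by rewrite ltr_wpDl.
have ri : 0 < r^-1 by rewrite invr_gt0.
have rn : 0 <= r ^- n by rewrite invr_ge0 exprn_ge0// ltW.
under eq_integral => z _.
  rewrite !(ann_scale _ r0) -mulrBr normrM ger0_norm// scalerBr.
  over.
rewrite (@ge0_intZ _ _ _ mu (r ^- n)
  (fun z => `|ann 1 (r^-1 *: z - r^-1 *: h) - ann 1 (r^-1 *: z)|))//; last first.
  exact: (measurable_scale r^-1 (mabs 1 (r^-1 *: h))).
rewrite (ge0_integral_scale (f := fun z => `|ann 1 (z - r^-1 *: h) - ann 1 z|))//.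
rewrite muleA -EFinM exprVn invrK mulVf ?expf_neq0 ?gt_eqF// mul1e.
by apply: le_trans (H1 _) _; rewrite enormZ gtr0_norm// [r^-1 * _]mulrC.
Qed.

(** Convolution with the Riesz kernel truncated to e < |y| <= 2 ^ J e. *)
Definition rsum e J (f : V -> R) x : R := \sum_(j < J) convol (ann (e * 2 ^+ j)) f x.

Lemma ip_sqrE (f : V -> R) : bddL1 f ->
  (\int[mu]_x (f x ^+ 2)%:E = (ip f f)%:E)%E.
Proof.
move=> Df; rewrite /ip -Rintegral_EFin; first by apply: eq_integral => x _; rewrite expr2.
exact: bddL1M.
Qed.

Lemma ip_ge0 (f : V -> R) : 0 <= ip f f.
Proof. by apply: Rintegral_ge0 => x _; rewrite -expr2 sqr_ge0. Qed.

Lemma ip_comm (f g : V -> R) : ip f g = ip g f.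
Proof. by apply: eq_Rintegral => x _; rewrite mulrC. Qed.

Lemma ip_addl (f g h : V -> R) : bddL1 f -> bddL1 g -> bddL1 h ->
  ip (fun x => f x + g x) h = ip f h + ip g h.
Proof.
move=> Df Dg Dh; rewrite /ip -RintegralD//; try exact: bddL1M.
by apply: eq_Rintegral => x _; rewrite mulrDl.
Qed.

Lemma ip_scalel c (f h : V -> R) : bddL1 f -> bddL1 h ->
  ip (fun x => c * f x) h = c * ip f h.
Proof.
move=> Df Dh; rewrite /ip -RintegralZl//; last exact: bddL1M.
by apply: eq_Rintegral => x _; rewrite mulrA.
Qed.

(** Cotlar-Stein. For i <= j the mean zero of the i-th piece and the modulus of
    continuity of the j-th one give |T_i T_j g| = O (2 ^ (i - j)) |g|; the other case
    follows from |T_i T_j g| ^ 2 = <g, T_j T_i T_i T_j g>. *)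
Lemma rsum_L2 : exists2 C : R, 0 < C & forall (e : R) J f, 0 < e -> bddL1 f ->
  (\int[mu]_x (rsum e J f x ^+ 2)%:E <= (C ^+ 2 * ip f f)%:E)%E.
Proof.
have [Cw Cw0 Hw] := ann_modulus.
pose a := 2 ^+ n * @vball R n + 1; have a0 : 0 < a := annC_gt0.
pose B := 2 * (a * Cw); have B0 : 0 < B by rewrite !mulr_gt0.
(* The square roots of the almost orthogonality bounds are sqrt B s ^ |i - j|. *)
pose s : R := Num.sqrt 2^-1.
have s0 : 0 <= s by exact: sqrtr_ge0.
have s1 : s < 1 by rewrite -sqrtr1 ltr_sqrt// invf_lt1// ltr1n.
pose C := Num.sqrt B * (2 * (1 - s)^-1).
have C0 : 0 < C by rewrite !mulr_gt0 ?sqrtr_gt0// invr_gt0 subr_gt0.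
exists C => // e J f e0 Df.
have rj0 (j : nat) : 0 < e * 2 ^+ j by rewrite mulr_gt0// exprn_gt0.
pose W : lmodType R := (V -> R^o)%type.
pose T (j : 'I_J) : W -> W := convol (ann (e * 2 ^+ j)).
pose D : set W := @bddL1 R n.
pose ip' : W -> W -> R := @ip R n.
have DD : forall f g : W, D f -> D g -> D (f + g) by exact: bddL1D.
have DZ : forall c (f : W), D f -> D (c *: f) by move=> c g; exact: bddL1Z.
have ipC : forall f g : W, D f -> D g -> ip' f g = ip' g f.
  by move=> ? ? _ _; exact: ip_comm.
have ipDl : forall f g h : W, D f -> D g -> D h -> ip' (f + g) h = ip' f h + ip' g h.
  by move=> *; exact: ip_addl.
have ipZl : forall c (f h : W), D f -> D h -> ip' (c *: f) h = c * ip' f h.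
  by move=> *; exact: ip_scalel.
have ip0 : forall f : W, D f -> 0 <= ip' f f by move=> *; exact: ip_ge0.
have D0 : D 0 by exact: bddL1_0.
have DT : forall i (f : W), D f -> D (T i f).
  by move=> i g Dg; apply: bddL1_convol => //; exact: bddL1_ann.
have TD : forall i (f g : W), D f -> D g -> T i (f + g) = T i f + T i g.
  move=> i g h Dg Dh; apply/funext => x.
  by apply: conv_addr => //; exact: bddL1_ann.
have T0 : forall i, T i 0 = 0.
  move=> i; apply/funext => x; rewrite /T /convol.
  under eq_Rintegral do rewrite mulr0.
  by rewrite Rintegral_cst// mul0r.
have T_anti : forall i (f g : W), D f -> D g -> ip' (T i f) g = - ip' f (T i g).
  move=> i g h Dg Dh; apply: conv_anti => //; first exact: bddL1_ann.
  exact: annN.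
pose nm := @ipnorm R W ip'.
have nmle (g : W) (c : R) q : D g -> 0 <= c -> 0 <= q ->
    (\int[mu]_x (g x ^+ 2)%:E <= (c ^+ 2 * q)%:E)%E -> nm g <= c * Num.sqrt q.
  move=> Dg c0 q0; rewrite ip_sqrE// lee_fin => H.
  by rewrite -[X in X * _]ger0_norm// -sqrtr_sqr -sqrtrM ?sqr_ge0// ler_sqrt// mulr_ge0 ?sqr_ge0.
have Ta : forall i (f : W), D f -> nm (T i f) <= a * nm f.
  move=> i g Dg; apply: nmle; [exact: DT|exact: ltW|exact: ip0|].
  have [mg _ _] := Dg; apply: conv_L2 => //; first exact: ip0.
  - exact: measurable_ann.
  - exact: ann_L1.
  - by rewrite ip_sqrE.
pose d (i j : 'I_J) : R := B * 2^-1 ^+ ((i - j) + (j - i))%N.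
have d0 : forall i j, 0 <= d i j by move=> i j; rewrite mulr_ge0 ?exprn_ge0// ltW.
have Td' : forall (i j : 'I_J) (f : W), (i <= j)%N -> D f -> nm (T i (T j f)) <= d i j * nm f.
  move=> i j g ij Dg; apply: nmle; [exact: DT _ _ (DT _ _ Dg)|exact: d0|exact: ip0|].
  have -> : d i j = a * (2 * Cw * 2^-1 ^+ (j - i)%N).
    rewrite /d /B; have -> : (i - j + (j - i) = j - i)%N by lia.
    ring.
  apply: (conv_conv_L2 (r := 2 * (e * 2 ^+ i))) => //.
  - exact: ip0.
  - by rewrite !mulr_gt0// exprn_gt0.
  - exact: bddL1_ann.
  - exact: bddL1_ann.
  - exact: ann_mean0.
  - by move=> x xr; rewrite /ann leNgt xr andbF.
  - exact: ann_L1.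
  - move=> y yr; apply: le_trans (Hw _ _ (rj0 j)) _; rewrite lee_fin.
    rewrite [X in _ <= X * _]mulrC -mulrA ler_wpM2l ?(ltW Cw0)//.
    rewrite ge_min; apply/orP; right; rewrite ler_pdivrMr//.
    apply: le_trans yr _; rewrite -mulrA ler_wpM2l// mulrCA ler_wpM2l ?(ltW e0)//.
    rewrite -{2}(subnK ij) exprD mulrA -exprMn mulVf// expr1n mul1r//.
  - by rewrite ip_sqrE.
have Td : forall (i j : 'I_J) (f : W), D f -> nm (T i (T j f)) <= d i j * nm f.
  move=> i j g Dg; have [ij|/ltnW ji] := leqP i j; first exact: Td'.
  set h := T i (T j g); have Dh : D h := DT _ _ (DT _ _ Dg).
  have E : nm h ^+ 2 = ip' g (T j (T i h)).
    rewrite (ipnorm_sqr ip0 Dh) {1}/h (T_anti _ _ _ (DT _ _ Dg) Dh).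
    by rewrite (T_anti _ _ _ Dg (DT _ _ Dh)) opprK.
  have := le_trans (ler_norm _) (ip_CS DD DZ ipC ipDl ipZl ip0 Dg (DT j _ (DT i _ Dh))).
  rewrite -E => H1.
  have H2 : nm h ^+ 2 <= nm g * (d j i * nm h).
    by apply: le_trans H1 _; rewrite ler_wpM2l ?sqrtr_ge0// Td'.
  have dji : d j i = d i j by rewrite /d addnC.
  have [->|hn] := eqVneq (nm h) 0; first by rewrite mulr_ge0 ?sqrtr_ge0.
  have hp : 0 < nm h by rewrite lt_neqAle eq_sym hn sqrtr_ge0.
  by rewrite -(ler_pM2r hp) -expr2 -dji mulrAC mulrC.
have dC : forall j, \sum_(i < J) Num.sqrt (d i j) <= C.
  move=> j; rewrite (eq_bigr (fun i : 'I_J => Num.sqrt B * s ^+ ((i - j) + (j - i))%N)).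
    rewrite -mulr_sumr ler_wpM2l ?sqrtr_ge0//; apply: sum_geom_dist.
    by rewrite s0.
  move=> i _; rewrite /d sqrtrM ?(ltW B0)//; congr (_ * _).
  have -> : (2^-1 : R) = s ^+ 2 by rewrite sqr_sqrtr.
  by rewrite exprAC sqrtr_sqr ger0_norm// exprn_ge0.
have := @Cotlar_Stein R W D ip' D0 DD DZ ipC ipDl ipZl ip0 J T DT TD T0 T_anti
  a C d (ltW a0) C0 d0 Ta Td dC f Df.
set S := \sum_(i < J) T i f => SC.
have SE : S = rsum e J f by apply/funext => x; rewrite /S fct_sumE.
have DS : D S by apply: D_sum => //; move=> i; exact: DT.
rewrite -SE ip_sqrE// lee_fin -[ip S S]/(ip' S S) -[ip f f]/(ip' f f).
rewrite -(ipnorm_sqr ip0 DS) -(ipnorm_sqr ip0 Df).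
rewrite -exprMn; apply: lerXn2r SC; rewrite nnegrE; first exact: ipnorm_ge0.
by apply: mulr_ge0; [exact: ltW|exact: ipnorm_ge0].
Qed.

End riesz_pieces.

(** * Sums of dyadic pieces on molecules *)

Section molecules.
Context {R : realType} {n : nat}.
Local Notation V := 'rV[R]_n.
Local Notation mu := (@lebesgue_rV R n).
Implicit Types (x y h z : V) (r t : R) (g : V -> R).

Lemma powR_exprn (a t : R) m : 0 <= a -> (a ^+ m) `^ t = (a `^ t) ^+ m.
Proof.
by move=> a0; rewrite -powR_mulrn// -powRrM mulrC powRrM powR_mulrn// powR_ge0.
Qed.

Lemma minr_le_powR (t beta : R) : 0 <= t -> 0 < beta <= 1 -> Num.min 1 t <= t `^ beta.
Proof.
move=> t0 /andP[b0 b1]; have [t1|t1] := lerP t 1.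
  have [->|tn] := eqVneq t 0; first by rewrite powR_ge0.
  by rewrite ger1_powR// lt_neqAle eq_sym tn t0.
apply: (@le_trans _ _ (1 `^ beta)); first by rewrite powR1.
by apply: ge0_ler_powR; rewrite ?nnegrE ?(ltW b0) ?(ltW t1).
Qed.

(** A part of the decay pays for a power of the distance. *)
Lemma wgtM_powR (s s' : R) x : s' < s -> wgt s x * enorm x `^ (s - s') <= wgt s' x.
Proof.
move=> ss; have x0 := enorm_ge0 x.
have x1 : 0 < 1 + enorm x by rewrite ltr_pwDl.
rewrite /wgt -!powRN.
apply: (@le_trans _ _ ((1 + enorm x) `^ (- s) * (1 + enorm x) `^ (s - s'))).
  rewrite ler_wpM2l ?powR_ge0//; apply: ge0_ler_powR; rewrite ?nnegrE ?(ltW x1)//.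
    by rewrite subr_ge0 ltW.
  by rewrite lerDr.
rewrite -powRD; last by rewrite (gt_eqF x1) implybT.
by rewrite addrA addNr add0r.
Qed.

Lemma bddL1_wgt (s : R) g : n%:R < s -> measurable_fun setT g ->
  (forall x, `|g x| <= wgt s x) -> bddL1 g.
Proof.
move=> ns mg gw; have [I _ Iw] := wgt_integrable ns.
have s0 : 0 <= s by apply: le_trans (ltW ns).
split=> //; first by exists 1 => x; apply: le_trans (gw x) (wgt_le1 _ s0).
apply: (integrable_le (M := I)) => //; apply: le_trans Iw.
by apply: ge0_le_integralT => x; rewrite lee_fin.
Qed.

(** As g has mean zero, (k * g) (x) is the integral of g y (k (x - y) - k x). *)
Lemma convol_mean0_L1 (k g W : V -> R) : bddL1 k -> bddL1 g -> \int[mu]_y g y = 0 ->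
  (forall y, 0 <= W y) -> measurable_fun setT W ->
  (forall y, (\int[mu]_x `|k (x - y)%R - k x|%:E <= (W y)%:E)%E) ->
  (\int[mu]_x `|convol k g x|%:E <= \int[mu]_y (`|g y| * W y)%:E)%E.
Proof.
move=> Dk Dg g0 W0 mW kW; have [mk [M kM] ki] := Dk; have [mg [Mg gM] gi] := Dg.
have mF : measurable_fun setT (fun z : V * V => `|g z.2| * `|k (z.1 - z.2) - k z.1|).
  apply: measurable_funM.
    apply: measurableT_comp => //; exact: measurable_comp_snd.
  apply: measurableT_comp => //; apply: measurable_funB.
    exact: measurable_sub_comp.
  exact: measurable_comp_fst.
have E x : convol k g x = \int[mu]_y (g y * (k (x - y) - k x)).
  rewrite /convol -(Rintegral_reflect x (f := fun y => k y * g (x - y))); last first.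
    by apply: measurable_funM => //; exact: measurable_reflect.
  have gk : mu.-integrable setT (EFin \o (fun y : V => g y * k (x - y))).
    by apply: (integrable_bdd_mul (M := M)) => //; exact: measurable_reflect.
  transitivity (\int[mu]_y (g y * k (x - y)) - k x * \int[mu]_y g y).
    by rewrite g0 mulr0 subr0; apply: eq_Rintegral => y _; rewrite subKr mulrC.
  rewrite -RintegralZl// -RintegralB//; last exact: integrableZR.
  by apply: eq_Rintegral => y _; ring.
apply: (@le_trans _ _ (\int[mu]_x \int[mu]_y (`|g y| * `|k (x - y)%R - k x|)%:E)%E).
  apply: ge0_le_integralT => x; rewrite ?lee_fin// E.
  apply: le_trans (normr_Rintegral_le _ _) _.
  by under eq_integral do rewrite normrM.
rewrite (fubini_tonelli (fun z : V * V => (`|g z.2| * `|k (z.1 - z.2)%R - k z.1|)%:E)) /=.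
- apply: ge0_le_integralT => y.
    by apply: integral_ge0 => x _; rewrite lee_fin mulr_ge0.
  rewrite ge0_intZ//; last first.
    apply: measurableT_comp => //; apply: measurable_funB => //.
    exact: measurable_shift.
  by rewrite EFinM lee_pmul// integral_ge0.
- exact/measurable_EFinP.
- by move=> z; rewrite lee_fin mulr_ge0.
Qed.

Lemma convol_local (k : V -> R) (g1 g2 : V -> R) x (r : R) :
  (forall y, r < enorm y -> k y = 0) ->
  (forall z, enorm (x - z) <= r -> g1 z = g2 z) ->
  convol k g1 x = convol k g2 x.
Proof.
move=> kr g12; apply: eq_Rintegral => y _.
have [yr|yr] := ltP r (enorm y); first by rewrite kr// !mul0r.
by rewrite g12// subKr.
Qed.

Variable l : 'I_n.

Lemma measurable_rsum e J g : measurable_fun setT g ->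
  measurable_fun setT (rsum l e J g).
Proof.
move=> mg; apply: measurable_sum => j; apply: measurable_convol => //.
exact: measurable_ann.
Qed.

Lemma rsum_split e J0 J1 g x :
  rsum l e (J0 + J1) g x = rsum l e J0 g x + rsum l (e * 2 ^+ J0) J1 g x.
Proof.
rewrite /rsum big_split_ord/=; congr (_ + _).
by apply: eq_bigr => j _; rewrite exprD mulrA.
Qed.

(** From scale 1 on, g looks like a point mass with total mass zero. The decay s of g
    is shared between an integrable weight s' and a power |y| ^ beta, beta = s - s',
    and the latter turns the modulus of the j-th piece into a gain 2 ^ (- beta j). *)
Lemma rsum_nonlocal (s : R) : n%:R < s -> exists2 C : R, 0 < C & forall e J g, 1 <= e ->
  measurable_fun setT g -> (forall x, `|g x| <= wgt s x) -> \int[mu]_y g y = 0 ->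
  (\int[mu]_x `|rsum l e J g x|%:E <= C%:E)%E.
Proof.
move=> ns.
(* s' exceeds n, while s - s' is at most 1, so that min 1 t <= t ^ (s - s'). *)
pose s' := Num.max ((n%:R + s) / 2) (s - 1).
have s's : s' < s by rewrite gt_max; apply/andP; split; lra.
have ns' : n%:R < s' by rewrite lt_max; apply/orP; left; lra.
pose beta := s - s'.
have b0 : 0 < beta by rewrite subr_gt0.
have b1 : beta <= 1.
  rewrite /beta lerBlDl -lerBlDr; by rewrite le_max lexx orbT.
have [Cw Cw0 Hw] := @ann_modulus R n l.
have [I I0 Iw] := wgt_integrable ns'.
pose z : R := 2 `^ (- beta).
have z0 : 0 < z by rewrite powR_gt0.
have z1 : z < 1.
  by rewrite /z /powR pnatr_eq0/= expR_lt1 pmulr_llt0 ?ln_gt0 ?ltr1n//; lra.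
exists (Cw * I * (1 - z)^-1) => [|e J g e1 mg gw g0].
  by rewrite !mulr_gt0// invr_gt0 subr_gt0.
have Dg := bddL1_wgt ns mg gw.
have e0 : 0 < e by apply: lt_le_trans e1.
have H j : (\int[mu]_x `|convol (ann l (e * 2 ^+ j)) g x|%:E <= (Cw * I * z ^+ j)%:E)%E.
  have r0 : 0 < e * 2 ^+ j by rewrite mulr_gt0// exprn_gt0.
  pose W y := Cw * Num.min 1 (enorm y / (e * 2 ^+ j)).
  have W0 y : 0 <= W y.
    rewrite mulr_ge0 ?(ltW Cw0)// le_min ler01/= divr_ge0 ?enorm_ge0 ?(ltW r0)//.
  have mW : measurable_fun setT W.
    apply: measurable_funM => //; apply: measurable_minr => //.
    by apply: measurable_funM => //; exact: measurable_enorm.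
  apply: le_trans (convol_mean0_L1 (bddL1_ann l r0) Dg g0 W0 mW (fun y => Hw _ y r0)) _.
  have K0 : 0 <= Cw * z ^+ j by rewrite mulr_ge0 ?exprn_ge0 ?ltW.
  apply: (@le_trans _ _ (\int[mu]_y ((Cw * z ^+ j) * wgt s' y)%:E)%E).
    apply: ge0_le_integralT => y; first by rewrite lee_fin mulr_ge0.
    rewrite lee_fin /W mulrCA -mulrA ler_wpM2l ?(ltW Cw0)//.
    have h1 : Num.min 1 (enorm y / (e * 2 ^+ j)) <= enorm y `^ beta * z ^+ j.
      apply: le_trans (minr_le_powR (beta := beta) _ _) _.
      - by rewrite divr_ge0 ?enorm_ge0 ?(ltW r0).
      - by rewrite b0.
      rewrite powRM ?enorm_ge0 ?invr_ge0 ?(ltW r0)// ler_wpM2l ?powR_ge0//.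
      rewrite -powR_inv1 ?(ltW r0)// -powRrM mulN1r.
      rewrite powRM ?(ltW e0) ?exprn_ge0//.
      rewrite powR_exprn//.
      rewrite -[leRHS]mul1r ler_wpM2r ?exprn_ge0 ?(ltW z0)//.
      rewrite powRN invf_le1 ?powR_gt0//.
      by rewrite -[leLHS](powRr0 e); apply: ler_powR => //; exact: ltW.
    apply: (@le_trans _ _ (wgt s y * (enorm y `^ beta * z ^+ j))).
      by rewrite ler_pM// le_min ler01 divr_ge0 ?enorm_ge0 ?(ltW r0).
    by rewrite mulrA mulrC ler_wpM2l ?exprn_ge0 ?(ltW z0)// wgtM_powR.
  rewrite ge0_intZ//; last 2 first.
  - exact: measurable_wgt.
  - by move=> y; rewrite ltW ?wgt_gt0.
  rewrite [leRHS](_ : _ = (Cw * z ^+ j)%:E * I%:E)%E; last by rewrite -EFinM mulrAC.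
  by rewrite lee_wpmul2l ?lee_fin.
apply: (@le_trans _ _ (\int[mu]_x (\sum_(j < J) `|convol (ann l (e * 2 ^+ j)) g x|)%:E)%E).
  by apply: ge0_le_integralT => x; rewrite lee_fin// ler_norm_sum.
under eq_integral do rewrite -sumEFin.
rewrite ge0_integral_sum//; last first.
  move=> j; apply/measurable_EFinP; apply: measurableT_comp => //.
  by apply: measurable_convol => //; exact: measurable_ann.
apply: (@le_trans _ _ (\sum_(j < J) (Cw * I * z ^+ j)%:E)%E).
  by apply: lee_sum => j _; exact: H.
rewrite sumEFin lee_fin -mulr_sumr ler_wpM2l ?mulr_ge0 ?(ltW Cw0) ?(ltW I0)//.
by apply: geom_sum_le; rewrite (ltW z0).
Qed.

(** Up to scale 1 the operator only sees g within distance 2. On the shell of points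
    of size about 2 ^ m replace g by its restriction gm to a neighbourhood E m of this
    shell: by Cauchy-Schwarz and the L^2 bound the contribution of the shell is
    O (2 ^ (m n) 2 ^ (- m s)), which is summable. *)
Lemma rsum_local (s : R) : n%:R < s -> exists2 C : R, 0 < C & forall e J g, 0 < e ->
  (forall j, (j < J)%N -> e * 2 ^+ j <= 1) ->
  measurable_fun setT g -> (forall x, `|g x| <= wgt s x) ->
  (\int[mu]_x `|rsum l e J g x|%:E <= C%:E)%E.
Proof.
move=> ns; have s0 : 0 <= s by apply: le_trans (ltW ns).
have [C C0 HC] := @rsum_L2 R n l.
pose v : R := @vball R n + 1.
have v0 : 0 < v by rewrite ltr_wpDl// vball_ge0.
pose q : R := 2 `^ (- s); have q0 : 0 < q by rewrite powR_gt0.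
pose z := q * 2 ^+ n; have z0 : 0 < z by rewrite mulr_gt0// exprn_gt0.
have z1 : z < 1.
  rewrite /z -powR_mulrn// -powRD; last by rewrite pnatr_eq0 implybT.
  by rewrite /powR pnatr_eq0/= expR_lt1 pmulr_llt0 ?ln_gt0 ?ltr1n//; lra.
pose K := C * v * 3 ^+ n * 4 `^ s.
have K0 : 0 < K by rewrite /K !mulr_gt0 ?exprn_gt0 ?powR_gt0.
exists (K * (1 - z)^-1) => [|e J g e0 eJ mg gw].
  by rewrite mulr_gt0// invr_gt0 subr_gt0.
(* If m is minimal with |x| <= 2 ^ m, then every y with |x - y| <= 2 is in E m. *)
pose E (m : nat) : set V := eball (3 * 2 ^+ m) `&` [set x | 2 ^+ m <= 4 * (1 + enorm x)].
have mE m : measurable (E m).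
  apply: measurableI; first exact: measurable_enorm_le.
  have me : measurable_fun setT (fun x : V => 4 * (1 + enorm x)).
    by apply: measurable_funM => //; apply: measurable_funD => //; exact: measurable_enorm.
  rewrite (_ : [set x | _] = (fun x : V => 4 * (1 + enorm x)) @^-1` `[2 ^+ m, +oo[%classic).
    rewrite -[X in measurable X]setTI; exact: (me measurableT _ (measurable_itv _)).
  by apply/seteqP; split => x /=; rewrite in_itv/= andbT.
pose gm m x := g x * \1_(E m) x.
have mgm m : measurable_fun setT (gm m).
  by apply: measurable_funM => //; exact: measurable_indic.
have gmw m x : `|gm m x| <= wgt s x.
  rewrite /gm normrM indicE; case: (_ \in _); rewrite ?normr1 ?normr0 ?mulr1 ?mulr0//.
  by rewrite ltW ?wgt_gt0.
have Dgm m : bddL1 (gm m) by exact: bddL1_wgt ns (mgm m) (gmw m).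
have gmq m x : `|gm m x| <= (4 `^ s * q ^+ m) * \1_(eball (3 * 2 ^+ m)) x.
  rewrite /gm normrM !indicE.
  have [[xE1 xE2]|xE] := pselect (E m x); last first.
    by rewrite memNset// normr0 mulr0 !mulr_ge0 ?powR_ge0 ?exprn_ge0 ?(ltW q0).
  rewrite !mem_set// normr1 !mulr1 (le_trans (gw x))//.
  have x1 : 0 < 1 + enorm x by rewrite ltr_pwDl// enorm_ge0.
  have -> : 4 `^ s * q ^+ m = (4 / 2 ^+ m) `^ s.
    rewrite powRM ?invr_ge0 ?exprn_ge0//; congr (_ * _).
    rewrite -(powR_inv1 (exprn_ge0 m _))// -powRrM mulN1r.
    by rewrite powR_exprn.
  rewrite /wgt -[leLHS]mul1r ler_pdivrMr ?powR_gt0// -powRM ?divr_ge0 ?exprn_ge0 ?(ltW x1)//.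
  apply: (@le_trans _ _ (1 `^ s)); first by rewrite powR1.
  apply: ge0_ler_powR; rewrite ?nnegrE ?mulr_ge0 ?divr_ge0 ?exprn_ge0 ?(ltW x1)//.
  by rewrite mulrAC ler_pdivlMr ?exprn_gt0// mul1r.
pose u m x := \1_(eball (2 ^+ m)) x * `|rsum l e J (gm m) x|.
have u0 m x : 0 <= u m x by rewrite mulr_ge0.
have mu_ m : measurable_fun setT (u m).
  apply: measurable_funM; first by apply: measurable_indic; exact: measurable_enorm_le.
  by apply: measurableT_comp => //; exact: measurable_rsum.
have uz m : (\int[mu]_x (u m x)%:E <= (K * z ^+ m)%:E)%E.
  pose a := 2 ^+ m ^+ n * v; have a0 : 0 < a by rewrite mulr_gt0// !exprn_gt0.
  pose Q := (C * (4 `^ s * q ^+ m) * 3 ^+ n) ^+ 2 * a.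
  have -> : K * z ^+ m = Num.sqrt (a * Q).
    rewrite /Q mulrCA -expr2 -exprMn sqrtr_sqr ger0_norm; last first.
      by rewrite !mulr_ge0 ?exprn_ge0 ?powR_ge0 ?ltW.
    rewrite /K /z /a exprMn -!exprM (mulnC m n); ring.
  have -> : (\int[mu]_x (u m x)%:E =
     \int[mu]_x `|\1_(eball (2 ^+ m)) x * rsum l e J (gm m) x|%:E)%E.
    apply: eq_integral => x _; rewrite normrM /u; congr (_ * _)%:E.
    by rewrite ger0_norm.
  apply: Cauchy_Schwarz_weight => //.
  - by apply: measurable_indic; exact: measurable_enorm_le.
  - exact: measurable_rsum.
  - under eq_integral do rewrite ger0_norm//.
    under eq_integral do rewrite -[X in X%:E]mul1r.
    rewrite integral_indic_eball ?exprn_gt0// mul1r lee_fin /a.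
    by rewrite ler_wpM2l ?exprn_ge0// /v lerDl.
  apply: (@le_trans _ _ (\int[mu]_x (rsum l e J (gm m) x ^+ 2)%:E)%E).
    apply: ge0_le_integralT => x; first by rewrite lee_fin mulr_ge0// sqr_ge0.
    by rewrite lee_fin ler_piMl ?sqr_ge0// indicE; case: (_ \in _); rewrite ?normr1 ?normr0.
  apply: le_trans (HC e J _ e0 (Dgm m)) _.
  rewrite EFinM -ip_sqrE//.
  apply: (@le_trans _ _ ((C ^+ 2)%:E * \int[mu]_x ((4 `^ s * q ^+ m) ^+ 2 *
      \1_(eball (3 * 2 ^+ m)) x)%:E)%E).
    rewrite lee_wpmul2l ?lee_fin ?sqr_ge0//; apply: ge0_le_integralT => x.
      by rewrite lee_fin sqr_ge0.
    rewrite lee_fin -[leLHS]real_normK ?num_real//.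
    apply: (@le_trans _ _ (((4 `^ s * q ^+ m) * \1_(eball (3 * 2 ^+ m)) x) ^+ 2)).
      rewrite ler_sqr ?nnegrE// mulr_ge0// mulr_ge0 ?powR_ge0 ?exprn_ge0 ?ltW//.
    rewrite exprMn ler_wpM2l ?sqr_ge0// indicE; case: (_ \in _) => /=.
      by rewrite expr1n.
    by rewrite expr0n.
  rewrite integral_indic_eball ?sqr_ge0 ?mulr_gt0 ?exprn_gt0//.
  rewrite -EFinM lee_fin /Q /a [(3 * _) ^+ n]exprMn.
  have vv : @vball R n <= v by rewrite lerDl.
  have v1 := @vball_ge0 R n.
  have P0 : 0 <= (C * (4 `^ s * q ^+ m)) ^+ 2 * 2 ^+ m ^+ n.
    by rewrite mulr_ge0 ?sqr_ge0 ?exprn_ge0.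
  have h3 : 1 <= (3 : R) ^+ n by rewrite exprn_ege1// ler1n.
  set P := _ * 2 ^+ m ^+ n in P0.
  rewrite (_ : C ^+ 2 * _ = P * (3 ^+ n * @vball R n)); last by rewrite /P; ring.
  rewrite (_ : _ ^+ 2 * (2 ^+ m ^+ n * v) = P * (3 ^+ n * (3 ^+ n * v))); last first.
    by rewrite /P; ring.
  rewrite ler_wpM2l// ler_wpM2l ?exprn_ge0// (le_trans vv)// ler_peMl// ltW//.
apply: (@le_trans _ _ (\int[mu]_x (\sum_(m <oo) (u m x)%:E))%E).
  apply: ge0_le_integralT => x; first by rewrite lee_fin.
  have ex : exists m, enorm x <= 2 ^+ m.
    exists (Num.truncn (enorm x)).+1; apply: le_trans (ltW (truncnS_gt _)) _.
    by rewrite -natrX ler_nat ltnW// ltn_expl.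
  case: (ex_minnP ex) => m xm mmin.
  apply: le_trans (ler_term_nneseries (u := fun m => u m x) m _) => //.
  rewrite lee_fin /u indicE mem_set// mul1r.
  rewrite le_eqVlt; apply/orP; left; apply/eqP; congr `|_|.
  apply: eq_bigr => j _; apply: (convol_local (r := 2)).
    move=> y yr; rewrite /ann; case: ifP => // /andP[_ y2].
    by have := eJ j (ltn_ord j); lra.
  move=> y xy; rewrite /gm indicE mem_set ?mulr1//; split => /=.
    have := enorm_triB y x; rewrite (enormBC y x) /eball/= => h1.
    have : 1 <= (2 : R) ^+ m by rewrite exprn_ege1// ler1n.
    lra.
  have h1 := enorm_triD x y; have y0 := enorm_ge0 y.
  case: m xm mmin => [|m] xm mmin; first by rewrite expr0; lra.
  have {}mmin : 2 ^+ m < enorm x.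
    by rewrite ltNge; apply/negP => /mmin; rewrite ltnn.
  rewrite exprS; case: m mmin xm => [|m] mmin xm; first by rewrite expr0; lra.
  have : 1 <= (2 : R) ^+ m by rewrite exprn_ege1// ler1n.
  by move: mmin; rewrite exprS; lra.
rewrite integral_nneseries//; last 2 first.
- by move=> m; exact/measurable_EFinP.
- by move=> m x _; rewrite lee_fin.
apply: (@le_trans _ _ (\sum_(m <oo) (K * z ^+ m)%:E)%E).
  apply: lee_nneseries => [m _ _|m _]; first by apply: integral_ge0 => x _; rewrite lee_fin.
  exact: uz.
apply: nneseries_le => [m|k]; first by rewrite mulr_ge0 ?exprn_ge0 ?ltW.
rewrite -mulr_sumr ler_wpM2l ?(ltW K0)//.
by apply: geom_sum_le; rewrite (ltW z0).
Qed.

Lemma rsum_molecule (s : R) : n%:R < s -> exists2 C : R, 0 < C & forall e J g, 0 < e ->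
  measurable_fun setT g -> (forall x, `|g x| <= wgt s x) -> \int[mu]_y g y = 0 ->
  (\int[mu]_x `|rsum l e J g x|%:E <= C%:E)%E.
Proof.
move=> ns; have [C1 C10 H1] := rsum_nonlocal ns; have [C2 C20 H2] := rsum_local ns.
exists (C2 + C1) => [|e J g e0 mg gw g0]; first by rewrite addr_gt0.
have ex : exists m, 1 <= e * 2 ^+ m.
  exists (Num.truncn e^-1).+1; rewrite -ler_pdivrMl// mulr1.
  apply: le_trans (ltW (truncnS_gt _)) _.
  by rewrite -natrX ler_nat ltnW// ltn_expl.
case: (ex_minnP ex) => m em mmin.
have small j : (j < m)%N -> e * 2 ^+ j <= 1.
  by move=> jm; rewrite ltW// ltNge; apply/negP => /mmin; rewrite leqNgt jm.
have [Jm|/ltnW mJ] := leqP J m.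
  apply: le_trans (H2 e J g e0 _ mg gw) _; last by rewrite lee_fin lerDl ltW.
  by move=> j jJ; apply: small; exact: leq_trans Jm.
rewrite -(subnKC mJ).
have mr e' J' : measurable_fun setT (fun x => `|rsum l e' J' g x|).
  by apply: measurableT_comp => //; exact: measurable_rsum.
apply: (@le_trans _ _ (\int[mu]_x (`|rsum l e m g x| + `|rsum l (e * 2 ^+ m) (J - m) g x|)%:E)%E).
  by apply: ge0_le_integralT => x; rewrite lee_fin// rsum_split ler_normD.
by rewrite ge0_intD// EFinD leeD//; [exact: H2|exact: H1].
Qed.

End molecules.

(** * Truncated Riesz transforms on molecules *)

Section fatou_L1.
Context d (T : measurableType d) (R : realType).
Variable mu : {measure set T -> \bar R}.

(** The form of Fatou's lemma by which L^1 bounds pass to almost everywhere limits. *)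
Lemma fatou_L1 (f_ : nat -> T -> R) (f : T -> R) (C : \bar R) :
  (forall j, measurable_fun setT (f_ j)) ->
  {ae mu, forall x, (fun j => f_ j x) @ \oo --> f x} ->
  (forall j, (\int[mu]_x `|f_ j x|%:E <= C)%E) ->
  (\int[mu]_x `|f x|%:E <= C)%E.
Proof.
move=> mf cf fC.
apply: (@le_trans _ _ (\int[mu]_x limn_einf (fun j => `|f_ j x|%:E))%E).
  apply: ge0_ae_le_integral => [x|x|]; first by rewrite lee_fin.
    rewrite limn_einf_lim; apply: lime_ge; first exact: is_cvg_einfs.
    apply: nearW => k; apply: le_ereal_inf_tmp => _ [m /= _ <-].
    by rewrite lee_fin.
  apply: filterS cf => x cx.
  have : (fun j => `|f_ j x|%:E) @ \oo --> (`|f x|%:E)%E.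
    by apply: cvg_EFin; [exact: nearW|exact: cvg_norm].
  by move=> /cvg_limn_einf_sup[-> _].
apply: le_trans (fatou mu measurableT (f := fun j x => `|f_ j x|%:E) _ _) _.
- by move=> j; apply/measurable_EFinP; exact: measurableT_comp.
- by move=> j x _; rewrite lee_fin.
rewrite limn_einf_lim; apply: lime_le; first exact: is_cvg_einfs.
apply: nearW => k; apply: le_trans (fC k).
by apply: ereal_inf_lbound; exists k => /=.
Qed.

End fatou_L1.

Section truncated_riesz.
Context {R : realType} {n : nat}.
Local Notation V := 'rV[R]_n.
Local Notation mu := (@lebesgue_rV R n).
Variable l : 'I_n.
Implicit Types (x y : V) (f g : V -> R) (e r : R).

Definition tker e y : R := if e < enorm y then rker l y else 0.

(** The truncated Riesz transform of a real function without its constant; the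
    complex transform [riesz_trunc] is made of two of these ([riesz_truncE]). *)
Definition rtr f e x : R := convol (tker e) f x.

Lemma n_gt0 : (0 < n)%N.
Proof. by case: l => m; exact: leq_ltn_trans. Qed.

Lemma measurable_tker e : measurable_fun setT (tker e).
Proof.
apply: measurable_fun_ifT => //; last exact: measurable_rker.
by apply: measurable_fun_ltr => //; exact: measurable_enorm.
Qed.

Lemma tker_le e y : 0 < e -> `|tker e y| <= e ^- n.
Proof.
move=> e0; rewrite /tker; case: ifP => [ey|_]; last first.
  by rewrite normr0 invr_ge0 exprn_ge0// ltW.
have y0 := lt_trans e0 ey.
apply: le_trans (rker_le _ y0) _.
by rewrite lef_pV2 ?posrE ?exprn_gt0//; apply: lerXn2r; rewrite ?nnegrE ltW.
Qed.

Lemma integrable_reflect f x : mu.-integrable setT (EFin \o f) ->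
  mu.-integrable setT (EFin \o (fun y : V => f (x - y))).
Proof.
move=> fi; have mf := integrable_measurable fi.
apply: (integrable_le (M := \int[mu]_y `|f y|)); first exact: measurable_reflect.
rewrite (ge0_integral_reflect x (f := fun y => `|f y|))//; last exact: measurableT_comp.
by rewrite integrable_normE.
Qed.

Lemma integrable_bdd_convol (k f : V -> R) (M : R) x : measurable_fun setT k ->
  (forall y, `|k y| <= M) -> mu.-integrable setT (EFin \o f) ->
  mu.-integrable setT (EFin \o (fun y : V => k y * f (x - y))).
Proof.
move=> mk kM fi; apply: (eq_integrableR (f := (fun y : V => f (x - y) * k y))).
  by move=> y; rewrite mulrC.
by apply: (integrable_bdd_mul (M := M)) => //; exact: integrable_reflect.
Qed.

Lemma convol_le (k f : V -> R) (M : R) x : (forall y, `|k y| <= M) ->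
  mu.-integrable setT (EFin \o f) ->
  `|convol k f x| <= M * \int[mu]_y `|f y|.
Proof.
move=> kM fi; have mf := integrable_measurable fi.
have M0 : 0 <= M by apply: le_trans (kM 0).
have mnf : measurable_fun setT (fun y => `|f y|) by exact: measurableT_comp.
apply: normr_Rintegral_le_fin.
apply: (@le_trans _ _ (\int[mu]_y (M * `|f (x - y)|)%:E)%E).
  by apply: ge0_le_integralT => y; rewrite lee_fin// normrM ler_wpM2r.
rewrite ge0_intZ//; last exact: measurable_reflect mnf.
by rewrite (ge0_integral_reflect x mnf)// integrable_normE// -EFinM.
Qed.

Lemma measurable_rtr f e : measurable_fun setT f -> measurable_fun setT (rtr f e).
Proof. by move=> mf; apply: measurable_convol => //; exact: measurable_tker. Qed.

Lemma rtr_le f e x : 0 < e -> mu.-integrable setT (EFin \o f) ->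
  `|rtr f e x| <= e ^- n * \int[mu]_y `|f y|.
Proof. by move=> e0 fi; apply: convol_le => // y; exact: tker_le. Qed.

Lemma integrable_rtr f e x : 0 < e -> mu.-integrable setT (EFin \o f) ->
  mu.-integrable setT (EFin \o (fun y : V => tker e y * f (x - y))).
Proof.
move=> e0 fi; apply: (integrable_bdd_convol (M := e ^- n)) => //.
- exact: measurable_tker.
- by move=> y; exact: tker_le.
Qed.

Lemma rtrB f g e x : 0 < e -> mu.-integrable setT (EFin \o f) ->
  mu.-integrable setT (EFin \o g) ->
  rtr (fun x => f x - g x) e x = rtr f e x - rtr g e x.
Proof.
move=> e0 fi gi; rewrite /rtr /convol -RintegralB//; try exact: integrable_rtr.
by apply: eq_Rintegral => y _; rewrite mulrBr.
Qed.

Lemma rsum_rtr f e J x : 0 < e -> mu.-integrable setT (EFin \o f) ->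
  rsum l e J f x = rtr f e x - rtr f (e * 2 ^+ J) x.
Proof.
move=> e0 fi; have mf := integrable_measurable fi.
have r0 j : 0 < e * 2 ^+ j by rewrite mulr_gt0// exprn_gt0.
elim: J => [|J IH]; first by rewrite /rsum big_ord0 expr0 mulr1 subrr.
rewrite /rsum big_ord_recr/= -/(rsum l e J f x) IH.
suff -> : convol (ann l (e * 2 ^+ J)) f x =
    rtr f (e * 2 ^+ J) x - rtr f (e * 2 ^+ J.+1) x by rewrite addrA subrK.
rewrite /rtr /convol -RintegralB//; try exact: integrable_rtr.
apply: eq_Rintegral => y _; rewrite -mulrBl; congr (_ * _).
rewrite /ann /tker exprS mulrCA.
have le2 : e * 2 ^+ J <= 2 * (e * 2 ^+ J) by rewrite ler_peMl ?ler1n// ltW.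
case: ltP => [h1|h1]/=; case: ltP => [h2|h2]; rewrite ?subr0 ?subrr//.
by rewrite mulrCA in h2; have := le_lt_trans h1 (le_lt_trans le2 h2); rewrite ltxx.
Qed.

(** The kernel of the remainder is bounded by (2 ^ J e) ^ (- n). *)
Lemma rsum_cvg f e x : 0 < e -> mu.-integrable setT (EFin \o f) ->
  (fun J => rsum l e J f x) @ \oo --> rtr f e x.
Proof.
move=> e0 fi.
rewrite (_ : (fun J => _) = (fun J => rtr f e x - rtr f (e * 2 ^+ J) x)); last first.
  by apply/funext => J; rewrite rsum_rtr.
suff H : (fun J => rtr f (e * 2 ^+ J) x) @ \oo --> (0 : R).
  by have := cvgB (cvg_cst (rtr f e x)) H; rewrite subr0; exact.
pose M := e ^- n * \int[mu]_y `|f y|.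
have r0 j : 0 < e * 2 ^+ j by rewrite mulr_gt0// exprn_gt0.
have M0 : 0 <= M.
  by rewrite mulr_ge0 ?invr_ge0 ?exprn_ge0 ?(ltW e0)// Rintegral_ge0.
apply/norm_cvg0P; apply: (squeeze_cvgr (f := fun=> 0) (h := fun J => M * 2^-1 ^+ J)).
- apply: nearW => J; rewrite normr_ge0/=.
  apply: le_trans (rtr_le _ (r0 J) fi) _.
  rewrite /M exprMn invfM -!mulrA ler_wpM2l ?invr_ge0 ?exprn_ge0 ?(ltW e0)//.
  rewrite mulrC ler_wpM2l ?Rintegral_ge0// exprVn lef_pV2 ?posrE ?exprn_gt0//.
  by rewrite ler_eXnr ?exprn_ege1 ?ler1n// n_gt0.
- exact: cvg_cst.
- rewrite -[X in _ --> X](mulr0 M); apply: cvgM; first exact: cvg_cst.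
  by apply: cvg_expr; rewrite ger0_norm// invf_lt1// ltr1n.
Qed.

Lemma rtr_molecule1 (s : R) : n%:R < s -> exists2 C : R, 0 < C & forall e g, 0 < e ->
  measurable_fun setT g -> (forall x, `|g x| <= wgt s x) -> \int[mu]_y g y = 0 ->
  (\int[mu]_x `|rtr g e x|%:E <= C%:E)%E.
Proof.
move=> ns; have [C C0 HC] := @rsum_molecule R n l s ns.
exists C => // e g e0 mg gw g0.
have [_ _ gi] := bddL1_wgt ns mg gw.
apply: (fatou_L1 (f_ := fun J => rsum l e J g)) => [J||J].
- exact: measurable_rsum.
- by apply: aeW => x; exact: rsum_cvg.
- exact: HC.
Qed.

Lemma tker_scale e r y : 0 < r -> tker e y = r ^- n * tker (e / r) (r^-1 *: y).
Proof.
move=> r0; rewrite /tker enormZ gtr0_norm ?invr_gt0// [r^-1 * _]mulrC ltr_pM2r ?invr_gt0//.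
case: ifP => _; last by rewrite mulr0.
by rewrite rkerZ ?invr_gt0// exprVn invrK mulrA mulVf ?mul1r// expf_neq0 ?gt_eqF.
Qed.

(** A dilation by r turns the truncation at e into the truncation at e / r, and the
    bound at unit scale is uniform in the truncation. *)
Lemma rtr_molecule (s : R) : n%:R < s -> exists2 C : R, 0 < C & forall e g A r,
  0 < e -> 0 < A -> 0 < r ->
  measurable_fun setT g -> (forall x, `|g x| <= A * (r ^- n * wgt s (r^-1 *: x))) ->
  \int[mu]_y g y = 0 -> (\int[mu]_x `|rtr g e x|%:E <= (C * A)%:E)%E.
Proof.
move=> ns; have [C C0 HC] := rtr_molecule1 ns.
exists C => // e g A r e0 A0 r0 mg gw g0.
have rn : r ^+ n != 0 by rewrite expf_neq0 ?gt_eqF.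
have rn0 : 0 < r ^+ n by rewrite exprn_gt0.
have ri : 0 < r^-1 by rewrite invr_gt0.
pose G x := A^-1 * (r ^+ n * g (r *: x)).
have mg' := measurable_scale r mg.
have mG : measurable_fun setT G by do 2 apply: measurable_funM => //.
have Gw x : `|G x| <= wgt s x.
  rewrite /G !normrM gtr0_norm ?invr_gt0// [`|r ^+ n|]gtr0_norm// ler_pdivrMl//.
  rewrite -ler_pdivlMl//; apply: le_trans (gw _) _.
  by rewrite scalerA mulVf ?gt_eqF// scale1r mulrCA.
have G0 : \int[mu]_y G y = 0.
  have h := Rintegral_affine 0 (lt0r_neq0 r0) mg; rewrite g0 mulr0 in h.
  have gi : mu.-integrable setT (EFin \o (fun x : V => g (r *: x))).
    have [_ _ Gi] := bddL1_wgt ns mG Gw.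
    apply: (eq_integrableR (f := (fun x : V => (A * r ^- n) * G x))).
      by move=> x; rewrite /G; field; rewrite rn gt_eqF.
    exact: integrableZR.
  rewrite /G; transitivity (\int[mu]_y ((A^-1 * r ^+ n) * g (r *: y))).
    by apply: eq_Rintegral => y _; rewrite mulrA.
  rewrite RintegralZl//; under eq_Rintegral do rewrite -[r *: _]addr0.
  by rewrite h mulr0.
have E x : rtr g e x = A * (r ^- n * rtr G (e / r) (r^-1 *: x)).
  pose F y := tker (e / r) y * g (x - r *: y).
  have mF : measurable_fun setT F.
    apply: measurable_funM; first exact: measurable_tker.
    exact: (measurable_scale r (measurable_reflect x mg)).
  transitivity (r ^- n * \int[mu]_y F (r^-1 *: y + 0)).
    rewrite -RintegralZl//.
      apply: eq_Rintegral => y _; rewrite (tker_scale _ _ r0) /F addr0 scalerA.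
      by rewrite mulfV ?gt_eqF// scale1r mulrA.
    apply: (eq_integrableR (f := (fun y : V => r ^+ n * (tker e y * g (x - y))))).
      move=> y; rewrite (tker_scale _ _ r0) /F addr0 scalerA mulfV ?gt_eqF// scale1r.
      by rewrite !mulrA mulfV// mul1r.
    apply: integrableZR; apply: integrable_rtr => //.
    have [_ _ Gi] := bddL1_wgt ns mG Gw.
    apply: (integrable_le (M := A * \int[mu]_x `|G x|)) => //.
    have nG : measurable_fun setT (fun x => `|G x|) by exact: measurableT_comp.
    have := ge0_integral_scale ri nG (fun x => normr_ge0 _).
    rewrite exprVn invrK (integrable_normE Gi) => h.
    have -> : (\int[mu]_x `|g x|%:E = \int[mu]_x ((A * r ^- n) * `|G (r^-1 *: x)|)%:E)%E.
      apply: eq_integral => y _; rewrite /G scalerA mulfV ?gt_eqF// scale1r.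
      rewrite !normrM gtr0_norm ?invr_gt0// [`|r ^+ n|]gtr0_norm//.
      by congr EFin; field; rewrite rn gt_eqF.
    rewrite ge0_intZ ?mulr_ge0 ?invr_ge0 ?(ltW rn0) ?(ltW A0)//; last first.
      exact: (measurable_scale r^-1 nG).
    by rewrite h -!EFinM mulrA divfK.
  rewrite Rintegral_affine ?gt_eqF// gtr0_norm// exprVn invrK mulrA mulVf// mul1r.
  rewrite mulrA /rtr /convol -RintegralZl//.
    apply: eq_Rintegral => y _; rewrite /F /G scalerBr scalerA mulfV ?gt_eqF// scale1r.
    by field; rewrite rn gt_eqF.
  apply: integrable_rtr; first by rewrite divr_gt0.
  by have [] := bddL1_wgt ns mG Gw.
under eq_integral do rewrite E normrM (gtr0_norm A0) normrM gtr0_norm ?invr_gt0//.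
have mR := measurableT_comp (@normr_measurable R setT) (measurable_rtr (e / r) mG).
have mR' := measurable_scale r^-1 mR.
rewrite ge0_intZ ?(ltW A0)//; last 2 first.
- exact: measurable_funM.
- by move=> x; rewrite mulr_ge0// invr_ge0 ltW.
rewrite ge0_intZ ?invr_ge0 ?(ltW rn0)//.
rewrite (ge0_integral_scale ri mR (fun x => normr_ge0 _)) exprVn invrK.
rewrite (muleA (r ^- n)%:E) -EFinM mulVf// mul1e [C * A]mulrC EFinM.
rewrite lee_wpmul2l ?lee_fin ?(ltW A0)//.
by apply: HC; rewrite // divr_gt0.
Qed.

End truncated_riesz.

(** * The principal value *)

Lemma measurable_bigcap_count d (T : measurableType d) (I : countType)
    (A : I -> set T) :
  (forall i, measurable (A i)) -> measurable (\bigcap_i A i).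
Proof.
move=> mA; rewrite -[X in measurable X]setCK setC_bigcap; apply: measurableC.
by apply: measurable_bigcup_count => i; exact: measurableC.
Qed.

Section limit_at_zero.
Context d (T : measurableType d) (R : realType).
Variable mu : {measure set T -> \bar R}.
Variable F : R -> T -> R.
Hypothesis mF : forall e, 0 < e -> measurable_fun setT (F e).
Hypothesis Fr : forall x e, 0 < e -> F e' x @[e' --> e^'+] --> F e x.

(** Equal to 0 where the limit does not exist. *)
Definition lim0 x : R := lim (F e x @[e --> 0^'+]).

Definition has_lim0 : set T := [set x | cvg (F e x @[e --> 0^'+])].

(** Cauchy's criterion; rational truncations suffice because F is right-continuous in
    the truncation parameter. *)
Lemma has_lim0E : has_lim0 = \bigcap_(m : nat) \bigcup_(k : nat) \bigcap_(pq : rat * rat)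
  [set x | 0 < (ratr pq.1 : R) < k.+1%:R^-1 -> 0 < (ratr pq.2 : R) < k.+1%:R^-1 ->
    `|F (ratr pq.1 : R) x - F (ratr pq.2 : R) x| <= (m.+1%:R^-1 : R)].
Proof.
apply/seteqP; split => x /=.
  move=> /cvg_ex[l /cvgrPdist_le cl] m _.
  have m0 : (0 : R) < (m.+1%:R^-1) / 2 by rewrite divr_gt0.
  have [t /= t0 dl] := cl _ m0.
  have [k kd] : exists k : nat, k.+1%:R^-1 < t.
    exists (Num.truncn t^-1); rewrite -[X in _ < X]invrK ltf_pV2 ?posrE ?invr_gt0//.
    exact: truncnS_gt.
  exists k => // -[p q] _ /= /andP[p0 pk] /andP[q0 qk].
  have H (s : R) : 0 < s -> s < k.+1%:R^-1 -> `|l - F s x| <= m.+1%:R^-1 / 2.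
    move=> s0 tk; apply: dl => //=.
    by rewrite sub0r normrN gtr0_norm// (lt_trans tk).
  have := H _ p0 pk; have := H _ q0 qk.
  move: (F _ x) (F _ x) (m.+1%:R^-1) => a b c.
  rewrite !ler_norml => /andP[? ?] /andP[? ?]; apply/andP; split; lra.
move=> H; apply/cauchy_cvgP; apply: cauchy_exP => eps eps0.
have [m meps] : exists m : nat, (m.+1%:R^-1 : R) < eps / 2.
  exists (Num.truncn (eps / 2)^-1); rewrite -[X in _ < X]invrK ltf_pV2 ?posrE ?invr_gt0 ?divr_gt0//.
  exact: truncnS_gt.
have [k _ Hk] := H m I.
have k0 : (0 : R) < k.+1%:R^-1 by rewrite invr_gt0.
have [q0] := rat_in_itvoo k0; rewrite in_itv/= => q0k.
exists (F (ratr q0) x); near=> e.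
have e0 : 0 < e by near: e; exact: nbhs_right_gt.
have ek : e < k.+1%:R^-1 by near: e; exact: nbhs_right_lt.
rewrite /ball/= distrC.
have /cvgrPdist_lt := @Fr x e e0.
have e20 : 0 < eps / 2 by rewrite divr_gt0.
move=> /(_ _ e20)[t /= t0 dF].
have emin : e < Num.min (e + t) k.+1%:R^-1 by rewrite lt_min ek andbT ltrDl.
have [p] := rat_in_itvoo emin; rewrite in_itv/= lt_min => /andP[ep /andP[pd pk]].
have h1 : `|F e x - F (ratr p) x| < eps / 2.
  apply: dF => //=; rewrite ltr0_norm ?subr_lt0// opprB ltrBlDl//.
have h2 : `|F (ratr p) x - F (ratr q0) x| <= m.+1%:R^-1.
  by apply: (Hk (p, q0)) => //=; rewrite pk (lt_trans e0).
rewrite (_ : F e x - F (ratr q0) x =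
  (F e x - F (ratr p) x) + (F (ratr p) x - F (ratr q0) x)); last by rewrite addrA subrK.
apply: le_lt_trans (ler_normD _ _) _.
rewrite [ltRHS](splitr eps); apply: ltrD h1 _; exact: le_lt_trans meps.
Unshelve. all: by end_near. Qed.

Lemma measurable_has_lim0 : measurable has_lim0.
Proof.
rewrite has_lim0E; apply: bigcap_measurable => // m _.
apply: bigcup_measurable => // k _; apply: measurable_bigcap_count => -[p q] /=.
have [pk|pk] := boolP (0 < (ratr p : R) < k.+1%:R^-1); last first.
  rewrite (_ : [set x | _] = setT)//.
  by apply/seteqP; split.
have [qk|qk] := boolP (0 < (ratr q : R) < k.+1%:R^-1); last first.
  rewrite (_ : [set x | _] = setT)//.
  by apply/seteqP; split.
have mpq : measurable_fun setT (fun x => `|F (ratr p) x - F (ratr q) x|).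
  apply: measurableT_comp => //; apply: measurable_funB; apply: mF.
    by case/andP : pk.
  by case/andP : qk.
rewrite (_ : [set x | _] =
  (fun x => `|F (ratr p) x - F (ratr q) x|) @^-1` `]-oo, m.+1%:R^-1]%classic).
  by rewrite -[X in measurable X]setTI; exact: (mpq measurableT _ (measurable_itv _)).
apply/seteqP; split => x /=; rewrite in_itv/=; first exact.
by [].
Qed.

Let approx j x : R := \1_has_lim0 x * F (j.+1%:R^-1) x.

Let measurable_approx j : measurable_fun setT (approx j).
Proof.
apply: measurable_funM; first by apply: measurable_indic; exact: measurable_has_lim0.
by apply: mF; rewrite invr_gt0.
Qed.

Let approx_cvg x : (fun j => approx j x) @ \oo --> lim0 x.
Proof.
rewrite /approx indicE /lim0; have [xE|xE] := pselect (has_lim0 x); last first.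
  rewrite memNset// dvgP//.
  under eq_cvg do rewrite mul0r.
  exact: cvg_cst.
rewrite mem_set//.
under eq_cvg do rewrite mul1r.
have /cvg_at_rightP := xE; apply; split; first by move=> j; rewrite invr_gt0.
exact: cvg_harmonic.
Qed.

Lemma measurable_lim0 : measurable_fun setT lim0.
Proof. by apply: (measurable_fun_cvg (h := approx)) => // x _; exact: approx_cvg. Qed.

(** Fatou along e = 1 / (j + 1) on the set where the limit exists; elsewhere lim0 is 0.
    This bounds principal values without showing that they exist almost everywhere. *)
Lemma lim0_L1 (C : \bar R) : (forall e, 0 < e -> (\int[mu]_x `|F e x|%:E <= C)%E) ->
  (\int[mu]_x `|lim0 x|%:E <= C)%E.
Proof.
move=> FC; apply: (fatou_L1 (f_ := approx)) => //.
  by apply: aeW => x; exact: approx_cvg.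
move=> j; have j0 : (0 : R) < j.+1%:R^-1 by rewrite invr_gt0.
apply: le_trans (FC _ j0); apply: ge0_le_integralT => x; first by rewrite lee_fin.
rewrite lee_fin normrM ler_piMl// indicE; case: (_ \in _); first by rewrite normr1.
by rewrite normr0.
Qed.

End limit_at_zero.

Section riesz_real.
Context {R : realType} {n : nat}.
Local Notation V := 'rV[R]_n.
Local Notation mu := (@lebesgue_rV R n).
Variable l : 'I_n.
Implicit Types (x y : V) (f g : V -> R) (e r : R).

(** The constraint e < |y| is open in e, so the truncated kernels converge pointwise
    from the right; dominated convergence. *)
Lemma rtr_right_continuous f x e : 0 < e -> mu.-integrable setT (EFin \o f) ->
  rtr l f e' x @[e' --> e^'+] --> rtr l f e x.
Proof.
move=> e0 fi; have mf := integrable_measurable fi.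
apply/cvg_at_rightP => u [ue uc].
pose h j y : R := tker l (u j) y * f (x - y).
pose h0 y : R := tker l e y * f (x - y).
have mh e' : measurable_fun setT (fun y : V => tker l e' y * f (x - y)).
  by apply: measurable_funM; [exact: measurable_tker|exact: measurable_reflect].
have en : 0 <= e ^- n by rewrite invr_ge0 exprn_ge0// ltW.
have gi : mu.-integrable setT (EFin \o (fun y : V => e ^- n * `|f (x - y)|)).
  apply: integrableZR; apply: integrable_normR; exact: integrable_reflect.
have [_ _ H] : [/\ mu.-integrable setT (fun y => (h0 y)%:E),
    [sequence (\int[mu]_y `|(h j y)%:E - (h0 y)%:E|)%E]_j @ \oo --> 0%E &
    [sequence (\int[mu]_y (h j y)%:E)%E]_j @ \oo --> (\int[mu]_y (h0 y)%:E)%E].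
  apply: (@dominated_convergence _ _ _ mu setT measurableT (fun j y => (h j y)%:E)
    (fun y => (h0 y)%:E) (fun y => (e ^- n * `|f (x - y)|)%:E)) => //.
  - by move=> j; apply/measurable_EFinP; exact: mh.
  - by apply/measurable_EFinP; exact: mh.
  - apply: aeW => y _; apply: cvg_near_cst; rewrite /h /h0 /tker.
    have [ey|ey] := ltP e (enorm y); last first.
      by apply: nearW => j; rewrite ltNge (le_trans ey (ltW (ue j))).
    move/cvgrPdist_lt: uc => /(_ (enorm y - e)); rewrite subr_gt0 => /(_ ey).
    apply: filterS => j; rewrite ltr0_norm ?subr_lt0// opprB ltrBlDr subrK.
    by move=> ->.
  - apply: aeW => y j _ /=; rewrite lee_fin normrM ler_wpM2r//.
    rewrite /tker; case: ifP => ey; last by rewrite normr0.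
    have := tker_le l y e0; rewrite /tker (lt_trans (ue j) ey); exact.
have : fine (\int[mu]_y (h j y)%:E)%E @[j --> \oo] --> fine (\int[mu]_y (h0 y)%:E)%E.
  apply: fine_cvg; rewrite fineK//.
  by apply: integrable_fin_num => //; exact: integrable_rtr.
exact.
Qed.

Variable c : R.

Definition rlim f x : R := lim (c * rtr l f e x @[e --> 0^'+]).

Lemma rlim_measurable f : mu.-integrable setT (EFin \o f) -> measurable_fun setT (rlim f).
Proof.
move=> fi; have mf := integrable_measurable fi.
rewrite -[rlim f]/(lim0 (fun e x => c * rtr l f e x)).
apply: measurable_lim0.
  by move=> e e0; apply: measurable_funM => //; exact: measurable_rtr.
by move=> x e e0; apply: cvgM; [exact: cvg_cst|exact: rtr_right_continuous].
Qed.

Lemma rlim_L1 f (C : R) : mu.-integrable setT (EFin \o f) ->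
  (forall e, 0 < e -> (\int[mu]_x `|rtr l f e x|%:E <= C%:E)%E) ->
  (\int[mu]_x `|rlim f x|%:E <= (`|c| * C)%:E)%E.
Proof.
move=> fi fC; have mf := integrable_measurable fi.
rewrite -[rlim f]/(lim0 (fun e x => c * rtr l f e x)).
apply: lim0_L1.
- by move=> e e0; apply: measurable_funM => //; exact: measurable_rtr.
- by move=> x e e0; apply: cvgM; [exact: cvg_cst|exact: rtr_right_continuous].
move=> e e0; under eq_integral do rewrite normrM.
rewrite ge0_intZ//; last by apply: measurableT_comp => //; exact: measurable_rtr.
by rewrite EFinM lee_wpmul2l ?lee_fin//; exact: fC.
Qed.

End riesz_real.

(** * Complex-valued functions and the Hardy norm *)

Section complex_norm.
Context {R : realType}.
Implicit Types z w : R[i].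

Lemma ReB z w : complex.Re (z - w) = complex.Re z - complex.Re w.
Proof. by case: z w => a b []. Qed.

Lemma ImB z w : complex.Im (z - w) = complex.Im z - complex.Im w.
Proof. by case: z w => a b []. Qed.

Lemma ReD z w : complex.Re (z + w) = complex.Re z + complex.Re w.
Proof. by case: z w => a b []. Qed.

Lemma ImD z w : complex.Im (z + w) = complex.Im z + complex.Im w.
Proof. by case: z w => a b []. Qed.

Lemma ReM z w : complex.Re (z * w) = complex.Re z * complex.Re w - complex.Im z * complex.Im w.
Proof. by case: z w => a b []. Qed.

Lemma ImM z w : complex.Im (z * w) = complex.Re z * complex.Im w + complex.Im z * complex.Re w.
Proof. by case: z w => a b []. Qed.

Lemma normc_ge0 z : 0 <= Normc.normc z.
Proof. by case: z => a b; exact: sqrtr_ge0. Qed.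

Lemma Re_le_normc z : `|complex.Re z| <= Normc.normc z.
Proof.
case: z => a b /=; rewrite -sqrtr_sqr; apply: ler_wsqrtr.
by rewrite lerDl sqr_ge0.
Qed.

Lemma Im_le_normc z : `|complex.Im z| <= Normc.normc z.
Proof.
case: z => a b /=; rewrite -sqrtr_sqr; apply: ler_wsqrtr.
by rewrite lerDr sqr_ge0.
Qed.

Lemma normc_le_ReIm z : Normc.normc z <= `|complex.Re z| + `|complex.Im z|.
Proof.
case: z => a b /=; rewrite -[leRHS]ger0_norm ?addr_ge0// -sqrtr_sqr; apply: ler_wsqrtr.
rewrite sqrrD !real_normK ?num_real// lerD2r lerDl.
by rewrite mulrn_wge0// mulr_ge0.
Qed.

Lemma normc_triB z w : Normc.normc (z - w) <= Normc.normc z + Normc.normc w.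
Proof. by apply: le_trans (le_normcD _ _) _; rewrite normcN. Qed.

Lemma Re_sum (I : Type) (s : seq I) (P : pred I) (F : I -> R[i]) :
  complex.Re (\sum_(i <- s | P i) F i) = \sum_(i <- s | P i) complex.Re (F i).
Proof. by elim/big_ind2 : _ => // z a w c <- <-; exact: ReD. Qed.

Lemma Im_sum (I : Type) (s : seq I) (P : pred I) (F : I -> R[i]) :
  complex.Im (\sum_(i <- s | P i) F i) = \sum_(i <- s | P i) complex.Im (F i).
Proof. by elim/big_ind2 : _ => // z a w c <- <-; exact: ImD. Qed.

Lemma complexE z : z = Complex (complex.Re z) (complex.Im z).
Proof. by case: z. Qed.

End complex_norm.

Section complex_integral.
Context d (T : measurableType d) (R : realType).
Variable mu : {measure set T -> \bar R}.
Implicit Types f g : T -> R[i].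

Definition cmeas f := measurable_fun setT (fun x => complex.Re (f x)) /\
  measurable_fun setT (fun x => complex.Im (f x)).

Definition cintable f := mu.-integrable setT (EFin \o (fun x => complex.Re (f x))) /\
  mu.-integrable setT (EFin \o (fun x => complex.Im (f x))).

Lemma measurable_normc f : cmeas f -> measurable_fun setT (fun x => Normc.normc (f x)).
Proof.
move=> [mr mi].
rewrite (_ : (fun x => _) = (fun r => r `^ (2^-1)) \o
  (fun x => complex.Re (f x) ^+ 2 + complex.Im (f x) ^+ 2)); last first.
  apply/funext => x /=; rewrite powR12_sqrt ?addr_ge0 ?sqr_ge0//.
  by rewrite {1}[f x]complexE.
apply: measurableT_comp; first exact: measurable_powR.
by apply: measurable_funD; apply: measurable_funX.
Qed.

Lemma cmeasM f g : cmeas f -> cmeas g -> cmeas (fun x => f x * g x).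
Proof.
move=> [mf1 mf2] [mg1 mg2]; split.
- under eq_fun do rewrite ReM.
  by apply: measurable_funB; exact: measurable_funM.
- under eq_fun do rewrite ImM.
  by apply: measurable_funD; exact: measurable_funM.
Qed.

Lemma cmeasB f g : cmeas f -> cmeas g -> cmeas (fun x => f x - g x).
Proof.
move=> [mf1 mf2] [mg1 mg2]; split.
- by under eq_fun do rewrite ReB; exact: measurable_funB.
- by under eq_fun do rewrite ImB; exact: measurable_funB.
Qed.

Lemma cmeas_cst z : cmeas (fun=> z).
Proof. by split. Qed.

Lemma cmeas_sum (I : Type) (s : seq I) (F : I -> T -> R[i]) :
  (forall i, cmeas (F i)) -> cmeas (fun x => \sum_(i <- s) F i x).
Proof.
move=> mF; split.
- by under eq_fun do rewrite Re_sum; apply: measurable_sum => i; case: (mF i).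
- by under eq_fun do rewrite Im_sum; apply: measurable_sum => i; case: (mF i).
Qed.

Lemma cintable_le f (M : R) : cmeas f ->
  (\int[mu]_x (Normc.normc (f x))%:E <= M%:E)%E -> cintable f.
Proof.
move=> [mr mi] fM; split; apply: (integrable_le (M := M)) => //; apply: le_trans fM;
  apply: ge0_le_integralT => x; rewrite lee_fin//.
- exact: Re_le_normc.
- exact: Im_le_normc.
Qed.

Lemma ae_cintegral f g : {ae mu, forall x, f x = g x} ->
  cintegral mu setT f = cintegral mu setT g.
Proof.
by move=> fg; congr Complex; apply: ae_eq_RintegralT; apply: filterS fg => x ->.
Qed.

(** The factor 2 comes from treating the real and the imaginary part separately. *)
Lemma normc_cintegral_le f (M : R) :
  (\int[mu]_x (Normc.normc (f x))%:E <= M%:E)%E ->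
  Normc.normc (cintegral mu setT f) <= 2 * M.
Proof.
move=> fM; apply: le_trans (normc_le_ReIm _) _; rewrite mulr2n mulrDl mul1r.
apply: lerD; apply: normr_Rintegral_le_fin; apply: le_trans fM;
  apply: ge0_le_integralT => x; rewrite lee_fin//.
- exact: Re_le_normc.
- exact: Im_le_normc.
Qed.

Lemma cintegralB f g : cintable f -> cintable g ->
  cintegral mu setT (fun x => f x - g x) = cintegral mu setT f - cintegral mu setT g.
Proof.
move=> [fr fi] [gr gi]; rewrite [RHS]complexE ReB ImB/=; congr Complex.
- by rewrite -RintegralB//; apply: eq_Rintegral => x _; rewrite ReB.
- by rewrite -RintegralB//; apply: eq_Rintegral => x _; rewrite ImB.
Qed.

Lemma cintegralZ z f : cintable f ->
  cintegral mu setT (fun x => z * f x) = z * cintegral mu setT f.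
Proof.
move=> [fr fi]; rewrite [RHS]complexE ReM ImM/=; congr Complex.
- rewrite -!RintegralZl// -RintegralB//; try exact: integrableZR.
  by apply: eq_Rintegral => x _; rewrite ReM.
- rewrite -!RintegralZl// -RintegralD//; try exact: integrableZR.
  by apply: eq_Rintegral => x _; rewrite ImM.
Qed.

Lemma cLnorm1E f : cLnorm mu 1%:E f = (\int[mu]_x (Normc.normc (f x))%:E)%E.
Proof.
rewrite /cLnorm Lnorm1; apply: eq_integral => x _ /=.
by rewrite ger0_norm// normc_ge0.
Qed.

End complex_integral.

Section riesz_complex.
Context {R : realType} {n : nat}.
Local Notation V := 'rV[R]_n.
Local Notation mu := (@lebesgue_rV R n).
Implicit Types (f g : V -> R[i]).

Lemma riesz_truncE (l : 'I_n) f e x : riesz_trunc l f e x =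
  Complex (riesz_cst R n * rtr l (fun y => complex.Re (f y)) e x)
          (riesz_cst R n * rtr l (fun y => complex.Im (f y)) e x).
Proof.
rewrite /riesz_trunc [LHS]complexE ReM ImM /= !mul0r subr0 addr0; congr Complex;
  congr (_ * _); rewrite Rintegral_mkcond; apply: eq_Rintegral => y _ /=;
  rewrite patchE /tker; (have [ey|ey] := ltP e (enorm y);
    [rewrite mem_set//|rewrite memNset ?mul0r//]).
- by rewrite ReM /= mul0r subr0.
- by apply/negP; rewrite -leNgt.
- by rewrite ImM /= mul0r addr0.
- by apply/negP; rewrite -leNgt.
Qed.

Lemma rieszE (l : 'I_n) f x : riesz l f x =
  Complex (rlim l (riesz_cst R n) (fun y => complex.Re (f y)) x)
          (rlim l (riesz_cst R n) (fun y => complex.Im (f y)) x).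
Proof.
rewrite /riesz /rlim.
have -> : (fun e => complex.Re (riesz_trunc l f e x)) =
  (fun e => riesz_cst R n * rtr l (fun y => complex.Re (f y)) e x).
  by apply/funext => e; rewrite riesz_truncE.
have -> // : (fun e => complex.Im (riesz_trunc l f e x)) =
  (fun e => riesz_cst R n * rtr l (fun y => complex.Im (f y)) e x).
by apply/funext => e; rewrite riesz_truncE.
Qed.

Lemma ae_reflect (P : V -> Prop) (x : V) :
  {ae mu, forall y, P y} -> {ae mu, forall y, P (x - y)}.
Proof.
move=> [N [mN N0 NP]]; exists ((fun y => (-1) *: y + x) @^-1` N); split.
- rewrite -[X in measurable X]setTI; exact: measurable_affine.
- by rewrite lebesgue_rV_affine// ?oppr_eq0 ?oner_eq0// N0 mule0.
- by move=> y /= nP; apply: NP; rewrite /= scaleN1r addrC.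
Qed.

Lemma ae_rlim (l : 'I_n) c (F G : V -> R) x : {ae mu, forall x, F x = G x} ->
  rlim l c F x = rlim l c G x.
Proof.
move=> FG; have H : (fun e => c * rtr l F e x) = (fun e => c * rtr l G e x).
  apply/funext => e; congr (_ * _); apply: ae_eq_RintegralT.
  by apply: filterS (ae_reflect x FG) => y ->.
exact: (congr1 (fun u : R -> R => lim (u e @[e --> 0^'+])) H).
Qed.

(** Equality holds at every point: the reflection about a point preserves null sets,
    so the truncated integrals coincide. *)
Lemma ae_riesz (l : 'I_n) f g : {ae mu, forall x, f x = g x} -> riesz l f = riesz l g.
Proof.
move=> fg; apply/funext => x; rewrite !rieszE.
have fr : {ae mu, forall x, complex.Re (f x) = complex.Re (g x)} by apply: filterS fg => y ->.
have fi : {ae mu, forall x, complex.Im (f x) = complex.Im (g x)} by apply: filterS fg => y ->.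
by rewrite (ae_rlim l _ x fr) (ae_rlim l _ x fi).
Qed.

(** The principal values are controlled by the truncations uniformly in e
    ([rlim_L1]), and f may be replaced by its Borel representative g ([ae_riesz]). *)
Lemma H1_bound f g (B C : R) : cmeas g -> {ae mu, forall x, f x = g x} ->
  (\int[mu]_x (Normc.normc (g x))%:E <= B%:E)%E ->
  (forall (l : 'I_n) e, 0 < e ->
     (\int[mu]_x `|rtr l (fun y => complex.Re (g y)) e x|%:E <= C%:E)%E) ->
  (forall (l : 'I_n) e, 0 < e ->
     (\int[mu]_x `|rtr l (fun y => complex.Im (g y)) e x|%:E <= C%:E)%E) ->
  in_H1 f /\ (H1norm f <= (B + n%:R * (2 * (`|riesz_cst R n| * C)))%:E)%E.
Proof.
move=> mg fg gB gr gi; have [ir ii] := cintable_le mg gB.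
have EB : (cLnorm mu 1%:E f <= B%:E)%E.
  rewrite cLnorm1E (ae_eq_integralT (g := fun x => (Normc.normc (g x))%:E))//.
  by apply: filterS fg => x ->.
have mR l : cmeas (riesz l g).
  split; (under eq_fun do rewrite rieszE); exact: rlim_measurable.
have ER l : (cLnorm mu 1%:E (riesz l f) <= (2 * (`|riesz_cst R n| * C))%:E)%E.
  rewrite (ae_riesz l fg) cLnorm1E.
  apply: (@le_trans _ _ (\int[mu]_x (`|rlim l (riesz_cst R n) (fun y => complex.Re (g y)) x|
     + `|rlim l (riesz_cst R n) (fun y => complex.Im (g y)) x|)%:E)%E).
    apply: ge0_le_integralT => x; rewrite lee_fin ?normc_ge0//.
    by apply: le_trans (normc_le_ReIm _) _; rewrite rieszE.
  rewrite ge0_intD//; try (by apply: measurableT_comp => //; exact: rlim_measurable).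
  rewrite mulr_natl mulr2n EFinD.
  by apply: leeD; [exact: (rlim_L1 _ ir (gr l))|exact: (rlim_L1 _ ii (gi l))].
split; last first.
  rewrite /H1norm EFinD; apply: leeD => //.
  rewrite mulr_natl -[X in _ *+ X](card_ord n) -sumr_const -sumEFin.
  exact: lee_sum.
split; first split.
- by exists g; case: mg.
- exact: le_lt_trans EB (ltry _).
move=> l; split; last exact: le_lt_trans (ER l) (ltry _).
by exists (riesz l g); case: (mR l) => ? ?; split => //; rewrite (ae_riesz l fg); exact: aeW.
Qed.

End riesz_complex.

(** * Null sets and integrals on a product *)

Section product_sections.
Context d1 d2 (T1 : measurableType d1) (T2 : measurableType d2) (R : realType).
Variables (m1 : {sigma_finite_measure set T1 -> \bar R})
  (m2 : {sigma_finite_measure set T2 -> \bar R}).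

Lemma ae_xsection (P : T1 * T2 -> Prop) : {ae (m1 \x m2)%E, forall z, P z} ->
  {ae m1, forall x, {ae m2, forall y, P (x, y)}}.
Proof.
move=> [N [mN N0 NP]].
have N1 : (\int[m1]_x `|m2 (xsection N x)| = 0)%E.
  rewrite -[RHS]N0; apply: eq_integral => x _; by rewrite gee0_abs// measure_ge0.
have /ae_eq_integral_abs : measurable_fun setT (fun x => m2 (xsection N x)).
  exact: measurable_fun_xsection.
move=> /(_ m1 measurableT) [/(_ N1) H _].
apply: filterS H => x /= /(_ I) Hx; exists (xsection N x); split => //.
  exact: measurable_xsection.
by move=> y /= nP; rewrite /xsection/= inE; exact: NP.
Qed.

Lemma ae_ysection (P : T1 * T2 -> Prop) : {ae (m1 \x m2)%E, forall z, P z} ->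
  {ae m2, forall y, {ae m1, forall x, P (x, y)}}.
Proof.
move=> [N [mN N0 NP]].
have N1 : (\int[m2]_y `|m1 (ysection N y)| = 0)%E.
  transitivity ((m1 \x^ m2)%E N); last first.
    rewrite -[RHS]N0; apply/esym; apply: product_measure_unique => // A B mA mB.
    exact: product_measure2E.
  by apply: eq_integral => x _; rewrite gee0_abs// measure_ge0.
have /ae_eq_integral_abs : measurable_fun setT (fun y => m1 (ysection N y)).
  exact: measurable_fun_ysection.
move=> /(_ m2 measurableT) [/(_ N1) H _].
apply: filterS H => y /= /(_ I) Hy; exists (ysection N y); split => //.
  exact: measurable_ysection.
by move=> x /= nP; rewrite /ysection/= inE; exact: NP.
Qed.

Lemma cmeas_xsection (G : T1 * T2 -> R[i]) x : cmeas G -> cmeas (fun y => G (x, y)).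
Proof.
move=> [mr mi]; split.
- exact: (measurable_fun_pair2 x mr).
- exact: (measurable_fun_pair2 x mi).
Qed.

Lemma cmeas_ysection (G : T1 * T2 -> R[i]) y : cmeas G -> cmeas (fun x => G (x, y)).
Proof.
move=> [mr mi]; split.
- exact: (measurable_fun_pair1 y mr).
- exact: (measurable_fun_pair1 y mi).
Qed.

Lemma cmeas_cintegral (G : T1 * T2 -> R[i]) : cmeas G ->
  cmeas (fun x => cintegral m2 setT (fun y => G (x, y))).
Proof.
move=> [mr mi]; split.
- exact: (@measurable_Rintegral _ _ _ _ _ m2 (fun z => complex.Re (G z))).
- exact: (@measurable_Rintegral _ _ _ _ _ m2 (fun z => complex.Im (G z))).
Qed.

Lemma cFubini (G : T1 * T2 -> R[i]) : cmeas G ->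
  (\int[m2]_y \int[m1]_x (Normc.normc (G (x, y)))%:E < +oo)%E ->
  (forall x, cintable m2 (fun y => G (x, y))) ->
  (forall y, cintable m1 (fun x => G (x, y))) ->
  cintegral m1 setT (fun x => cintegral m2 setT (fun y => G (x, y))) =
  cintegral m2 setT (fun y => cintegral m1 setT (fun x => G (x, y))).
Proof.
move=> [mr mi] Goo Gx Gy.
have part (P : R[i] -> R) : (forall z, `|P z| <= Normc.normc z) ->
    (\int[m2]_y \int[m1]_x `|P (G (x, y))|%:E < +oo)%E.
  move=> Pn; apply: le_lt_trans Goo; apply: ge0_le_integralT => y.
    by apply: integral_ge0 => x _; rewrite lee_fin.
  by apply: ge0_le_integralT => x; rewrite lee_fin.
congr Complex.
- apply: (Rintegral_Fubini (G := fun z => complex.Re (G z))) => //.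
  + by apply: part => z; exact: Re_le_normc.
  + by move=> x; case: (Gx x).
  + by move=> y; case: (Gy y).
- apply: (Rintegral_Fubini (G := fun z => complex.Im (G z))) => //.
  + by apply: part => z; exact: Im_le_normc.
  + by move=> x; case: (Gx x).
  + by move=> y; case: (Gy y).
Qed.

End product_sections.

(** * Borel representatives and Hoelder functions *)

Section bounded_representatives.
Context d (T : measurableType d) (R : realType).
Variable mu : {measure set T -> \bar R}.
Implicit Types f g : T -> R[i].

Lemma cmeas_if (c : T -> bool) f : measurable_fun setT c -> cmeas f ->
  cmeas (fun x => if c x then f x else 0).
Proof.
move=> mc [mr mi]; split.
- rewrite (_ : (fun x => _) = (fun x => if c x then complex.Re (f x) else 0)).
    exact: measurable_fun_ifT.
  by apply/funext => x; case: ifP.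
- rewrite (_ : (fun x => _) = (fun x => if c x then complex.Im (f x) else 0)).
    exact: measurable_fun_ifT.
  by apply/funext => x; case: ifP.
Qed.

(** Put a Borel representative equal to 0 where it violates the bound. *)
Lemma bounded_representative f (M : T -> R) : measurable_fun setT M ->
  (forall x, 0 <= M x) -> ae_measurable mu f ->
  {ae mu, forall x, Normc.normc (f x) <= M x} ->
  exists g, [/\ cmeas g, {ae mu, forall x, f x = g x} &
    forall x, Normc.normc (g x) <= M x].
Proof.
move=> mM M0 [g [mr mi fg]] fM.
exists (fun x => if Normc.normc (g x) <= M x then g x else 0); split.
- apply: cmeas_if; last by split.
  by apply: measurable_fun_ler => //; exact: measurable_normc.
- by apply: filterS2 fg fM => x -> ->.
- by move=> x; case: ifP => // _; rewrite Normc.normc0.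
Qed.

Lemma Lpinfty_representative f : in_Lp mu +oo%E f -> exists g (M : R),
  [/\ 0 <= M, cmeas g, {ae mu, forall x, f x = g x} & forall x, Normc.normc (g x) <= M].
Proof.
move=> [mf fB].
have [M M0 fM] : exists2 M : R, 0 <= M & {ae mu, forall x, Normc.normc (f x) <= M}.
  have [mu0|mu0] := ltP (0 : \bar R)%E (mu setT); last first.
    exists 0 => //; exists setT; split => //.
    by apply/eqP; rewrite eq_le mu0 measure_ge0.
  move: fB; rewrite /cLnorm unlock mu0.
  set c := ess_sup_inf.ess_sup _ _ => coo.
  have Hc : {ae mu, forall x, ((Normc.normc (f x))%:E <= c)%E}.
    have := ess_sup_inf.ess_sup_ge mu (abse \o (fun x => (Normc.normc (f x))%:E)).
    apply: filterS => x; rewrite -/c; apply: le_trans => /=.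
    by rewrite lee_fin ler_norm.
  exists `|fine c| => //; apply: filterS Hc => x.
  case: (c) coo => [r _|//|_] /=; last by rewrite leeNy_eq.
  by rewrite lee_fin => /le_trans; apply; rewrite ler_norm.
have [g [mg fg gM]] := bounded_representative (measurable_cst M) (fun=> M0) mf fM.
by exists g, M.
Qed.

End bounded_representatives.

Section holder_functions.
Context {R : realType} {n : nat}.
Local Notation V := 'rV[R]_n.
Variables (delta : R) (phi : V -> R[i]).
Hypothesis n0 : (0 < n)%N.
Hypothesis d01 : 0 < delta <= 1.
Hypothesis Hphi : holder_c0 delta phi.

Lemma holder_c0_cmeas : cmeas phi.
Proof.
have [_ [K HK]] := Hphi; have /andP[d0 _] := d01.
split; apply: (holder_measurable (K := K) d0) => x y; apply: le_trans (HK x y).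
- by rewrite -ReB Re_le_normc.
- by rewrite -ImB Im_le_normc.
Qed.

Lemma enorm_le_norm (x : V) : enorm x <= n%:R * `|x|.
Proof.
apply: le_trans (enorm_le_sum x) _.
rewrite mulr_natl -[X in _ *+ X](card_ord n) -sumr_const; apply: ler_sum => i _.
rewrite [leRHS]/Num.Def.normr/= mx_normrE; exact: (le_bigmax _ (fun i => `|x i.1 i.2|) (ord0, i)).
Qed.

Lemma holder_c0_support : exists2 rho : R, 1 <= rho &
  forall x, rho < enorm x -> phi x = 0.
Proof.
have [cs _] := Hphi; have [M [Mr HM]] := compact_bounded cs.
pose m := `|M| + 1.
exists (n%:R * m + 1); first by rewrite lerDr mulr_ge0// addr_ge0.
move=> x xm; apply/eqP; apply/negP => /negP phix.
have : `|x| <= m.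
  apply: HM; first by rewrite /m (le_lt_trans (ler_norm M))// ltrDl.
  exact: subset_closure.
move=> xm'; have := lt_le_trans xm (enorm_le_norm x).
have : n%:R * `|x| <= n%:R * m by rewrite ler_wpM2l.
by lra.
Qed.

(** Compare with a point x1 outside the support. *)
Lemma holder_c0_bounded : exists2 B : R, 0 < B & forall x, Normc.normc (phi x) <= B.
Proof.
have [rho rho1 Hrho] := holder_c0_support; have [_ [K HK]] := Hphi.
have /andP[d0 d1] := d01.
pose x1 : V := (rho + 1) *: delta_mx ord0 (Ordinal n0).
have e1 : rho < enorm x1.
  rewrite enormZ ger0_norm; last by lra.
  have : 1 <= enorm (delta_mx ord0 (Ordinal n0) : V).
    have := enorm_coord (delta_mx ord0 (Ordinal n0) : V) (Ordinal n0).
    by rewrite mxE !eqxx normr1.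
  nra.
pose D := rho + enorm x1.
exists (`|K| * D `^ delta + 1); first by rewrite ltr_wpDl// mulr_ge0// powR_ge0.
move=> x; have [xr|xr] := leP (enorm x) rho; last first.
  by rewrite Hrho// Normc.normc0 addr_ge0// mulr_ge0// powR_ge0.
have := HK x x1; rewrite (Hrho x1)// subr0 => /le_trans; apply.
apply: (@le_trans _ _ (`|K| * D `^ delta)); last by rewrite lerDl.
apply: (@le_trans _ _ (`|K| * enorm (x - x1) `^ delta)).
  by rewrite ler_wpM2r ?powR_ge0// ler_norm.
rewrite ler_wpM2l//; apply: ge0_ler_powR.
- exact: ltW.
- by rewrite nnegrE enorm_ge0.
- by rewrite nnegrE addr_ge0 ?enorm_ge0//; lra.
- rewrite /D; apply: (le_trans (enormD _ _)); rewrite enormN lerD2r//.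
Qed.

(** Lower the exponent at distances below 1; use the sup norm at the others. *)
Lemma holder_c0_lower (eta : R) : 0 < eta <= delta -> exists2 K : R, 0 < K &
  forall x y, Normc.normc (phi x - phi y) <= K * enorm (x - y) `^ eta.
Proof.
move=> /andP[e0 ed]; have [B B0 HB] := holder_c0_bounded; have [_ [K HK]] := Hphi.
exists (`|K| + 2 * B); first by rewrite ltr_wpDl// mulr_gt0.
move=> x y; have [r1|r1] := leP (enorm (x - y)) 1.
  apply: le_trans (HK x y) _.
  have [r0|r0] := eqVneq (enorm (x - y)) 0.
    rewrite r0 powR0 ?powR0 ?mulr0// ?gt_eqF//.
    exact: lt_le_trans e0 ed.
  have re : enorm (x - y) `^ delta <= enorm (x - y) `^ eta.
    by apply: ger_powR => //; rewrite lt_neqAle eq_sym r0 enorm_ge0.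
  apply: (@le_trans _ _ (`|K| * enorm (x - y) `^ eta)).
    apply: (@le_trans _ _ (`|K| * enorm (x - y) `^ delta)).
      by rewrite ler_wpM2r ?powR_ge0// ler_norm.
    by rewrite ler_wpM2l.
  by rewrite ler_wpM2r ?powR_ge0// lerDl mulr_ge0// ltW.
apply: (le_trans (normc_triB _ _)).
have p1 : 1 <= enorm (x - y) `^ eta.
  apply: (@le_trans _ _ (1 `^ eta)); first by rewrite powR1.
  by apply: ge0_ler_powR; rewrite ?nnegrE ?(ltW e0) ?(ltW r1)// enorm_ge0.
have Hx := HB x; have Hy := HB y; have K0 := normr_ge0 K.
have : (`|K| + 2 * B) * 1 <= (`|K| + 2 * B) * enorm (x - y) `^ eta.
  by rewrite ler_wpM2l// addr_ge0// mulr_ge0// ltW.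
by move: (_ `^ _) => p; lra.
Qed.

End holder_functions.

(** * A kernel tested on a smooth function *)

Section kernel_estimates.
Context {R : realType} {n : nat}.
Local Notation V := 'rV[R]_n.
Local Notation mu := (@lebesgue_rV R n).
Implicit Types (x y z : V) (s S t : R) (F : V -> R[i]).

(** [Phi] at the frequency k is this dilate with t = 2 ^ k ([PhiE]). *)
Definition dil t s z : R := t ^+ n * wgt s (t *: z).

Lemma dil_ge0 t s z : 0 <= t -> 0 <= dil t s z.
Proof. by move=> t0; rewrite mulr_ge0 ?exprn_ge0// ltW// wgt_gt0. Qed.

Lemma measurable_dil t s : measurable_fun setT (dil t s).
Proof.
apply: measurable_funM => //; apply: (measurable_scale t (f := wgt s)).
exact: measurable_wgt.
Qed.

Lemma measurable_dil_reflect t s x : measurable_fun setT (fun y : V => dil t s (x - y)).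
Proof. by apply: measurable_reflect; exact: measurable_dil. Qed.

Lemma integral_dil s (I : R) : (\int[mu]_x (wgt s x)%:E <= I%:E)%E ->
  forall t, 0 < t -> (\int[mu]_z (dil t s z)%:E <= I%:E)%E.
Proof.
move=> HI t t0; rewrite ge0_intZ ?exprn_ge0 ?(ltW t0)//; last 2 first.
- by apply: (measurable_scale t (f := wgt s)); exact: measurable_wgt.
- by move=> z; rewrite ltW// wgt_gt0.
rewrite (ge0_integral_scale (f := wgt s))//; last first.
- by move=> z; rewrite ltW// wgt_gt0.
- exact: measurable_wgt.
by rewrite muleA -EFinM mulfV ?mul1e// expf_neq0// gt_eqF.
Qed.

Lemma integral_dil_reflect s (I : R) : (\int[mu]_x (wgt s x)%:E <= I%:E)%E ->
  forall t x, 0 < t -> (\int[mu]_y (dil t s (x - y)%R)%:E <= I%:E)%E.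
Proof.
move=> HI t x t0; rewrite (ge0_integral_reflect x (f := dil t s)).
- exact: integral_dil.
- exact: measurable_dil.
- by move=> z; rewrite dil_ge0// ltW.
Qed.

Lemma wgt_le s S z : s <= S -> wgt S z <= wgt s z.
Proof.
move=> sS; rewrite lef_pV2 ?posrE ?powR_gt0 ?ltr_pwDl ?enorm_ge0//.
by apply: ler_powR => //; rewrite lerDl enorm_ge0.
Qed.

(** Spending S - s units of decay on a power of the distance gains the same power
    of 1 / t. *)
Lemma dilM_powR t s S z : 0 < t -> s < S ->
  dil t S z * enorm z `^ (S - s) <= t `^ (- (S - s)) * dil t s z.
Proof.
move=> t0 sS; rewrite /dil -[leLHS]mulrA [leRHS]mulrCA ler_wpM2l ?exprn_ge0 ?(ltW t0)//.
have := wgtM_powR (t *: z) sS; rewrite enormZ gtr0_norm// powRM ?enorm_ge0 ?(ltW t0)//.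
move=> H; have p0 : 0 < t `^ (S - s) by rewrite powR_gt0.
rewrite powRN ler_pdivlMl//; apply: le_trans H.
by rewrite mulrCA.
Qed.

(** Away from the origin the decay s >= n absorbs the factor t ^ n. *)
Lemma dil_far t s x z : 1 <= t -> n%:R <= s -> 2 <= enorm x -> enorm x / 2 <= enorm z ->
  dil t s z <= 3 `^ s * wgt s x.
Proof.
move=> t1 ns x2 xz; have t0 : 0 < t by apply: lt_le_trans t1.
have s0 : 0 <= s by apply: le_trans ns.
rewrite /dil /wgt enormZ gtr0_norm//.
set a := 1 + enorm x; set q := 1 + t * enorm z.
have a0 : 0 < a by rewrite /a; lra.
have q0 : 0 < q by rewrite /q ltr_pwDl// mulr_ge0 ?(ltW t0)// enorm_ge0.
have H : (t * a) `^ s <= (3 * q) `^ s.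
  apply: ge0_ler_powR => //; rewrite ?nnegrE ?mulr_ge0 ?(ltW a0) ?(ltW q0) ?(ltW t0)//.
  apply: (@le_trans _ _ (3 * (t * enorm z))); last by rewrite ler_pM2l// /q lerDr.
  rewrite mulrCA ler_pM2l// /a; lra.
rewrite powRM ?(ltW a0) ?(ltW t0)// in H; rewrite powRM ?(ltW q0)// in H.
have tn : t ^+ n <= t `^ s by rewrite -powR_mulrn ?(ltW t0)//; exact: ler_powR.
have as0 : 0 < a `^ s by rewrite powR_gt0.
rewrite ler_pdivrMr ?powR_gt0// mulrAC ler_pdivlMr//; apply: le_trans H.
by rewrite ler_pM2r.
Qed.

(** At scales 1 / t >= 1, a translation of length at most rho only costs a constant. *)
Lemma dil_near t s x y (rho : R) : 0 < t -> t <= 1 -> 0 <= s -> 0 <= rho ->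
  enorm y <= rho ->
  dil t s (x - y) <= (1 + rho) `^ s * dil t s x.
Proof.
move=> t0 t1 s0 r0 yr; rewrite /dil mulrCA ler_wpM2l ?exprn_ge0 ?(ltW t0)//.
rewrite /wgt !enormZ gtr0_norm//.
set a := 1 + t * enorm x; set q := 1 + t * enorm (x - y).
have a0 : 0 < a by rewrite /a ltr_pwDl// mulr_ge0 ?(ltW t0)// enorm_ge0.
have q0 : 0 < q by rewrite /q ltr_pwDl// mulr_ge0 ?(ltW t0)// enorm_ge0.
have H : a `^ s <= ((1 + rho) * q) `^ s.
  apply: ge0_ler_powR => //; rewrite ?nnegrE ?mulr_ge0 ?(ltW a0) ?(ltW q0)//.
    by rewrite addr_ge0.
  have := enorm_triD x y; rewrite /a /q.
  have w0 := enorm_ge0 (x - y); have := enorm_ge0 y.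
  move: (enorm x) (enorm (x - y)) w0 (enorm y) yr => u w w0 v vr v0 uw.
  have h1 : t * u <= t * (w + v) by rewrite ler_pM2l.
  have h2 : t * v <= rho by apply: le_trans vr; rewrite ler_piMl//; lra.
  have h3 : 0 <= rho * (t * w) by rewrite !mulr_ge0// ltW.
  by lra.
rewrite powRM ?(ltW q0) ?addr_ge0// in H.
by rewrite ler_pdivlMr ?powR_gt0// mulrC ler_pdivrMr ?powR_gt0.
Qed.

Variables (eta s S gam A Bb Bp K rho : R) (bb phi : V -> R[i]).
Hypotheses (eta0 : 0 < eta) (ns : n%:R < s) (SE : S = s + eta).
Hypotheses (etag : eta <= gam) (gam1 : gam <= 1).
Hypotheses (A0 : 0 < A) (Bb0 : 0 <= Bb) (Bp0 : 0 < Bp) (K0 : 0 < K) (rho1 : 1 <= rho).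
Hypotheses (mbb : cmeas bb) (bbB : forall x, Normc.normc (bb x) <= Bb).
Hypotheses (mphi : cmeas phi) (phiB : forall x, Normc.normc (phi x) <= Bp).
Hypothesis phirho : forall x, rho < enorm x -> phi x = 0.
Hypothesis phiK : forall x y, Normc.normc (phi x - phi y) <= K * enorm (x - y) `^ eta.

Let s0 : 0 <= s. Proof. by apply: le_trans (ltW ns). Qed.
Let rho0 : 0 < rho. Proof. by apply: lt_le_trans rho1. Qed.
Let sS : s < S. Proof. by rewrite SE ltrDl. Qed.

Lemma cintable_dil F t x (C : R) : 0 < t -> cmeas F ->
  (forall y, Normc.normc (F y) <= C * dil t S (x - y)) -> cintable mu F.
Proof.
move=> t0 mF FA; have [I I0 HI] := wgt_integrable (lt_trans ns sS).
have C0 : 0 <= C.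
  have := le_trans (normc_ge0 _) (FA 0); rewrite pmulr_lge0//.
  by rewrite mulr_gt0 ?exprn_gt0// wgt_gt0.
apply: (cintable_le (M := C * I)) => //.
apply: (@le_trans _ _ (\int[mu]_y (C * dil t S (x - y)%R)%:E)%E).
  by apply: ge0_le_integralT => y; rewrite lee_fin// normc_ge0.
rewrite ge0_intZ//; last 2 first.
- exact: measurable_dil_reflect.
- by move=> y; rewrite dil_ge0// ltW.
rewrite EFinM; apply: lee_wpmul2l; first by rewrite lee_fin.
exact: integral_dil_reflect.
Qed.

Lemma cintable_dilM F w t x (C M : R) : 0 < t -> cmeas F -> cmeas w ->
  (forall y, Normc.normc (F y) <= C * dil t S (x - y)) ->
  (forall y, Normc.normc (w y) <= M) -> cintable mu (fun y => F y * w y).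
Proof.
move=> t0 mF mw FC wM; apply: (cintable_dil (C := C * M) t0) => [|y].
  exact: cmeasM.
by rewrite Normc.normcM mulrAC; apply: ler_pM; rewrite ?normc_ge0.
Qed.

Lemma normc_bb_phi_le y : Normc.normc (bb y * phi y) <= Bb * Bp.
Proof. by rewrite Normc.normcM ler_pM ?normc_ge0. Qed.

Lemma normc_bb_phi y : Normc.normc (bb y * phi y) <= Bb * Bp * \1_(eball rho) y.
Proof.
rewrite Normc.normcM indicE; have [yr|yr] := leP (enorm y) rho.
  by rewrite mem_set// mulr1 ler_pM// normc_ge0.
by rewrite phirho// Normc.normc0 mulr0 !mulr_ge0// ltW.
Qed.

(** As F bb has integral 0, phi y may be replaced by phi y - phi x, which is
    O (|x - y| ^ eta); by [dilM_powR] this is a gain t ^ (- eta). For |x| > 2 rho the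
    value phi x is 0, and the decay in x comes from [dil_far]. *)
Lemma high_frequency_bound : exists2 C : R, 0 < C & forall t F x, 1 <= t -> cmeas F ->
  (forall y, Normc.normc (F y) <= A * dil t S (x - y)) ->
  cintegral mu setT (fun y => F y * bb y) = 0 ->
  Normc.normc (cintegral mu setT (fun y => F y * (bb y * phi y))) <=
    C * t `^ (- eta) * wgt s x.
Proof.
have [I I0 HI] := wgt_integrable ns; have v0 := @vball_ge0 R n.
pose W := A * Bb * K; have W0 : 0 <= W by rewrite !mulr_ge0// ltW.
(* C1 serves for |x| <= 2 rho, C2 for the other points. *)
pose C1 := I * (1 + 2 * rho) `^ s.
pose C2 := 3 `^ s * (rho ^+ n * @vball R n).
have C10 : 0 <= C1 by rewrite mulr_ge0 ?powR_ge0// ltW.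
have C20 : 0 <= C2 by rewrite !mulr_ge0 ?powR_ge0 ?exprn_ge0// ltW.
have [WE C1E C2E] : [/\ W = A * Bb * K, C1 = I * (1 + 2 * rho) `^ s &
  C2 = 3 `^ s * (rho ^+ n * @vball R n)] by [].
clearbody W C1 C2.
exists (2 * W * (C1 + C2) + 1) => [|t F x t1 mF FA Fb0].
  by rewrite ltr_wpDl// mulr_ge0 ?addr_ge0// mulr_ge0.
have t0 : 0 < t by apply: lt_le_trans t1.
have ww := wgt_gt0 s x.
have d0 y : 0 <= dil t S (x - y) by rewrite dil_ge0// ltW.
have ds0 y : 0 <= dil t s (x - y) by rewrite dil_ge0// ltW.
have te0 : 0 < t `^ (- eta) by rewrite powR_gt0.
have iFb : cintable mu (fun y => F y * bb y) := cintable_dilM t0 mF mbb FA bbB.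
have iFbp : cintable mu (fun y => F y * (bb y * phi y)) :=
  cintable_dilM t0 mF (cmeasM mbb mphi) FA normc_bb_phi_le.
have iFbx : cintable mu (fun y => phi x * (F y * bb y)).
  apply: (@cintable_dil _ t x (Bp * (A * Bb))) => // [|y].
    by apply: cmeasM; [exact: cmeas_cst|exact: cmeasM].
  rewrite !Normc.normcM -mulrA; apply: ler_pM; rewrite ?mulr_ge0 ?normc_ge0//.
  by rewrite mulrAC; apply: ler_pM; rewrite ?normc_ge0.
have -> : cintegral mu setT (fun y => F y * (bb y * phi y)) =
    cintegral mu setT (fun y => F y * bb y * (phi y - phi x)).
  transitivity (cintegral mu setT (fun y => F y * (bb y * phi y)) -
                cintegral mu setT (fun y => phi x * (F y * bb y))).
    by rewrite cintegralZ// Fb0 mulr0 subr0.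
  by rewrite -cintegralB//; congr cintegral; apply/funext => y; ring.
have P y : Normc.normc (F y * bb y * (phi y - phi x)) <= W * t `^ (- eta) * dil t s (x - y).
  rewrite !Normc.normcM.
  apply: (@le_trans _ _ (A * dil t S (x - y) * Bb * (K * enorm (y - x) `^ eta))).
    by apply: ler_pM; rewrite ?mulr_ge0 ?normc_ge0//; apply: ler_pM; rewrite ?normc_ge0.
  have := dilM_powR (x - y) t0 sS; rewrite (_ : S - s = eta); last by rewrite SE; ring.
  rewrite (enormBC y x) => H.
  rewrite (_ : _ * _ = W * (dil t S (x - y) * enorm (x - y) `^ eta)); last by rewrite WE; ring.
  by rewrite -mulrA ler_wpM2l.
have key : forall M, (\int[mu]_y (Normc.normc (F y * bb y * (phi y - phi x)))%:E <=
     (W * t `^ (- eta) * (M * wgt s x))%:E)%E -> M <= C1 + C2 ->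
   Normc.normc (cintegral mu setT (fun y => F y * bb y * (phi y - phi x))) <=
    (2 * W * (C1 + C2) + 1) * t `^ (- eta) * wgt s x.
  move=> M HM MC; apply: le_trans (normc_cintegral_le HM) _.
  apply: (@le_trans _ _ (2 * W * (C1 + C2) * t `^ (- eta) * wgt s x)); last first.
    by rewrite ler_pM2r// ler_pM2r// lerDl.
  rewrite (_ : _ * _ = 2 * W * M * t `^ (- eta) * wgt s x); last by ring.
  by rewrite ler_pM2r// ler_pM2r// ler_wpM2l// mulr_ge0.
have [xr|xr] := leP (enorm x) (2 * rho).
  apply: (key C1); last by rewrite lerDl.
  apply: (@le_trans _ _ (\int[mu]_y (W * t `^ (- eta) * dil t s (x - y)%R)%:E)%E).
    by apply: ge0_le_integralT => y; rewrite lee_fin ?normc_ge0.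
  rewrite ge0_intZ ?mulr_ge0 ?powR_ge0//; last exact: measurable_dil_reflect.
  rewrite [X in (_ <= X)%E]EFinM; apply: lee_wpmul2l; first by rewrite lee_fin mulr_ge0// powR_ge0.
  apply: le_trans (integral_dil_reflect HI x t0) _.
  rewrite lee_fin C1E -mulrA ler_peMr ?(ltW I0)//.
  rewrite ler_pdivlMr ?mul1r ?powR_gt0 ?ltr_pwDl ?enorm_ge0//.
  apply: ge0_ler_powR => //; rewrite ?nnegrE ?addr_ge0 ?enorm_ge0 ?mulr_ge0 ?(ltW rho0)//.
  by rewrite lerD2l.
apply: (key C2); last by rewrite lerDr.
have px : phi x = 0.
  by apply: phirho; apply: lt_trans xr; rewrite mulr_natl mulr2n ltrDl.
apply: (@le_trans _ _ (\int[mu]_y (W * t `^ (- eta) * (3 `^ s * wgt s x) * \1_(eball rho) y)%:E)%E).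
  apply: ge0_le_integralT => y; rewrite lee_fin ?normc_ge0//.
  rewrite indicE; have [yr|yr] := leP (enorm y) rho; last first.
    rewrite px phirho// subr0 mulr0 Normc.normc0.
    by rewrite !mulr_ge0// ?powR_ge0 ?(ltW ww).
  rewrite mem_set// mulr1; apply: le_trans (P y) _.
  rewrite ler_wpM2l ?mulr_ge0 ?powR_ge0//; apply: dil_far => //; first exact: ltW.
    by apply: ltW; apply: le_lt_trans xr; rewrite ler_peMr.
  have aux (u r v w : R) : 2 * r < u -> v <= r -> u <= w + v -> u / 2 <= w by lra.
  exact: aux xr yr (enorm_triD x y).
rewrite integral_indic_eball//; last by rewrite !mulr_ge0// ?powR_ge0 ?(ltW ww).
by rewrite lee_fin le_eqVlt; apply/orP; left; apply/eqP; rewrite C2E; ring.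
Qed.

(** As bb phi has integral 0, F y may be replaced by F y - c, where c stands for the
    value of the kernel at y = 0, so that the difference is O ((t |y|) ^ gam) on the
    support of phi. *)
Lemma low_frequency_bound : cintegral mu setT (fun y => bb y * phi y) = 0 ->
  exists2 C : R, 0 < C & forall t F (c : R[i]) x, 0 < t -> t <= 1 -> cmeas F ->
  (forall y, Normc.normc (F y) <= A * dil t S (x - y)) ->
  {ae mu, forall y, Normc.normc (F y - c) <=
     A * (t * enorm y) `^ gam * (dil t S (x - y) + dil t S x)} ->
  Normc.normc (cintegral mu setT (fun y => F y * (bb y * phi y))) <=
    C * t `^ eta * dil t s x.
Proof.
move=> bp0; have v0 := @vball_ge0 R n.
pose C1 := A * rho * (2 * (1 + rho) `^ s) * (Bb * Bp) * (rho ^+ n * @vball R n).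
have C10 : 0 <= C1 by rewrite !mulr_ge0 ?powR_ge0 ?exprn_ge0 ?(ltW A0) ?(ltW rho0) ?(ltW Bp0).
have C1E : C1 = A * rho * (2 * (1 + rho) `^ s) * (Bb * Bp) * (rho ^+ n * @vball R n) by [].
clearbody C1.
exists (2 * C1 + 1) => [|t F c x t0 t1 mF FA Fc]; first by rewrite ltr_wpDl// mulr_ge0.
have te0 : 0 <= t `^ eta by rewrite powR_ge0.
have dx0 : 0 <= dil t s x by rewrite dil_ge0// ltW.
have ibp : cintable mu (fun y => bb y * phi y).
  apply: (cintable_le (M := Bb * Bp * (rho ^+ n * @vball R n))); first exact: cmeasM.
  rewrite -integral_indic_eball ?mulr_ge0 ?(ltW Bp0)//.
  apply: ge0_le_integralT => y; rewrite lee_fin ?normc_ge0//.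
  exact: normc_bb_phi.
have iFbp : cintable mu (fun y => F y * (bb y * phi y)) :=
  cintable_dilM t0 mF (cmeasM mbb mphi) FA normc_bb_phi_le.
have icbp : cintable mu (fun y => c * (bb y * phi y)).
  apply: (cintable_le (M := Normc.normc c * (Bb * Bp) * (rho ^+ n * @vball R n))).
    by apply: cmeasM; [exact: cmeas_cst|exact: cmeasM].
  rewrite -integral_indic_eball ?mulr_ge0 ?(ltW Bp0) ?normc_ge0//.
  apply: ge0_le_integralT => y; rewrite lee_fin ?normc_ge0//.
  by rewrite Normc.normcM -[leRHS]mulrA ler_wpM2l ?normc_ge0// normc_bb_phi.
have -> : cintegral mu setT (fun y => F y * (bb y * phi y)) =
    cintegral mu setT (fun y => (F y - c) * (bb y * phi y)).
  transitivity (cintegral mu setT (fun y => F y * (bb y * phi y)) -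
                cintegral mu setT (fun y => c * (bb y * phi y))).
    by rewrite cintegralZ// bp0 mulr0 subr0.
  by rewrite -cintegralB//; congr cintegral; apply/funext => y; ring.
have H : (\int[mu]_y (Normc.normc ((F y - c) * (bb y * phi y)))%:E <=
    (C1 * t `^ eta * dil t s x)%:E)%E.
  pose D := A * (t `^ eta * rho) * (2 * ((1 + rho) `^ s * dil t s x)).
  have D0 : 0 <= D.
    by apply: mulr_ge0; rewrite mulr_ge0 ?(ltW A0)// mulr_ge0 ?powR_ge0// ltW.
  have DE : D = A * (t `^ eta * rho) * (2 * ((1 + rho) `^ s * dil t s x)) by [].
  clearbody D.
  rewrite (_ : C1 * _ * _ = D * (Bb * Bp) * (rho ^+ n * @vball R n)); last by rewrite C1E DE; ring.
  rewrite -integral_indic_eball ?mulr_ge0 ?(ltW Bp0)//.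
  apply: ge0_ae_le_integral => [y|y|].
  - by rewrite lee_fin normc_ge0.
  - by rewrite lee_fin mulr_ge0// mulr_ge0// mulr_ge0// ltW.
  apply: filterS Fc => y Fcy; rewrite lee_fin indicE.
  have [yr|yr] := leP (enorm y) rho; last first.
    by rewrite phirho// !mulr0 Normc.normc0 mulr_ge0// mulr_ge0// mulr_ge0// ltW.
  rewrite mem_set// mulr1 Normc.normcM.
  have B1 := normc_bb_phi y; rewrite indicE mem_set// mulr1 in B1.
  apply: ler_pM; rewrite ?normc_ge0//; apply: le_trans Fcy _; rewrite DE.
  have dS0 z : 0 <= dil t S z by rewrite dil_ge0// ltW.
  have dSs z : dil t S z <= dil t s z.
    by rewrite ler_wpM2l ?exprn_ge0 ?(ltW t0)// wgt_le// ltW.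
  have r1s : 1 <= (1 + rho) `^ s.
    rewrite -[leLHS](powRr0 (1 + rho)); apply: ler_powR => //.
    by rewrite lerDl ltW.
  apply: ler_pM.
  - by rewrite mulr_ge0 ?powR_ge0 ?(ltW A0).
  - by apply: addr_ge0; exact: dS0.
  - rewrite ler_pM2l// powRM ?enorm_ge0 ?(ltW t0)//.
    apply: ler_pM; rewrite ?powR_ge0//.
      by apply: ger_powR => //; rewrite t0.
    apply: (@le_trans _ _ (rho `^ gam)).
      apply: ge0_ler_powR; rewrite ?nnegrE ?enorm_ge0 ?(ltW rho0)//.
      by apply: le_trans etag; exact: ltW.
    rewrite -[leRHS](powRr1 (ltW rho0)); exact: ler_powR.
  - rewrite mulr_natl mulr2n; apply: lerD.
      by apply: le_trans (dSs _) _; apply: dil_near => //; exact: ltW.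
    by apply: le_trans (dSs _) _; rewrite ler_peMl.
apply: le_trans (normc_cintegral_le H) _.
rewrite (_ : 2 * _ = 2 * C1 * t `^ eta * dil t s x); last by ring.
by rewrite ler_wpM2r// ler_wpM2r// lerDl.
Qed.

Lemma dilC t s' x y : dil t s' (x - y) = dil t s' (y - x).
Proof. by rewrite /dil /wgt !enormZ enormBC. Qed.

Lemma adjoint_mean0 t (G : V * V -> R[i]) : 0 < t -> cmeas G ->
  (forall x y, Normc.normc (G (x, y)) <= A * dil t S (x - y)) ->
  {ae mu, forall y, cintegral mu setT (fun x => G (x, y) * bb x) = 0} ->
  cintegral mu setT (fun x => bb x * cintegral mu setT (fun y => G (x, y) * (bb y * phi y))) = 0.
Proof.
move=> t0 mG GA G0; have [I I0 HI] := wgt_integrable (lt_trans ns sS).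
have v0 := @vball_ge0 R n.
have d0 z : 0 <= dil t S z by rewrite dil_ge0// ltW.
pose H (z : V * V) := bb z.1 * (G z * (bb z.2 * phi z.2)).
have mfst (f : V -> R[i]) : cmeas f -> cmeas (fun z : V * V => f z.1).
  by move=> [fr fi]; split; [exact: (measurable_comp_fst fr)|exact: (measurable_comp_fst fi)].
have msnd (f : V -> R[i]) : cmeas f -> cmeas (fun z : V * V => f z.2).
  by move=> [fr fi]; split; [exact: (measurable_comp_snd fr)|exact: (measurable_comp_snd fi)].
have mH : cmeas H.
  apply: cmeasM; first exact: mfst.
  by apply: cmeasM => //; apply: cmeasM; exact: msnd.
have HA x y : Normc.normc (H (x, y)) <= Bb * A * (Bb * Bp * \1_(eball rho) y) * dil t S (x - y).
  rewrite /H /= !Normc.normcM -Normc.normcM.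
  apply: (@le_trans _ _ (Bb * (A * dil t S (x - y) * (Bb * Bp * \1_(eball rho) y)))).
    apply: ler_pM; rewrite ?mulr_ge0 ?normc_ge0//.
    by apply: ler_pM; rewrite ?normc_ge0// normc_bb_phi.
  by rewrite le_eqVlt; apply/orP; left; apply/eqP; ring.
have i1 y : 0 <= (\1_(eball rho) y : R) <= 1 by rewrite indicE; case: (_ \in _); rewrite ler01 lexx.
have c0 y : 0 <= Bb * A * (Bb * Bp * \1_(eball rho) y).
  by rewrite !mulr_ge0 ?(ltW A0) ?(ltW Bp0)//; case/andP: (i1 y).
have HA1 x y : Normc.normc (H (x, y)) <= Bb * A * (Bb * Bp) * dil t S (x - y).
  apply: le_trans (HA x y) _; apply: ler_wpM2r => //.
  rewrite ler_wpM2l ?mulr_ge0 ?(ltW A0)// ler_piMr ?mulr_ge0 ?(ltW Bp0)//.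
have iGx x : cintable mu (fun y => G (x, y) * (bb y * phi y)) :=
  cintable_dilM t0 (cmeas_xsection x mG) (cmeasM mbb mphi) (GA x) normc_bb_phi_le.
have GAy y x : Normc.normc (G (x, y)) <= A * dil t S (y - x) by rewrite dilC; exact: GA.
have iGy y : cintable mu (fun x => G (x, y) * bb x) :=
  cintable_dilM t0 (cmeas_ysection y mG) mbb (GAy y) bbB.
have -> : cintegral mu setT (fun x => bb x * cintegral mu setT (fun y => G (x, y) * (bb y * phi y)))
    = cintegral mu setT (fun x => cintegral mu setT (fun y => H (x, y))).
  by congr cintegral; apply/funext => x; rewrite -cintegralZ.
rewrite cFubini//; last 3 first.
- apply: (@le_lt_trans _ _ (\int[mu]_y (Bb * A * (Bb * Bp) * I * \1_(eball rho) y)%:E)%E).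
    apply: ge0_le_integralT => y.
      by apply: integral_ge0 => x _; rewrite lee_fin normc_ge0.
    apply: (@le_trans _ _ (\int[mu]_x
        (Bb * A * (Bb * Bp * \1_(eball rho) y) * dil t S (x - y)%R)%:E)%E).
      by apply: ge0_le_integralT => x; rewrite lee_fin ?normc_ge0.
    rewrite ge0_intZ; last 3 first.
    - exact: c0.
    - by apply: measurable_shift; exact: measurable_dil.
    - by move=> x; exact: d0.
    rewrite (ge0_integral_shift y (f := dil t S))//; last exact: measurable_dil.
    rewrite (_ : Bb * A * (Bb * Bp) * I * _ =
      Bb * A * (Bb * Bp * \1_(eball rho) y) * I); last by ring.
    rewrite [X in (_ <= X)%E]EFinM; apply: lee_wpmul2l; last exact: integral_dil.
    by rewrite lee_fin; exact: c0.
  have e0 : 0 <= Bb * A * (Bb * Bp) * I by rewrite !mulr_ge0// ltW.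
  by rewrite (integral_indic_eball e0 rho0) ltry.
- move=> x; exact: (cintable_dil t0 (cmeas_xsection x mH) (HA1 x)).
- move=> y; apply: (cintable_dil t0 (cmeas_ysection y mH) (x := y) (C := Bb * A * (Bb * Bp))).
  by move=> x; rewrite [dil t S (y - x)]dilC; exact: HA1.
rewrite (@ae_cintegral _ _ _ _ _ (fun=> 0)); last first.
  apply: filterS G0 => y Gy0.
  transitivity (bb y * phi y * cintegral mu setT (fun x => G (x, y) * bb x)); last first.
    by rewrite Gy0 mulr0.
  by rewrite -cintegralZ//; congr cintegral; apply/funext => x; rewrite /H/=; ring.
by rewrite /cintegral /Rintegral !integral0.
Qed.

End kernel_estimates.

(** * The terms of the series are molecules *)

Section square_function_molecules.
Context {R : realType} {n : nat}.
Local Notation V := 'rV[R]_n.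
Local Notation mu := (@lebesgue_rV R n).

Lemma PhiE (S : R) (k : int) (x : V) : Phi S k x = dil (2 ^ k) S x.
Proof.
have t0 : (0 : R) < 2 ^ k by rewrite exprz_gt0.
by rewrite /Phi /dil /wgt enormZ gtr0_norm// -exprz_exp.
Qed.

(** For k >= 0 the high frequency bound gives a molecule of scale 1, for k < 0 the low
    frequency bound gives one of scale 2 ^ (- k). Both are applied, for almost every
    x, to the section at x of a Borel representative G of the kernel, and g is a Borel
    representative of the resulting function. Its mean is 0 by [adjoint_mean0]. *)
Lemma theta_molecules (delta : R) (b : V -> R[i]) (theta : int -> V -> V -> R[i])
    (phi : V -> R[i]) :
  (0 < n)%N -> 0 < delta <= 1 -> in_Lp mu +oo%E b -> square_function_kernels theta ->
  (forall k : int, {ae mu, forall x, Theta theta k b x = 0}) ->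
  (forall k : int, {ae mu, forall x, Theta_adj theta k b x = 0}) ->
  holder_c0 delta phi -> mean_zero (mulop b phi) ->
  exists C q s : R, [/\ 0 < C, 0 < q < 1, n%:R < s &
    forall k : int, exists (g : V -> R[i]) (r : R), [/\ 1 <= r, cmeas g,
      {ae mu, forall x, mulop b (Theta theta k (mulop b phi)) x = g x},
      forall x, Normc.normc (g x) <= C * q ^+ `|k|%N * (r ^- n * wgt s (r^-1 *: x)) &
      cintegral mu setT g = 0]].
Proof.
move=> n0 d01 Hb [mtheta [A [N [gam [A0 nN /andP[gam0 gam1] size smooth]]]]] Tb Tab Hphi bphi0.
have [bb [Bb [Bb0 mbb bE bbB]]] := Lpinfty_representative Hb.
have mphi := holder_c0_cmeas d01 Hphi.
have [rho rho1 phirho] := holder_c0_support Hphi.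
have [Bp Bp0 phiB] := holder_c0_bounded n0 d01 Hphi.
pose eta := Num.min delta gam.
have /andP[dl0 dl1] := d01.
have eta0 : 0 < eta by rewrite lt_min dl0.
have etag : eta <= gam by rewrite ge_min lexx orbT.
have [K K0 phiK] : exists2 K : R, 0 < K &
  forall x y, Normc.normc (phi x - phi y) <= K * enorm (x - y) `^ eta.
  by apply: (holder_c0_lower n0 d01 Hphi); rewrite eta0 ge_min lexx.
(* As eta <= gam, the decay s that is left is at least N, hence exceeds n. *)
pose S := N + gam; pose s := S - eta.
have SE : S = s + eta by rewrite /s subrK.
have ns : n%:R < s by rewrite /s /S; lra.
clearbody eta s.
have bp0 : cintegral mu setT (fun y => bb y * phi y) = 0.
  rewrite -[RHS]bphi0; apply: ae_cintegral; apply: filterS bE => y by_.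
  by rewrite /mulop by_.
have [C1 C10 H1] := @high_frequency_bound R n eta s S A Bb Bp K rho bb phi
  eta0 ns SE A0 Bb0 K0 rho1 mbb bbB mphi phiB phirho phiK.
have [C2 C20 H2] := @low_frequency_bound R n eta s S gam A Bb Bp rho bb phi
  eta0 ns SE etag gam1 A0 Bb0 Bp0 rho1 mbb bbB mphi phiB phirho bp0.
pose q : R := 2^-1 `^ eta.
have q0 : 0 < q by rewrite powR_gt0.
have q1 : q < 1.
  apply: (@lt_le_trans _ _ (1 `^ eta)); last by rewrite powR1.
  by apply: gt0_ltr_powR; rewrite ?nnegrE// invf_lt1// ltr1n.
have qV : (2 `^ eta)^-1 = q.
  have p2 : (2 : R) `^ eta != 0 by rewrite gt_eqF// powR_gt0.
  apply: (mulfI p2); rewrite mulfV// /q -powRM// mulfV ?powR1//.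
pose C := Bb * (C1 + C2) + 1.
exists C, q, s; split => //; first by rewrite /C ltr_wpDl// mulr_ge0// addr_ge0// ltW.
  by rewrite q0.
move=> k; pose t : R := 2 ^ k; have t0 : 0 < t by rewrite exprz_gt0.
have [G [mG GE GA]] : exists G : V * V -> R[i], [/\ cmeas G,
    {ae (mu \x mu)%E, forall z, theta k z.1 z.2 = G z} &
    forall z, Normc.normc (G z) <= A * dil t S (z.1 - z.2)].
  apply: bounded_representative => //.
  - apply: measurable_funM => //.
    apply: (measurable_sub_comp (f := dil t S)); exact: measurable_dil.
  - by move=> z; rewrite mulr_ge0 ?(ltW A0)// dil_ge0// ltW.
  - by apply: aeW => z; rewrite -PhiE; exact: size.
have GA' x y : Normc.normc (G (x, y)) <= A * dil t S (x - y) by exact: GA.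
pose I x := cintegral mu setT (fun y => G (x, y) * (bb y * phi y)).
have mI : cmeas I.
  apply: (@cmeas_cintegral _ _ _ _ R mu (fun z : V * V => G z * (bb z.2 * phi z.2))).
  apply: cmeasM => //; case: mbb mphi => [br bi] [pr pi]; apply: cmeasM.
    by split; [exact: (measurable_comp_snd br)|exact: (measurable_comp_snd bi)].
  by split; [exact: (measurable_comp_snd pr)|exact: (measurable_comp_snd pi)].
pose g0 x := bb x * I x.
have g0E : {ae mu, forall x, mulop b (Theta theta k (mulop b phi)) x = g0 x}.
  apply: filterS2 (bE) (ae_xsection GE) => x bx Gx.
  rewrite /mulop /g0 bx; congr (_ * _); apply: ae_cintegral.
  by apply: filterS2 (bE) Gx => y <- <-.
have Gb0 : {ae mu, forall x, cintegral mu setT (fun y => G (x, y) * bb y) = 0}.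
  apply: filterS2 (ae_xsection GE) (Tb k) => x Gx <-; apply: ae_cintegral.
  by apply: filterS2 (bE) Gx => y <- <-.
have Ga0 : {ae mu, forall y, cintegral mu setT (fun x => G (x, y) * bb x) = 0}.
  apply: filterS2 (ae_ysection GE) (Tab k) => x Gx <-; apply: ae_cintegral.
  by apply: filterS2 (bE) Gx => y <- <-.
have g0m : cintegral mu setT g0 = 0.
  exact: (adjoint_mean0 eta0 ns SE A0 Bb0 Bp0 rho1 mbb bbB mphi phiB phirho t0 mG GA' Ga0).
have [r r1 g0B] : exists2 r : R, 1 <= r & {ae mu, forall x, Normc.normc (g0 x) <=
    C * q ^+ `|k|%N * (r ^- n * wgt s (r^-1 *: x))}.
  have Cge (w : R) : 0 <= w -> forall c, 0 <= c -> c <= C1 + C2 -> forall z : R[i],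
    Normc.normc z <= c * w -> forall x, Normc.normc (bb x * z) <= C * w.
    move=> w0 c c0 cC z zw x; rewrite Normc.normcM.
    apply: (@le_trans _ _ (Bb * (c * w))); first by rewrite ler_pM ?normc_ge0.
    rewrite mulrA ler_wpM2r// /C ler_wpDr// ler_wpM2l//.
  have [[t1 tq]|[t1 tq]] : 1 <= t /\ t `^ (- eta) = q ^+ `|k|%N \/
                           t <= 1 /\ t `^ eta = q ^+ `|k|%N.
    rewrite /t; case: (k) => m; [left|right].
      split; first by rewrite -exprnP exprn_ege1// ler1n.
      by rewrite powRN -exprnP powR_exprn// -exprVn qV.
    rewrite -[2 ^ Negz m]/(2 ^- m.+1) -exprVn; split; last by rewrite powR_exprn.
    by rewrite exprn_ile1// invf_le1// ler1n.
  - exists 1 => //; apply: filterS Gb0 => x Gx0.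
    rewrite expr1n invr1 mul1r scale1r -[leRHS]mulrA.
    apply: (Cge _ _ C1) => //; rewrite ?(ltW C10)//.
    + by rewrite mulr_ge0 ?exprn_ge0 ?(ltW q0) ?(ltW (wgt_gt0 _ _)).
    + by rewrite lerDl ltW.
    + by rewrite -tq mulrA; apply: H1 => //; exact: cmeas_xsection.
  - exists t^-1; first by rewrite invf_ge1.
    apply: filterS (ae_xsection GE) => x Gx.
    rewrite invrK exprVn invrK -[t ^+ n * _]/(dil t s x) -[leRHS]mulrA.
    apply: (Cge _ _ C2) => //; rewrite ?(ltW C20)//.
    + by rewrite mulr_ge0 ?exprn_ge0 ?(ltW q0)// dil_ge0// ltW.
    + by rewrite lerDr ltW.
    + rewrite -tq mulrA; apply: (H2 _ _ (theta k x 0)) => //; first exact: cmeas_xsection.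
      apply: filterS Gx => y /= <-; have := smooth k x y 0; rewrite !subr0.
      by rewrite !PhiE.
pose M (x : V) := C * q ^+ `|k|%N * (r ^- n * wgt s (r^-1 *: x)).
have r0 : 0 < r by apply: lt_le_trans r1.
have mM : measurable_fun setT M.
  apply: measurable_funM => //; apply: measurable_funM => //.
  by apply: (measurable_scale r^-1 (f := wgt s)); exact: measurable_wgt.
have M0 x : 0 <= M x.
  rewrite /M mulr_ge0//.
    by rewrite mulr_ge0 ?exprn_ge0 ?(ltW q0)// /C addr_ge0// mulr_ge0// addr_ge0// ltW.
  by apply: mulr_ge0; [rewrite invr_ge0 exprn_ge0// ltW|rewrite ltW// wgt_gt0].
have mg0 : ae_measurable mu g0.
  by have [g0r g0i] := cmeasM mbb mI; exists g0; split => //; exact: aeW.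
have [g [mg gE gB]] := bounded_representative mM M0 mg0 g0B.
exists g, r; split => //.
- by apply: filterS2 g0E gE => x -> ->.
- by rewrite -[RHS]g0m; apply: ae_cintegral; apply: filterS gE => x ->.
Qed.

(** A bounded function with compact support lies below every polynomial weight. *)
Lemma smooth_molecule (delta s : R) (b phi : V -> R[i]) :
  (0 < n)%N -> 0 < delta <= 1 -> 0 <= s -> in_Lp mu +oo%E b ->
  holder_c0 delta phi -> mean_zero (mulop b phi) ->
  exists (f : V -> R[i]) (A : R), [/\ 0 < A, cmeas f,
    {ae mu, forall x, mulop b phi x = f x},
    forall x, Normc.normc (f x) <= A * (1 ^- n * wgt s (1^-1 *: x)) &
    cintegral mu setT f = 0].
Proof.
move=> n0 d01 s0 Hb Hphi mphi0.
have [bb [Bb [Bb0 mbb bE bbB]]] := Lpinfty_representative Hb.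
have mphi := holder_c0_cmeas d01 Hphi.
have [rho rho1 phirho] := holder_c0_support Hphi.
have [Bp Bp0 phiB] := holder_c0_bounded n0 d01 Hphi.
pose f x := bb x * phi x.
have fE : {ae mu, forall x, mulop b phi x = f x}.
  by apply: filterS bE => x bx; rewrite /mulop bx.
pose A := Bb * Bp * (1 + rho) `^ s + 1.
have A0 : 0 < A by rewrite ltr_wpDl// !mulr_ge0 ?powR_ge0 ?(ltW Bp0).
exists f, A; split => //; first exact: cmeasM.
- move=> x; rewrite expr1n invr1 mul1r scale1r Normc.normcM.
  have w0 := wgt_gt0 s x.
  have [xr|xr] := leP (enorm x) rho; last first.
    by rewrite phirho// Normc.normc0 mulr0 mulr_ge0 ?(ltW A0) ?(ltW w0).
  apply: (@le_trans _ _ (Bb * Bp)); first by rewrite ler_pM ?normc_ge0.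
  apply: (@le_trans _ _ (Bb * Bp * (1 + rho) `^ s * wgt s x)); last first.
    by rewrite ler_pM2r// lerDl.
  rewrite -mulrA ler_peMr ?mulr_ge0 ?(ltW Bp0)//.
  rewrite ler_pdivlMr ?powR_gt0 ?ltr_pwDl ?enorm_ge0//.
  rewrite mul1r; apply: ge0_ler_powR; rewrite ?nnegrE ?addr_ge0 ?enorm_ge0 ?lerD2l//.
  by apply: le_trans rho1.
- by rewrite -[RHS]mphi0; apply/esym; exact: ae_cintegral.
Qed.

End square_function_molecules.

(** * Two-sided series *)

Section two_sided_series.
Context {R : realType} {n : nat}.
Local Notation V := 'rV[R]_n.
Local Notation mu := (@lebesgue_rV R n).
Implicit Types (x : V) (M N m : nat).

(** The sum over - M <= k <= N, indexed as in [series_cvg]. *)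
Definition psum (W : nmodType) (t : int -> V -> W) M N x : W :=
  \sum_(i < (M + N).+1) t (i%:Z - M%:Z) x.

Lemma psumE (W : nmodType) (t : int -> V -> W) M N x : psum t M N x =
  \sum_(0 <= j < M) t (- j.+1%:Z) x + \sum_(0 <= j < N.+1) t j%:Z x.
Proof.
rewrite /psum -addnS big_split_ord/=; congr (_ + _).
  rewrite (reindex_inj rev_ord_inj)/= [RHS]big_mkord; apply: eq_bigr => j _.
  congr (t _ x); rewrite -subzn; last by case: j.
  by rewrite addrAC subrr add0r.
rewrite [RHS]big_mkord; apply: eq_bigr => j _.
by congr (t _ x); rewrite PoszD addrAC subrr add0r.
Qed.

Lemma psum_diff (t : int -> V -> R) M N m x : (M <= m)%N -> (N <= m)%N ->
  psum t m m x - psum t M N x =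
  \sum_(M <= j < m) t (- j.+1%:Z) x + \sum_(N.+1 <= j < m.+1) t j%:Z x.
Proof.
move=> Mm Nm; rewrite !psumE (@big_cat_nat _ _ _ M 0 m)//= (@big_cat_nat _ _ _ N.+1 0 m.+1)//=.
set a := \sum_(0 <= i < M) _; set b := \sum_(0 <= i < N.+1) _; ring.
Qed.

Lemma L1_sum (I : Type) (s : seq I) (t : I -> V -> R) (c : I -> R) :
  (forall i, measurable_fun setT (t i)) ->
  (forall i, (\int[mu]_x `|t i x|%:E <= (c i)%:E)%E) ->
  (\int[mu]_x `|\sum_(i <- s) t i x|%:E <= (\sum_(i <- s) c i)%:E)%E.
Proof.
move=> mt tc; elim: s => [|i s IH].
  under eq_integral do rewrite big_nil normr0.
  by rewrite integral0 big_nil.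
rewrite big_cons EFinD; apply: le_trans (leeD (tc i) IH).
rewrite -ge0_intD//; last 2 first.
- exact: measurableT_comp.
- by apply: measurableT_comp => //; apply: measurable_sum.
apply: ge0_le_integralT => x; rewrite lee_fin//.
by rewrite big_cons ler_normD.
Qed.

Lemma geometric_tail (q : R) M m : 0 < q < 1 ->
  \sum_(M <= j < m) q ^+ j <= q ^+ M / (1 - q).
Proof.
move=> /andP[q0 q1]; have [mM|Mm] := leqP m M.
  by rewrite big_geq// divr_ge0 ?exprn_ge0 ?subr_ge0// ltW.
rewrite -[X in \sum_(X <= _ < _) _]add0n big_addn big_mkord.
under eq_bigr do rewrite exprD mulrC.
rewrite -mulr_sumr ler_wpM2l ?exprn_ge0 ?(ltW q0)//.
by apply: geom_sum_le; rewrite (ltW q0).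
Qed.

Lemma psum_tail_L1 (t : int -> V -> R) (c q : R) M N m : 0 <= c -> 0 < q < 1 ->
  (forall k, measurable_fun setT (t k)) ->
  (forall k, (\int[mu]_x `|t k x|%:E <= (c * q ^+ `|k|%N)%:E)%E) ->
  (M <= m)%N -> (N <= m)%N ->
  (\int[mu]_x `|psum t m m x - psum t M N x|%:E <=
   (c / (1 - q) * (q ^+ M + q ^+ N))%:E)%E.
Proof.
move=> c0 q01 mt tc Mm Nm; have /andP[q0 q1] := q01.
apply: (@le_trans _ _ (\int[mu]_x (`|\sum_(M <= j < m) t (- j.+1%:Z) x| +
    `|\sum_(N.+1 <= j < m.+1) t j%:Z x|)%:E)%E).
  by apply: ge0_le_integralT => x; rewrite lee_fin// psum_diff// ler_normD.
rewrite ge0_intD//; [|by apply: measurableT_comp => //; apply: measurable_sum..].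
have H1 : (\int[mu]_x `|\sum_(M <= j < m) t (- j.+1%:Z) x|%:E <=
    (\sum_(M <= j < m) c * q ^+ j.+1)%:E)%E.
  apply: (@L1_sum _ _ (fun j : nat => t (- j.+1%:Z)) (fun j => c * q ^+ j.+1)) => // j.
have H2 : (\int[mu]_x `|\sum_(N.+1 <= j < m.+1) t j%:Z x|%:E <=
    (\sum_(N.+1 <= j < m.+1) c * q ^+ j)%:E)%E.
  by apply: (@L1_sum _ _ (fun j : nat => t j%:Z) (fun j => c * q ^+ j)) => // j; exact: (tc j%:Z).
apply: le_trans (leeD H1 H2) _.
rewrite -EFinD lee_fin -!mulr_sumr mulrDr; apply: lerD; rewrite -mulrA ler_wpM2l// mulrC.
- apply: le_trans _ (geometric_tail M m q01).
  apply: ler_sum => j _; rewrite exprS ler_piMl ?exprn_ge0 ?ltW//.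
- apply: le_trans (geometric_tail _ _ q01) _; rewrite ler_wpM2r ?invr_ge0 ?subr_ge0 ?(ltW q1)//.
  by rewrite exprS ler_piMl ?exprn_ge0 ?ltW.
Qed.

Lemma psum_cvg (t : int -> V -> R) (c q : R) x : 0 <= c -> 0 < q < 1 ->
  (forall k, `|t k x| <= c * q ^+ `|k|%N) -> cvg ((fun m => psum t m m x) @ \oo).
Proof.
move=> c0 /andP[q0 q1] tc.
have H (u : nat -> R) : (forall j, `|u j| <= c * q ^+ j) -> cvgn (series u).
  move=> uc; apply: normed_cvg.
  apply: (@series_le_cvg R (fun j => `|u j|) (geometric c q)) => //; last first.
    by apply: is_cvg_geometric_series; rewrite ger0_norm// ltW.
  by move=> j; rewrite /geometric/= mulr_ge0// exprn_ge0// ltW.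
have H1 : cvgn (series (fun j => t (- j.+1%:Z) x)).
  apply: H => j; apply: le_trans (tc _) _; rewrite abszN ler_wpM2l//= exprS.
  by rewrite ler_piMl ?exprn_ge0 ?ltW.
have H2 : cvgn (series (fun j => t j%:Z x)) by apply: H => j; exact: tc.
rewrite (_ : (fun m => _) = (series (fun j => t (- j.+1%:Z) x)) \+
   (fun m => series (fun j => t j%:Z x) m.+1)); last first.
  by apply/funext => m; rewrite psumE.
apply: is_cvgD => //; have /cvg_ex[v Hv] := H2; apply/cvg_ex; exists v.
by rewrite (cvg_shiftS (series (fun j => t j%:Z x))).
Qed.

Lemma measurable_psum (t : int -> V -> R) M N :
  (forall k, measurable_fun setT (t k)) -> measurable_fun setT (psum t M N).
Proof. by move=> mt; apply: measurable_sum. Qed.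

End two_sided_series.

Section Lp_limit.
Context d (T : measurableType d) (R : realType).
Variable mu : {measure set T -> \bar R}.

(** Apply Fatou's lemma to psi y = max (|y| - del) 0, which is continuous and at most
    del ^ (1 - p) |y| ^ p. This gives |G - f| <= del almost everywhere, for every
    del = 1 / (j + 1). *)
Lemma cvg_Lp_ae_eq (F : nat -> T -> R) (G f : T -> R) (p : R) : 1 < p ->
  (forall m, measurable_fun setT (F m)) -> measurable_fun setT f ->
  (forall x, (fun m => F m x) @ \oo --> G x) ->
  (forall e : R, 0 < e -> exists m0, forall m, (m0 <= m)%N ->
     (\int[mu]_x (`|F m x - f x| `^ p)%:E <= e%:E)%E) ->
  {ae mu, forall x, G x = f x}.
Proof.
move=> p1 mF mf FG HF.
have mG : measurable_fun setT G.
  by apply: (measurable_fun_cvg (h := F)) => // x _; exact: FG.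
have key (j : nat) : {ae mu, forall x, `|G x - f x| <= j.+1%:R^-1}.
  set del : R := j.+1%:R^-1; have del0 : 0 < del by rewrite invr_gt0.
  (* A formula for max (|y| - del) 0 whose continuity is immediate. *)
  pose psi (y : R) := (`|y| - del + `| `|y| - del|) / 2.
  have psiE y : psi y = Num.max (`|y| - del) 0.
    rewrite /psi; move: (`|y| - del) => a.
    by case: (lerP a 0) => h; [rewrite ler0_norm//|rewrite gtr0_norm//]; lra.
  have psi0 y : 0 <= psi y by rewrite psiE le_max lexx orbT.
  have psip y : del `^ (p - 1) * psi y <= `|y| `^ p.
    rewrite psiE; have [yd|yd] := lerP (`|y| - del) 0; first by rewrite mulr0 powR_ge0.
    have yd' : del < `|y| by lra.
    have -> : `|y| `^ p = `|y| `^ (p - 1) * `|y|.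
      rewrite -[X in _ * X]powRr1// -powRD; first by congr (_ `^ _); ring.
      by rewrite (gt_eqF (lt_trans del0 yd')) implybT.
    apply: ler_pM; rewrite ?powR_ge0 ?(ltW yd)//; last by lra.
    by apply: ge0_ler_powR; rewrite ?nnegrE ?(ltW del0) ?(ltW yd')//; lra.
  have mpsi (h : T -> R) : measurable_fun setT h -> measurable_fun setT (fun x => psi (h x)).
    move=> mh; apply: measurable_funM => //.
    have mh' : measurable_fun setT (fun x => `|h x| - del).
      by apply: measurable_funB => //; exact: measurableT_comp.
    by apply: measurable_funD => //; exact: measurableT_comp.
  have Hpsi : (\int[mu]_x `|psi (G x - f x)|%:E = 0)%E.
    apply/eqP; rewrite eq_le; apply/andP; split; last first.
      by apply: integral_ge0 => x _; rewrite lee_fin.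
    apply/lee_addgt0Pr => e e0; rewrite add0e.
    have d0 : 0 < del `^ (p - 1) by rewrite powR_gt0.
    have [m0 Hm0] := HF (del `^ (p - 1) * e) (mulr_gt0 d0 e0).
    apply: (fatou_L1 (f_ := fun m x => psi (F (m + m0)%N x - f x))).
    - by move=> m; apply: mpsi; exact: measurable_funB.
    - apply: aeW => x; have := FG x; rewrite -(cvg_shiftn m0) => Fx.
      have c1 : (fun m => `|F (m + m0)%N x - f x| - del) @ \oo --> `|G x - f x| - del.
        apply: cvgB; last exact: cvg_cst.
        by apply: cvg_norm; apply: cvgB => //; exact: cvg_cst.
      apply: cvgM; last exact: cvg_cst.
      by apply: cvgD => //; exact: cvg_norm.
    - move=> m.
      rewrite -(@lee_pmul2l _ (del `^ (p - 1))%:E)// -ge0_intZ//; last 2 first.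
      + exact: ltW.
      + by apply: measurableT_comp => //; apply: mpsi; exact: measurable_funB.
      rewrite -EFinM; apply: le_trans (Hm0 (m + m0)%N (leq_addl _ _)).
      apply: ge0_le_integralT => x; rewrite lee_fin; first by rewrite mulr_ge0// ltW.
      by rewrite ger0_norm.
  have /ae_eq_integral_abs : measurable_fun setT (fun x => (psi (G x - f x))%:E).
    by apply/measurable_EFinP; apply: mpsi; exact: measurable_funB.
  move=> /(_ mu measurableT) [/(_ Hpsi) + _]; apply: filterS => x /= /(_ I) [].
  by rewrite psiE; case: (lerP (`|G x - f x| - del) 0) => [h _|h h0]; lra.
have := ae_foralln key; apply: filterS => x Hx.
apply/eqP; rewrite -subr_eq0 -normr_le0; apply/ler_addgt0Pr => e e0; rewrite add0r.
have [j _ je] := near_infty_natSinv_lt (PosNum e0).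
exact: le_trans (Hx j) (ltW (je j (leqnn j))).
Qed.

End Lp_limit.

(** * The error in the Hardy norm *)

Section molecular_series.
Context {R : realType} {n : nat}.
Local Notation V := 'rV[R]_n.
Local Notation mu := (@lebesgue_rV R n).

Lemma rtrD (l : 'I_n) (f g : V -> R) e x : 0 < e -> mu.-integrable setT (EFin \o f) ->
  mu.-integrable setT (EFin \o g) ->
  rtr l (fun x => f x + g x) e x = rtr l f e x + rtr l g e x.
Proof.
move=> e0 fi gi; rewrite /rtr /convol -RintegralD//; try exact: integrable_rtr.
by apply: eq_Rintegral => y _; rewrite mulrDr.
Qed.

Lemma integrable_sumR (I : Type) (r : seq I) (t : I -> V -> R) :
  (forall i, mu.-integrable setT (EFin \o t i)) ->
  mu.-integrable setT (EFin \o (fun x => \sum_(i <- r) t i x)).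
Proof.
move=> it; elim: r => [|i r IH].
  by apply: (eq_integrableR (f := fun=> 0)); [move=> x; rewrite big_nil|exact: integrable0].
apply: (eq_integrableR (f := fun x => t i x + \sum_(i <- r) t i x)).
  by move=> x; rewrite big_cons.
exact: integrableDR.
Qed.

Lemma rtr_sum (l : 'I_n) (I : Type) (r : seq I) (t : I -> V -> R) e x : 0 < e ->
  (forall i, mu.-integrable setT (EFin \o t i)) ->
  rtr l (fun x => \sum_(i <- r) t i x) e x = \sum_(i <- r) rtr l (t i) e x.
Proof.
move=> e0 it; elim: r => [|i r IH].
  rewrite big_nil /rtr /convol; under eq_Rintegral do rewrite big_nil mulr0.
  by rewrite /Rintegral integral0.
rewrite big_cons -IH -rtrD//; last exact: integrable_sumR.
by apply: eq_Rintegral => y _; rewrite big_cons.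
Qed.

Variables (h : int -> V -> R) (f : V -> R) (c q : R).
Hypotheses (c0 : 0 <= c) (q01 : 0 < q < 1).
Hypothesis mh : forall k, measurable_fun setT (h k).
Hypothesis hL1 : forall k, (\int[mu]_x `|h k x|%:E <= (c * q ^+ `|k|%N)%:E)%E.
Hypothesis hrtr : forall (l : 'I_n) e k, 0 < e ->
  (\int[mu]_x `|rtr l (h k) e x|%:E <= (c * q ^+ `|k|%N)%:E)%E.
Hypothesis fi : mu.-integrable setT (EFin \o f).
Hypothesis hf : {ae mu, forall x, (fun m => psum h m m x) @ \oo --> f x}.

Let B := c / (1 - q).
Let hi k : mu.-integrable setT (EFin \o h k).
Proof. exact: integrable_le (hL1 k). Qed.

Let integrable_psum M N : mu.-integrable setT (EFin \o psum h M N).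
Proof. exact: integrable_sumR. Qed.

Let mf := integrable_measurable fi.

(** Fatou along the symmetric sums, which converge to f almost everywhere. *)
Lemma psum_L1_error M N :
  (\int[mu]_x `|psum h M N x - f x|%:E <= (B * (q ^+ M + q ^+ N))%:E)%E.
Proof.
apply: (fatou_L1 (f_ := fun m x => psum h M N x - psum h (m + maxn M N) (m + maxn M N) x)).
- by move=> m; apply: measurable_funB; exact: measurable_psum.
- apply: filterS hf => x; rewrite -(cvg_shiftn (maxn M N)) => hx.
  by apply: cvgB => //; exact: cvg_cst.
- move=> m; have Mm : (M <= m + maxn M N)%N by apply: leq_trans (leq_maxl M N) (leq_addl _ _).
  have Nm : (N <= m + maxn M N)%N by apply: leq_trans (leq_maxr M N) (leq_addl _ _).
  apply: le_trans (psum_tail_L1 c0 q01 mh hL1 Mm Nm).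
  by apply: ge0_le_integralT => x; rewrite lee_fin// distrC.
Qed.

(** A truncated Riesz transform is bounded from L^1 to bounded functions ([rtr_le]), so
    that the L^1 convergence of the sums is enough. *)
Lemma rtr_psum_cvg (l : 'I_n) e x M N : 0 < e ->
  (fun m => rtr l (psum h M N) e x - rtr l (psum h m m) e x) @ \oo -->
  rtr l (fun y => psum h M N y - f y) e x.
Proof.
move=> e0; have /andP[q0 q1] := q01; rewrite rtrB//.
apply: cvgB; first exact: cvg_cst.
have qm : (fun m => e ^- n * (B * (q ^+ m + q ^+ m))) @ \oo --> (0 : R).
  have -> : (0 : R) = e ^- n * (B * (0 + 0)) by rewrite addr0 !mulr0.
  have qc : (fun m => q ^+ m) @ \oo --> (0 : R) by apply: cvg_expr; rewrite ger0_norm// ltW.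
  apply: cvgM; first exact: cvg_cst.
  apply: cvgM; first exact: cvg_cst.
  exact: cvgD.
apply/cvgrPdist_le => d d0; have /cvgrPdist_le /(_ d d0) := qm.
apply: filterS => m; rewrite sub0r normrN => Hm.
rewrite distrC -rtrB//; apply: le_trans Hm.
apply: (le_trans _ (ler_norm _)).
apply: le_trans (rtr_le _ _ e0 _) _; first exact: integrableBR.
rewrite ler_wpM2l ?invr_ge0 ?exprn_ge0 ?(ltW e0)//.
rewrite -lee_fin -integrable_normE ?psum_L1_error//.
exact: integrableBR.
Qed.

(** Fatou again: the truncated transforms of psum h M N - psum h m m are bounded in L^1
    term by term, uniformly in e and m. *)
Lemma rtr_psum_L1_error (l : 'I_n) e M N : 0 < e ->
  (\int[mu]_x `|rtr l (fun y => psum h M N y - f y) e x|%:E <=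
   (B * (q ^+ M + q ^+ N))%:E)%E.
Proof.
move=> e0; set j0 := maxn M N.
apply: (fatou_L1 (f_ := fun m x => rtr l (psum h M N) e x -
    rtr l (psum h (m + j0) (m + j0)) e x)).
- move=> m; apply: measurable_funB; apply: measurable_rtr; exact: measurable_psum.
- apply: aeW => x; have := @rtr_psum_cvg l e x M N e0; rewrite -(cvg_shiftn j0); exact.
- move=> m; have Mm : (M <= m + j0)%N by apply: leq_trans (leq_maxl M N) (leq_addl _ _).
  have Nm : (N <= m + j0)%N by apply: leq_trans (leq_maxr M N) (leq_addl _ _).
  have mt k : measurable_fun setT (rtr l (h k) e) by exact: measurable_rtr.
  apply: le_trans (psum_tail_L1 (t := fun k => rtr l (h k) e) c0 q01 mt _ Mm Nm).
    apply: ge0_le_integralT => x; rewrite lee_fin// distrC.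
    by rewrite /psum !rtr_sum.
  by move=> k; exact: hrtr.
Qed.

End molecular_series.

Section molecules_in_H1.
Context {R : realType} {n : nat}.
Local Notation V := 'rV[R]_n.
Local Notation mu := (@lebesgue_rV R n).

(** The constant is the sum of the ones of the n transforms, plus the integral of the
    weight. *)
Lemma complex_molecule (s : R) : n%:R < s -> exists2 C : R, 0 < C &
  forall (g : V -> R[i]) (A r : R), 0 < A -> 0 < r -> cmeas g ->
  (forall x, Normc.normc (g x) <= A * (r ^- n * wgt s (r^-1 *: x))) ->
  cintegral mu setT g = 0 ->
  [/\ (\int[mu]_x (Normc.normc (g x))%:E <= (C * A)%:E)%E,
      forall (l : 'I_n) e, 0 < e ->
        (\int[mu]_x `|rtr l (fun y => complex.Re (g y)) e x|%:E <= (C * A)%:E)%E &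
      forall (l : 'I_n) e, 0 < e ->
        (\int[mu]_x `|rtr l (fun y => complex.Im (g y)) e x|%:E <= (C * A)%:E)%E].
Proof.
move=> ns; have [I I0 HI] := @wgt_integrable R n s ns.
have /choice[D HD] : forall l : 'I_n, exists C : R, 0 < C /\ forall e (g : V -> R) A r,
    0 < e -> 0 < A -> 0 < r -> measurable_fun setT g ->
    (forall x, `|g x| <= A * (r ^- n * wgt s (r^-1 *: x))) -> \int[mu]_x g x = 0 ->
    (\int[mu]_x `|rtr l g e x|%:E <= (C * A)%:E)%E.
  by move=> l; have [C C0 HC] := rtr_molecule l ns; exists C.
have D0 l : 0 <= D l by have [/ltW] := HD l.
pose C := I + \sum_l D l.
have S0 : 0 <= \sum_l D l by apply: sumr_ge0.
exists C => [|g A r A0 r0 mg gA g0]; first by rewrite ltr_pwDl.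
have DC l : D l * A <= C * A.
  rewrite ler_wpM2r ?(ltW A0)// /C (bigD1 l)//= addrCA lerDl addr_ge0 ?(ltW I0)//.
  by apply: sumr_ge0.
have [mr mi] := mg.
have gr : \int[mu]_x complex.Re (g x) = 0 by rewrite -[LHS]/(complex.Re (cintegral mu setT g)) g0.
have gi : \int[mu]_x complex.Im (g x) = 0 by rewrite -[LHS]/(complex.Im (cintegral mu setT g)) g0.
split.
- apply: (@le_trans _ _ (\int[mu]_x (A * dil r^-1 s x)%:E)%E).
    apply: ge0_le_integralT => x; rewrite lee_fin ?normc_ge0// /dil exprVn.
    exact: gA.
  rewrite ge0_intZ ?(ltW A0)//; last 2 first.
  + exact: measurable_dil.
  + by move=> x; rewrite dil_ge0// invr_ge0 ltW.
  apply: (@le_trans _ _ (A%:E * I%:E)%E).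
    apply: lee_wpmul2l; first by rewrite lee_fin ltW.
    by apply: integral_dil => //; rewrite invr_gt0.
  by rewrite -EFinM lee_fin mulrC ler_wpM2r ?(ltW A0)// lerDl.
- move=> l e e0; have [_ H] := HD l.
  apply: (@le_trans _ _ (D l * A)%:E); last by rewrite lee_fin.
  by apply: (H e _ A r) => // x; apply: le_trans (gA x); exact: Re_le_normc.
- move=> l e e0; have [_ H] := HD l.
  apply: (@le_trans _ _ (D l * A)%:E); last by rewrite lee_fin.
  by apply: (H e _ A r) => // x; apply: le_trans (gA x); exact: Im_le_normc.
Qed.

Lemma cLnorm_powR d (T : measurableType d) (m : {measure set T -> \bar R}) (p : R) (F : T -> R[i]) :
  p != 0 -> (\int[m]_x (Normc.normc (F x) `^ p)%:E = cLnorm m p%:E F `^ p)%E.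
Proof.
move=> p0; rewrite /cLnorm (poweR_Lnorm _ _ p0); apply: eq_integral => x _.
by rewrite gee0_abs ?lee_fin ?normc_ge0// poweR_EFin.
Qed.

End molecules_in_H1.

(** * Convergence in the Hardy space *)

Lemma ae_forall_int d (T : measurableType d) (R : realType)
    (mu : {measure set T -> \bar R}) (P : int -> T -> Prop) :
  (forall k, {ae mu, forall x, P k x}) -> {ae mu, forall x, forall k, P k x}.
Proof.
move=> HP.
have H1 := ae_foralln (fun j => HP (Posz j)); have H2 := ae_foralln (fun j => HP (Negz j)).
by apply: filterS2 H1 H2 => x h1 h2 [j|j].
Qed.

Lemma cvg_diag_le (R : realType) (F : nat -> nat -> \bar R) (e : R) : 0 < e ->
  F MN.1 MN.2 @[MN --> (\oo, \oo)] --> 0%E ->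
  exists m0, forall m, (m0 <= m)%N -> (F m m <= e%:E)%E.
Proof.
move=> e0 FF.
have dd : (fun m : nat => (m, m)) @ \oo --> (\oo, \oo).
  by apply: cvg_pair; exact: cvg_id.
have := cvg_comp _ _ dd FF => /fine_cvgP[Ffin /cvgrPdist_le /(_ e e0) Fe].
have [m0 _ Hm] : \forall m \near \oo, (F m m <= e%:E)%E.
  apply: filterS2 Ffin Fe => m /= Fm.
  rewrite sub0r normrN => He; rewrite -(fineK Fm) lee_fin.
  exact: le_trans (ler_norm _) He.
by exists m0 => m; exact: Hm.
Qed.

Theorem theorem1p2 (R : realType) (n : nat) (delta : R)
    (b : 'rV[R]_n -> R[i]) (theta : int -> 'rV[R]_n -> 'rV[R]_n -> R[i]) :
  (0 < n)%N ->
  0 < delta <= 1 ->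
  para_accretive b ->
  square_function_kernels theta ->
  (forall k : int, {ae @lebesgue_rV R n, forall x, Theta theta k b x = 0}) ->
  (forall k : int, {ae @lebesgue_rV R n, forall x, Theta_adj theta k b x = 0}) ->
  (forall f : 'rV[R]_n -> R[i], holder_c0 delta f -> mean_zero (mulop b f) ->
    exists2 p : R, 1 < p &
      series_cvg (in_Lp (@lebesgue_rV R n) p%:E) (cLnorm (@lebesgue_rV R n) p%:E)
        (fun k => mulop b (Theta theta k (mulop b f))) (mulop b f)) ->
  forall phi : 'rV[R]_n -> R[i], holder_c0 delta phi ->
    mean_zero (mulop b phi) ->
    in_H1 (mulop b phi) /\
    series_cvg in_H1 H1norm
      (fun k => mulop b (Theta theta k (mulop b phi))) (mulop b phi).
Proof.
move=> n0 d01 [Hb _ _] Hk Tb Tab Hrep phi Hphi mphi0.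
set mu := @lebesgue_rV R n.
have [C [q [s [C0 q01 ns /choice[g /choice[r Hg]]]]]] :=
  theta_molecules n0 d01 Hb Hk Tb Tab Hphi mphi0.
have /andP[q0 q1] := q01.
have [D D0 HD] := @complex_molecule R n s ns.
pose u k := mulop b (Theta theta k (mulop b phi)).
have s0 : 0 <= s by apply: le_trans (ltW ns).
have [f [A [A0 mf fE fA f0]]] := smooth_molecule n0 d01 s0 Hb Hphi mphi0.
have [f1 fr fi] := HD f A 1 A0 ltr01 mf fA f0.
have [fH1 _] := H1_bound mf fE f1 fr fi.
split; first exact: fH1.
(* Each term is C q ^ |k| times a molecule of some scale r k >= 1. *)
pose c := D * C; have c0 : 0 <= c by rewrite mulr_ge0 ?ltW.
have gmol k : [/\ (\int[mu]_x (Normc.normc (g k x))%:E <= (c * q ^+ `|k|%N)%:E)%E,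
    forall (l : 'I_n) e, 0 < e ->
      (\int[mu]_x `|rtr l (fun y => complex.Re (g k y)) e x|%:E <= (c * q ^+ `|k|%N)%:E)%E &
    forall (l : 'I_n) e, 0 < e ->
      (\int[mu]_x `|rtr l (fun y => complex.Im (g k y)) e x|%:E <= (c * q ^+ `|k|%N)%:E)%E].
  have [r1 mg _ gB g0] := Hg k; rewrite /c -mulrA.
  by apply: (HD (g k) _ (r k)) => //; [rewrite mulr_gt0// exprn_gt0|exact: lt_le_trans r1].
have gle k x : Normc.normc (g k x) <= C * q ^+ `|k|%N.
  have [r1 _ _ gB _] := Hg k; apply: le_trans (gB x) _.
  rewrite ler_piMr ?mulr_ge0 ?exprn_ge0 ?(ltW C0) ?(ltW q0)//.
  rewrite mulr_ile1 ?wgt_le1 ?(ltW (wgt_gt0 _ _)) ?invr_ge0 ?exprn_ge0//.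
  - by apply: le_trans r1.
  - by rewrite invf_le1 ?exprn_gt0 ?exprn_ege1//; apply: lt_le_trans r1.
have uE : {ae mu, forall x, forall k, u k x = g k x}.
  by apply: ae_forall_int => k; have [] := Hg k.
have mg k : cmeas (g k) by have [] := Hg k.
split.
  move=> k; have [_ _ gE _ _] := Hg k; have [g1 gr gi] := gmol k.
  by have [] := H1_bound (mg k) gE g1 gr gi.
(* The symmetric sums converge at every point; their limit is b phi almost
   everywhere, because they converge to b phi in some L^p. *)
have key (P : R[i] -> R) : (forall z, `|P z| <= Normc.normc z) ->
    (forall z w, P (z - w) = P z - P w) ->
    (forall (I : Type) (s : seq I) (F : I -> R[i]),
       P (\sum_(i <- s) F i) = \sum_(i <- s) P (F i)) ->
    (forall k, measurable_fun setT (fun x => P (g k x))) ->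
    measurable_fun setT (fun x => P (f x)) ->
    {ae mu, forall x, (fun m => psum (fun k x => P (g k x)) m m x) @ \oo --> P (f x)}.
  move=> Pn PB Ps mPg mPf.
  have cv x : cvg ((fun m => psum (fun k x => P (g k x)) m m x) @ \oo).
    apply: (psum_cvg (c := C) (q := q)) => //; first exact: ltW.
    by move=> k; apply: le_trans (Pn _) (gle k x).
  have [p p1 [_ cvp]] := Hrep phi Hphi mphi0.
  have p0 : 0 < p by apply: lt_trans p1.
  have H : {ae mu, forall x,
      lim ((fun m => psum (fun k x => P (g k x)) m m x) @ \oo) = P (f x)}.
    apply: (cvg_Lp_ae_eq (F := fun m => psum (fun k x => P (g k x)) m m) p1) => //.
      by move=> m; exact: measurable_psum.
    move=> e e0.
    have e1 : 0 < e `^ p^-1 by rewrite powR_gt0.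
    have [m0 Hm0] := cvg_diag_le
      (F := fun M N => cLnorm mu p%:E (fun x => psum u M N x - mulop b phi x)) e1 cvp.
    exists m0 => m mm0.
    apply: (@le_trans _ _ (\int[mu]_x (Normc.normc (psum u m m x - mulop b phi x) `^ p)%:E)%E).
      apply: ge0_ae_le_integral => [x|x|]; rewrite ?lee_fin ?powR_ge0//.
      apply: filterS2 uE fE => x ux fx; rewrite lee_fin.
      apply: ge0_ler_powR; rewrite ?nnegrE ?normc_ge0 ?(ltW p0)//.
      rewrite fx; apply: le_trans (Pn _); rewrite PB /psum Ps.
      by under [in leRHS]eq_bigr do rewrite ux.
    rewrite cLnorm_powR ?gt_eqF//.
    have -> : e%:E = ((e `^ p^-1)%:E `^ p)%E.
      by rewrite poweR_EFin -powRrM mulVf ?gt_eqF// powRr1// ltW.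
    apply: gt0_ler_poweR; rewrite ?(ltW p0)//; last exact: Hm0.
    - by rewrite in_itv/= leey andbT Lnorm_ge0.
    - by rewrite in_itv/= leey andbT lee_fin ltW.
  by apply: filterS H => x <-; exact: cv.
have [mfr mfi] := mf; have [ifr ifi] := cintable_le mf f1.
have mgr k : measurable_fun setT (fun x => complex.Re (g k x)) by case: (mg k).
have mgi k : measurable_fun setT (fun x => complex.Im (g k x)) by case: (mg k).
have cr := key _ (@Re_le_normc R) (@ReB R) (fun I s F => Re_sum s xpredT F) mgr mfr.
have ci := key _ (@Im_le_normc R) (@ImB R) (fun I s F => Im_sum s xpredT F) mgi mfi.
have gr1 k : (\int[mu]_x `|complex.Re (g k x)|%:E <= (c * q ^+ `|k|%N)%:E)%E.
  have [g1 _ _] := gmol k; apply: le_trans g1; apply: ge0_le_integralT => x; rewrite lee_fin//.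
  exact: Re_le_normc.
have gi1 k : (\int[mu]_x `|complex.Im (g k x)|%:E <= (c * q ^+ `|k|%N)%:E)%E.
  have [g1 _ _] := gmol k; apply: le_trans g1; apply: ge0_le_integralT => x; rewrite lee_fin//.
  exact: Im_le_normc.
have grr (l : 'I_n) e k (e0 : 0 < e) :
    (\int[mu]_x `|rtr l (fun y => complex.Re (g k y)) e x|%:E <= (c * q ^+ `|k|%N)%:E)%E.
  by have [_ gr _] := gmol k; exact: gr.
have gir (l : 'I_n) e k (e0 : 0 < e) :
    (\int[mu]_x `|rtr l (fun y => complex.Im (g k y)) e x|%:E <= (c * q ^+ `|k|%N)%:E)%E.
  by have [_ _ gi] := gmol k; exact: gi.
pose B := c / (1 - q).
pose Z := 2 * B + n%:R * (2 * (`|riesz_cst R n| * B)).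
have bound M N :
    (H1norm (fun x => psum u M N x - mulop b phi x)%R <= (Z * (q ^+ M + q ^+ N))%:E)%E.
  pose d x := psum g M N x - f x.
  have md : cmeas d by apply: cmeasB => //; exact: cmeas_sum.
  have dE : {ae mu, forall x, psum u M N x - mulop b phi x = d x}.
    apply: filterS2 uE fE => x ux fx; rewrite fx /d; congr (_ - _).
    by apply: eq_bigr => i _; rewrite ux.
  have dRe y : complex.Re (d y) = psum (fun k x => complex.Re (g k x)) M N y - complex.Re (f y).
    by rewrite /d ReB /psum Re_sum.
  have dIm y : complex.Im (d y) = psum (fun k x => complex.Im (g k x)) M N y - complex.Im (f y).
    by rewrite /d ImB /psum Im_sum.
  have d1 : (\int[mu]_x (Normc.normc (d x))%:E <= (2 * (B * (q ^+ M + q ^+ N)))%:E)%E.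
    apply: (@le_trans _ _ (\int[mu]_x (`|complex.Re (d x)| + `|complex.Im (d x)|)%:E)%E).
      by apply: ge0_le_integralT => x; rewrite lee_fin ?normc_ge0// normc_le_ReIm.
    have [mdr mdi] := md.
    rewrite ge0_intD//; try exact: measurableT_comp.
    rewrite mulr_natl mulr2n EFinD; apply: leeD.
    - under eq_integral do rewrite dRe.
      exact: (psum_L1_error c0 q01 mgr gr1 cr).
    - under eq_integral do rewrite dIm.
      exact: (psum_L1_error c0 q01 mgi gi1 ci).
  have dr (l : 'I_n) e : 0 < e ->
      (\int[mu]_x `|rtr l (fun y => complex.Re (d y)) e x|%:E <= (B * (q ^+ M + q ^+ N))%:E)%E.
    rewrite (_ : (fun y => complex.Re (d y)) =
      (fun y => psum (fun k x => complex.Re (g k x)) M N y - complex.Re (f y))); last exact/funext.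
    exact: (rtr_psum_L1_error c0 q01 mgr gr1 grr ifr cr).
  have di (l : 'I_n) e : 0 < e ->
      (\int[mu]_x `|rtr l (fun y => complex.Im (d y)) e x|%:E <= (B * (q ^+ M + q ^+ N))%:E)%E.
    rewrite (_ : (fun y => complex.Im (d y)) =
      (fun y => psum (fun k x => complex.Im (g k x)) M N y - complex.Im (f y))); last exact/funext.
    exact: (rtr_psum_L1_error c0 q01 mgi gi1 gir ifi ci).
  have [_ H] := H1_bound md dE d1 dr di.
  apply: le_trans H _; rewrite lee_fin le_eqVlt; apply/orP; left; apply/eqP.
  by rewrite /Z; ring.
(* The Hardy norm of the error is at most Z (q ^ M + q ^ N). *)
apply: (@squeeze_cvge _ _ _ R (cst 0%E) _ (fun MN => (Z * (q ^+ MN.1 + q ^+ MN.2))%:E)).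
- apply: nearW => -[M N] /=; rewrite bound andbT.
  apply: adde_ge0; first exact: Lnorm_ge0.
  by apply: sume_ge0 => l _; exact: Lnorm_ge0.
- exact: cvg_cst.
- apply: cvg_EFin; first exact: nearW.
  have qc : (fun m => q ^+ m) @ \oo --> (0 : R) by apply: cvg_expr; rewrite ger0_norm// ltW.
  have -> : (0 : R) = Z * (0 + 0) by rewrite addr0 mulr0.
  apply: cvgM; first exact: cvg_cst.
  apply: cvgD.
  + exact: (cvg_comp _ _ cvg_fst qc).
  + exact: (cvg_comp _ _ cvg_snd qc).
Qed.
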